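(* Fix $0<r<R$ and set, for $x=(x_1,x_2,x_3)\in\mathbb T^3$, $$b_1(x)=1,\qquad b_2(x)=(R+r\cos x_3)\mathrm e^{\mathrm ix_1},\qquad b_3(x)=(R+r\sin x_3)\mathrm e^{\mathrm ix_2}.$$ Then, for every integer $k\ge1$, the space $\mathscr W_\infty$ generated by $b_1,b_2,b_3$ satisfies $$\overline{\mathscr W_\infty}^{\,C^k}=C^k(\mathbb T^3;\mathbb C),$$ and in particular these three profiles are cubic saturating. Moreover, three profiles are minimal among complex profile families with $C^1$ dense saturation: if $b_1,\dots,b_m\in C^\infty(\mathbb T^3;\mathbb C)$ is any family whose space $\mathscr W_\infty$ is dense in $C^1(\mathbb T^3;\mathbb C)$, then $m\ge3$.
   Context: $\mathbb T^3=(\mathbb R/2\pi\mathbb Z)^3$. For a finite family $b_1,\dots,b_m\in C^\infty(\mathbb T^3;\mathbb C)$, let $\mathsf N(z)=|z|^2z$, $\mathsf Jz=\mathrm iz$, with third real derivative $D^3\mathsf N[h,k,\ell]=2(hk\bar\ell+h\ell\bar k+k\ell\bar h)$. Put $\mathscr W_0=\operatorname{span}_{\mathbb R}\{b_1,\dots,b_m\}$, $$\mathscr W_{n+1}=\operatorname{span}_{\mathbb R}\bigl(\mathscr W_n\cup\{\mathsf JD^3\mathsf N[\phi,h,k]:\phi\in\mathscr W_n,\ h,k\in\mathscr W_0\}\bigr),\qquad\mathscr W_\infty=\bigcup_{n\ge0}\mathscr W_n.$$ The family is cubic saturating if $\mathscr W_\infty$ is dense in $H^1(\mathbb T^3;\mathbb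 C)$. *)

(* Defs.v *)
From HB Require Import structures.
From mathcomp Require Import all_boot all_order all_algebra.
From mathcomp Require Import complex.
From mathcomp Require Import all_classical all_reals all_analysis.
From mathcomp Require Import ring.

Set Implicit Arguments.
Unset Strict Implicit.
Unset Printing Implicit Defensive.

Import Order.TTheory GRing.Theory Num.Theory.
Import numFieldNormedType.Exports.

Local Open Scope classical_set_scope.
Local Open Scope ring_scope.
Local Open Scope complex_scope.

(* A point (x_1, x_2, x_3) is the nested pair x with x_1 = x.1.1,
   x_2 = x.1.2, x_3 = x.2; a function on the torus (R / 2 pi Z)^3 is a
   function on R^3 that is 2 pi-periodic in each coordinate. *)
Notation euclid3 R := (R * R * R)%type.

Section Torus.
Context {R : realType}.
Implicit Types (f g : euclid3 R -> R[i]) (k : nat) (i : 'I_3) (x : euclid3 R).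

Definition evec i : euclid3 R :=
  ((((i == 0 :> nat)%N)%:R, ((i == 1 :> nat)%N)%:R), ((i == 2 :> nat)%N)%:R).

Definition torus_fun f := forall i, periodic f ((pi *+ 2) *: evec i).

Definition re_part f : euclid3 R -> R := fun x => complex.Re (f x).
Definition im_part f : euclid3 R -> R := fun x => complex.Im (f x).

Definition partial i f : euclid3 R -> R[i] :=
  fun x => 'D_(evec i) (re_part f) x +i* 'D_(evec i) (im_part f) x.

Definition cderivable i f := forall x,
  derivable (re_part f) x (evec i) /\ derivable (im_part f) x (evec i).

Definition ccontinuous f := continuous (re_part f) /\ continuous (im_part f).

Fixpoint diff_class k f : Prop :=
  ccontinuous f /\
  if k is k'.+1 then forall i, cderivable i f /\ diff_class k' (partial i f)
  else True.

Definition Ck k : set (euclid3 R -> R[i]) :=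
  [set f | torus_fun f /\ diff_class k f].

Definition Cinfty : set (euclid3 R -> R[i]) := \bigcap_k Ck k.

(* sup of |d^s f (x)| over all x and all words s of at most k derivations *)
Definition Ck_norm k f : \bar R :=
  ereal_sup [set (Normc.normc (foldr partial f s x))%:E
            | s in [set s : seq 'I_3 | (size s <= k)%N] & x in [set: euclid3 R]].

Definition Ck_closure k (W : set (euclid3 R -> R[i])) : set (euclid3 R -> R[i]) :=
  [set f | Ck k f /\ forall e : R, 0 < e ->
     exists2 w, (W `&` Ck k) w & (Ck_norm k (f \- w)%R < e%:E)%E].

Local Notation leb3 := ((@lebesgue_measure R \x @lebesgue_measure R)
                          \x @lebesgue_measure R)%E.

(* [0, 2 pi]^3 *)
Definition cell : set (euclid3 R) :=
  (`[0, pi *+ 2] `*` `[0, pi *+ 2]) `*` `[0, pi *+ 2].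

Definition L2_sqnorm f : \bar R :=
  (\int[leb3]_(x in cell) ((Normc.normc (f x)) ^+ 2)%:E)%E.

(* R^3 with the sigma-algebra on which the measure leb3 is defined *)
Local Notation borel3 :=
  (measurableTypeR R * measurableTypeR R * measurableTypeR R)%type.

Definition L2 : set (euclid3 R -> R[i]) :=
  [set f | [/\ torus_fun f,
               measurable_fun [set: borel3] (re_part f : borel3 -> R),
               measurable_fun [set: borel3] (im_part f : borel3 -> R) &
               (L2_sqnorm f < +oo)%E]].

Definition cintegral f : R[i] :=
  Rintegral leb3 cell (re_part f) +i* Rintegral leb3 cell (im_part f).

Definition weak_partials i f : set (euclid3 R -> R[i]) :=
  [set g | L2 g /\ forall phi, Cinfty phi ->
     cintegral (f \* partial i phi) = - cintegral (g \* phi)].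

Definition H1 : set (euclid3 R -> R[i]) :=
  [set f | L2 f /\ forall i, exists g, weak_partials i f g].

(* weak derivatives are unique almost everywhere, so that on H1 this value
   does not depend on the choice made by xget *)
Definition H1_norm f : \bar R :=
  sqrte (L2_sqnorm f +
         \sum_(i < 3) L2_sqnorm (xget (fun=> 0%R) (weak_partials i f)))%E.

Definition H1_dense (W : set (euclid3 R -> R[i])) :=
  forall f, H1 f -> forall e : R, 0 < e ->
    exists2 w, (W `&` H1) w & (H1_norm (f \- w)%R < e%:E)%E.

Definition real_span (S : set (euclid3 R -> R[i])) : set (euclid3 R -> R[i]) :=
  [set f | exists n (c : 'I_n -> R) (s : 'I_n -> euclid3 R -> R[i]),
     (forall j, S (s j)) /\ f = \sum_(j < n) (c j)%:C *: s j].

Definition cubicN (z : R[i]) : R[i] := `|z| ^+ 2 * z.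

Definition opJ (z : R[i]) : R[i] := 'i%C * z.

Definition D3N (h k l : R[i]) : R[i] :=
  2 * (h * k * l^*%C + h * l * k^*%C + k * l * h^*%C).

(* By the next three lemmas D3N is the polarization of the real-homogeneous
   cubic cubicN, i.e. its third real derivative (constant in the base point) *)
Lemma D3N_symmetric (h k l : R[i]) : D3N h k l = D3N k h l /\ D3N h k l = D3N h l k.
Proof. by rewrite /D3N; split; ring. Qed.

Lemma D3N_linear (a : R) (h h' k l : R[i]) :
  D3N (a%:C * h + h') k l = a%:C * D3N h k l + D3N h' k l.
Proof.
case: h => h1 h2; case: h' => h1' h2'; case: k => k1 k2; case: l => l1 l2.
by rewrite /D3N; apply/eqP; rewrite eq_complex /=; apply/andP; split; apply/eqP; ring.
Qed.

Lemma D3N_diag (z : R[i]) : D3N z z z = 6 * cubicN z.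
Proof. by rewrite /D3N /cubicN sqr_normc; ring. Qed.

Fixpoint satW m (b : 'I_m -> euclid3 R -> R[i]) n : set (euclid3 R -> R[i]) :=
  if n is n'.+1 then
    real_span (satW b n' `|`
      [set f | exists phi g h, [/\ satW b n' phi, real_span (range b) g,
                 real_span (range b) h &
                 f = fun x => opJ (D3N (phi x) (g x) (h x))]])
  else real_span (range b).

Definition satW_infty m (b : 'I_m -> euclid3 R -> R[i]) : set (euclid3 R -> R[i]) :=
  \bigcup_n satW b n.

Definition cubic_saturating m (b : 'I_m -> euclid3 R -> R[i]) :=
  (forall j, Cinfty (b j)) /\ H1_dense (satW_infty b).

Definition expi (t : R) : R[i] := cos t +i* sin t.

Definition torus_profiles (r R0 : R) : 'I_3 -> euclid3 R -> R[i] :=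
  tnth [tuple (fun=> 1);
              (fun x => (R0 + r * cos x.2)%:C * expi x.1.1);
              (fun x => (R0 + r * sin x.2)%:C * expi x.1.2)].

End Torus.

(* Main.v *)
Require Import Defs.
From HB Require Import structures.
From mathcomp Require Import all_boot all_order all_algebra.
From mathcomp Require Import complex.
From mathcomp Require Import all_classical all_reals all_analysis.
From mathcomp Require Import measurable_realfun.
From mathcomp Require Import zify ring lra.

(* Only the operators with h = b_1 = 1 are needed.  For real f in W_infinity,
   the values i D^3 N [f, 1, b_j] and i D^3 N [i f, 1, b_j], combined with the
   rotation f |-> i D^3 N [f, 1, 1], show that f Re b_j and f Im b_j are again
   in W_infinity; so W_infinity contains every complex polynomial in the real
   and imaginary parts of b_2 and b_3.  The C^k closure of this algebra is
   closed under inversion of positive functions (Neumann series).  From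
   |b_2|^2 + |b_3|^2 and |b_2|^2 - |b_3|^2 it contains cos x_3 and sin x_3,
   and dividing b_2 and b_3 by their moduli it contains e^(i x_1), e^(i x_2),
   hence all trigonometric polynomials.

   Fejer means commute with derivatives (the Fourier coefficients of d_i f are
   i n_i times those of f) and converge uniformly for continuous f (Korovkin),
   which gives density in C^k.  For H^1, the truncated Fourier series of f and
   of its weak derivatives converge in L^2.

   Minimality: for m <= 2, at a maximum point x0 of sum |b_j|^2 the 4 x 2m real
   matrix with rows d_i b_j (i = 1, 2, 3) and - i b_j has rank at most 3, since
   the column vector of the b_j (x0) is in its kernel.  So some real
   (v, theta) <> 0 satisfies d_v b_j (x0) = i theta b_j (x0) for all j, and
   this phase relation is inherited by W_infinity and its C^1 closure. *)

Import Order.TTheory GRing.Theory Num.Theory.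
Import numFieldNormedType.Exports.

Local Open Scope classical_set_scope.
Local Open Scope ring_scope.
Local Open Scope complex_scope.

Set Implicit Arguments.
Unset Strict Implicit.
Unset Printing Implicit Defensive.

(** [satW_infty] is only a real vector space, and nothing makes it stable under products. Products
    therefore enter through operators: a multiplier is a smooth f such that multiplication by Re f
    and by Im f preserves the real functions a for which both a and i a lie in W. Multipliers
    compose, so they form a unital star algebra, and letting one act on a = 1 puts it into W.
    Inverses exist only as limits, so all divisions take place in a closure of smooth functions for
    every C^k at once, which is again a star algebra. For H^1, a Fourier sum is the best mean square
    approximation from its own frequencies. Frequency sets can thus be enlarged at no cost, and one
    finite set serves f and its three weak derivatives. Squared norms with the factor 2 of (a + b)^2
    <= 2 a^2 + 2 b^2 replace the triangle inequality throughout. For minimality with m = 2, the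
    matrix is 4 x 4, so counting dimensions alone yields no relation; the critical point of the sum
    of the |b_j|^2 supplies the missing kernel vector. *)

Local Notation normc := Normc.normc.

(** * Real and imaginary parts and the modulus of complex numbers *)

Section ComplexParts.
Context {R : rcfType}.
Implicit Types (z w : R[i]) (a : R).

Lemma ReD z w : complex.Re (z + w) = complex.Re z + complex.Re w.
Proof. by case: z; case: w. Qed.
Lemma ImD z w : complex.Im (z + w) = complex.Im z + complex.Im w.
Proof. by case: z; case: w. Qed.
Lemma ReN z : complex.Re (- z) = - complex.Re z.
Proof. by case: z. Qed.
Lemma ImN z : complex.Im (- z) = - complex.Im z.
Proof. by case: z. Qed.
Lemma ReM z w : complex.Re (z * w) =
  complex.Re z * complex.Re w - complex.Im z * complex.Im w.
Proof. by case: z; case: w. Qed.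
Lemma ImM z w : complex.Im (z * w) =
  complex.Re z * complex.Im w + complex.Im z * complex.Re w.
Proof. by case: z; case: w. Qed.

Lemma complexP z w : complex.Re z = complex.Re w ->
  complex.Im z = complex.Im w -> z = w.
Proof. by case: z => a b; case: w => c d /= -> ->. Qed.

Lemma conjcM z w : (z * w)^*%C = z^*%C * w^*%C.
Proof. exact: rmorphM. Qed.

Lemma conjc_sum (I : Type) (s : seq I) (F : I -> R[i]) :
  (\sum_(j <- s) F j)^*%C = \sum_(j <- s) (F j)^*%C.
Proof. exact: rmorph_sum. Qed.

Lemma normc_ge0 z : 0 <= normc z.
Proof. by case: z => a b; exact: sqrtr_ge0. Qed.

Lemma normc_real a : normc a%:C = `|a|.
Proof. by rewrite /= expr0n addr0 sqrtr_sqr. Qed.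

Lemma normc_conj z : normc z^*%C = normc z.
Proof. by case: z => a b /=; rewrite sqrrN. Qed.

Lemma sqr_normcE z :
  normc z ^+ 2 = complex.Re z ^+ 2 + complex.Im z ^+ 2.
Proof. by case: z => a b /=; rewrite sqr_sqrtr // addr_ge0 ?sqr_ge0. Qed.

Lemma normc_geRe z : `|complex.Re z| <= normc z.
Proof.
rewrite -[leLHS]sqrtr_sqr; case: z => a b /=.
by rewrite ler_sqrt ?addr_ge0 ?sqr_ge0 // lerDl sqr_ge0.
Qed.

Lemma normc_geIm z : `|complex.Im z| <= normc z.
Proof.
rewrite -[leLHS]sqrtr_sqr; case: z => a b /=.
by rewrite ler_sqrt ?addr_ge0 ?sqr_ge0 // lerDr sqr_ge0.
Qed.

Lemma normc_le_ReIm z : normc z <= `|complex.Re z| + `|complex.Im z|.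
Proof.
rewrite -(ler_pXn2r (n := 2)) ?nnegrE ?addr_ge0 ?normc_ge0 //.
rewrite sqr_normcE sqrrD !real_normK ?num_real // -addrA [X in _ <= _ + X]addrC.
by rewrite addrA lerDl mulrn_wge0 // mulr_ge0.
Qed.

End ComplexParts.

(** * Calculus of partial derivatives and the smooth periodic functions *)

Section PartialDerivatives.
Context {R : realType}.
Implicit Types (f g : euclid3 R -> R[i]) (k : nat) (i : 'I_3) (x : euclid3 R).

Lemma re_partD f g : re_part (f \+ g) = (re_part f + re_part g)%R.
Proof. by apply/funext => x; exact: ReD. Qed.
Lemma im_partD f g : im_part (f \+ g) = (im_part f + im_part g)%R.
Proof. by apply/funext => x; exact: ImD. Qed.
Lemma re_partM f g : re_part (f \* g) =
  (re_part f * re_part g - im_part f * im_part g)%R.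
Proof. by apply/funext => x; exact: ReM. Qed.
Lemma im_partM f g : im_part (f \* g) =
  (re_part f * im_part g + im_part f * re_part g)%R.
Proof. by apply/funext => x; exact: ImM. Qed.

Lemma cderivable_cst i (c : R[i]) : cderivable i (fun=> c).
Proof. by move=> x; split; exact: derivable_cst. Qed.

Lemma partial_cst i (c : R[i]) : partial i (fun=> c) = fun=> 0.
Proof.
apply/funext => x; rewrite /partial.
by rewrite (_ : re_part _ = cst (complex.Re c)) // (_ : im_part _ = cst (complex.Im c)) //
  !derive_cst.
Qed.

Lemma cderivableD i f g :
  cderivable i f -> cderivable i g -> cderivable i (f \+ g).
Proof.
move=> df dg x; have [df1 df2] := df x; have [dg1 dg2] := dg x.
by rewrite re_partD im_partD; split; [exact: derivableD df1 dg1|exact: derivableD df2 dg2].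
Qed.

Lemma partialD i f g : cderivable i f -> cderivable i g ->
  partial i (f \+ g) = partial i f \+ partial i g.
Proof.
move=> df dg; apply/funext => x; have [df1 df2] := df x; have [dg1 dg2] := dg x.
by rewrite /partial re_partD im_partD (deriveD df1 dg1) (deriveD df2 dg2).
Qed.

Lemma cderivableM i f g :
  cderivable i f -> cderivable i g -> cderivable i (f \* g).
Proof.
move=> df dg x; have [df1 df2] := df x; have [dg1 dg2] := dg x.
rewrite re_partM im_partM; split.
  exact: derivableB (derivableM df1 dg1) (derivableM df2 dg2).
exact: derivableD (derivableM df1 dg2) (derivableM df2 dg1).
Qed.

Lemma partialM i f g : cderivable i f -> cderivable i g ->
  partial i (f \* g) = (partial i f \* g) \+ (f \* partial i g).
Proof.
move=> df dg; apply/funext => x; have [df1 df2] := df x; have [dg1 dg2] := dg x.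
rewrite /partial re_partM im_partM.
rewrite (deriveB (derivableM df1 dg1) (derivableM df2 dg2)).
rewrite (deriveD (derivableM df1 dg2) (derivableM df2 dg1)).
rewrite (deriveM df1 dg1) (deriveM df1 dg2) (deriveM df2 dg1) (deriveM df2 dg2) /=.
move: ('D_(evec i) (re_part f) x) ('D_(evec i) (im_part f) x).
move: ('D_(evec i) (re_part g) x) ('D_(evec i) (im_part g) x).
rewrite /re_part /im_part /GRing.scale /=.
by move: (f x) (g x) => [a b] [c d] p q u v /=; congr (_ +i* _); ring.
Qed.

Lemma cderivable_conj i f :
  cderivable i f -> cderivable i (fun x => (f x)^*%C).
Proof.
move=> df x; have [df1 df2] := df x.
rewrite (_ : re_part _ = re_part f); last first.
  by apply/funext => y; rewrite /re_part; case: (f y).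
rewrite (_ : im_part _ = - im_part f); last first.
  by apply/funext => y; rewrite fctE /im_part; case: (f y).
by split; [exact: df1|exact: derivableN df2].
Qed.

Lemma partial_conj i f : cderivable i f ->
  partial i (fun x => (f x)^*%C) = fun x => (partial i f x)^*%C.
Proof.
move=> df; apply/funext => x; have [df1 df2] := df x; rewrite /partial.
rewrite (_ : re_part _ = re_part f); last first.
  by apply/funext => y; rewrite /re_part; case: (f y).
rewrite (_ : im_part _ = - im_part f); last first.
  by apply/funext => y; rewrite fctE /im_part; case: (f y).
by rewrite (deriveN df2).
Qed.

Lemma ccontinuousD f g :
  ccontinuous f -> ccontinuous g -> ccontinuous (f \+ g).
Proof.
move=> [cf1 cf2] [cg1 cg2]; rewrite /ccontinuous re_partD im_partD.
by split => x; [exact: continuousD (cf1 x) (cg1 x)|exact: continuousD (cf2 x) (cg2 x)].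
Qed.

Lemma ccontinuousM f g :
  ccontinuous f -> ccontinuous g -> ccontinuous (f \* g).
Proof.
move=> [cf1 cf2] [cg1 cg2]; rewrite /ccontinuous re_partM im_partM.
split => x.
  exact: continuousB (continuousM (cf1 x) (cg1 x)) (continuousM (cf2 x) (cg2 x)).
exact: continuousD (continuousM (cf1 x) (cg2 x)) (continuousM (cf2 x) (cg1 x)).
Qed.

Lemma ccontinuous_cst (c : R[i]) : ccontinuous (fun=> c : R[i]).
Proof. by split => x; exact: cvg_cst. Qed.

Lemma ccontinuous_conj f :
  ccontinuous f -> ccontinuous (fun x => (f x)^*%C).
Proof.
move=> [cf1 cf2]; split.
  rewrite (_ : re_part _ = re_part f)//.
  by apply/funext => y; rewrite /re_part; case: (f y).
rewrite (_ : im_part _ = - im_part f); last first.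
  by apply/funext => y; rewrite fctE /im_part; case: (f y).
by move=> x; exact: continuousN (cf2 x).
Qed.

Lemma diff_class_ccontinuous k f : diff_class k f -> ccontinuous f.
Proof. by case: k => [|k] []. Qed.

Lemma diff_classS k f : diff_class k.+1 f -> diff_class k f.
Proof.
elim: k f => [|k IH] f [cf df]; split => // i; have [di pi] := df i.
by split => //; exact: IH.
Qed.

Lemma diff_class_cst k (c : R[i]) : diff_class k (fun=> c).
Proof.
elim: k c => [|k IH] c; split => //; try exact: ccontinuous_cst.
by move=> i; split; [exact: cderivable_cst|rewrite partial_cst].
Qed.

Lemma diff_classD k f g :
  diff_class k f -> diff_class k g -> diff_class k (f \+ g).
Proof.
elim: k f g => [|k IH] f g [cf df] [cg dg]; split => //; try exact: ccontinuousD.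
move=> i; have [df1 df2] := df i; have [dg1 dg2] := dg i.
by split; [exact: cderivableD|rewrite partialD//; exact: IH].
Qed.

Lemma diff_classM k f g :
  diff_class k f -> diff_class k g -> diff_class k (f \* g).
Proof.
elim: k f g => [|k IH] f g [cf df] [cg dg]; split => //; try exact: ccontinuousM.
move=> i; have [df1 df2] := df i; have [dg1 dg2] := dg i.
split; first exact: cderivableM.
rewrite partialM//; apply: diff_classD; apply: IH => //; exact: diff_classS.
Qed.

Lemma diff_class_conj k f :
  diff_class k f -> diff_class k (fun x => (f x)^*%C).
Proof.
elim: k f => [|k IH] f [cf df]; split => //; try exact: ccontinuous_conj.
move=> i; have [df1 df2] := df i.
by split; [exact: cderivable_conj|rewrite partial_conj//; exact: IH].
Qed.

Lemma torus_cst (c : R[i]) : torus_fun (fun=> c).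
Proof. by move=> i x. Qed.

Lemma torusD f g : torus_fun f -> torus_fun g -> torus_fun (f \+ g).
Proof. by move=> tf tg i x /=; rewrite tf tg. Qed.

Lemma torusM f g : torus_fun f -> torus_fun g -> torus_fun (f \* g).
Proof. by move=> tf tg i x /=; rewrite tf tg. Qed.

Lemma torus_conj f : torus_fun f -> torus_fun (fun x => (f x)^*%C).
Proof. by move=> tf i x /=; rewrite tf. Qed.

(** The difference quotients at [x + v] and at [x] are the same function when v is a period, so
    their limits agree, default values included. *)
Lemma torus_partial i f : torus_fun f -> torus_fun (partial i f).
Proof.
move=> tf j x; have E (g : euclid3 R -> R) (v : euclid3 R) :
    (forall y, g (y + v) = g y) -> 'D_(evec i) g (x + v) = 'D_(evec i) g x.
  move=> gv; rewrite /derive.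
  have -> : g \o shift (x + v) = g \o shift x.
    by apply/funext => y /=; rewrite addrA gv.
  by rewrite gv.
by rewrite /partial !E // => y; rewrite /re_part /im_part tf.
Qed.

Lemma CinftyP f : Cinfty f <-> torus_fun f /\ forall k, diff_class k f.
Proof.
split=> [Cf|[tf Cf] k _]; last by split.
by split=> [|k]; [have [] := Cf 0%N I|have [] := Cf k I].
Qed.

Lemma Cinfty_cst (c : R[i]) : Cinfty (fun=> c).
Proof. by apply/CinftyP; split; [exact: torus_cst|move=> k; exact: diff_class_cst]. Qed.

Lemma CinftyD f g : Cinfty f -> Cinfty g -> Cinfty (f \+ g).
Proof.
move=> /CinftyP[tf df] /CinftyP[tg dg]; apply/CinftyP.
by split; [exact: torusD|move=> k; exact: diff_classD].
Qed.

Lemma CinftyM f g : Cinfty f -> Cinfty g -> Cinfty (f \* g).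
Proof.
move=> /CinftyP[tf df] /CinftyP[tg dg]; apply/CinftyP.
by split; [exact: torusM|move=> k; exact: diff_classM].
Qed.

Lemma Cinfty_conj f : Cinfty f -> Cinfty (fun x => (f x)^*%C).
Proof.
move=> /CinftyP[tf df]; apply/CinftyP.
by split; [exact: torus_conj|move=> k; exact: diff_class_conj].
Qed.

Lemma Cinfty_cderivable i f : Cinfty f -> cderivable i f.
Proof. by move=> /CinftyP[_ /(_ 1%N)[_ /(_ i)[]]]. Qed.

Lemma Cinfty_partial i f : Cinfty f -> Cinfty (partial i f).
Proof.
move=> /CinftyP[tf df]; apply/CinftyP; split; first exact: torus_partial.
by move=> k; have [_ /(_ i)[]] := df k.+1.
Qed.

Lemma CinftyZ (c : R[i]) f : Cinfty f -> Cinfty (fun x => c * f x).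
Proof. by apply: CinftyM; exact: Cinfty_cst. Qed.

Lemma CinftyB f g : Cinfty f -> Cinfty g -> Cinfty (f \- g).
Proof.
move=> Cf Cg; rewrite (_ : f \- g = f \+ (fun x => (-1) * g x)).
  by apply: CinftyD => //; exact: CinftyZ.
by apply/funext => x /=; rewrite mulN1r.
Qed.

Lemma Cinfty_sum (I : Type) (s : seq I) (F : I -> euclid3 R -> R[i]) :
  (forall j, Cinfty (F j)) -> Cinfty (fun x => \sum_(j <- s) F j x).
Proof.
move=> CF; elim: s => [|j s IH].
  by rewrite (_ : (fun _ => _) = fun=> 0); [exact: Cinfty_cst|];
    apply/funext => x; rewrite big_nil.
rewrite (_ : (fun _ => _) = F j \+ (fun x => \sum_(j <- s) F j x)).
  exact: CinftyD.
by apply/funext => x; rewrite big_cons.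
Qed.

Lemma partialZ i (c : R[i]) f : cderivable i f ->
  partial i (fun x => c * f x) = fun x => c * partial i f x.
Proof.
move=> df; rewrite (partialM (cderivable_cst i c) df) partial_cst.
by apply/funext => x /=; rewrite mul0r add0r.
Qed.

Lemma cderivableZ i (c : R[i]) f :
  cderivable i f -> cderivable i (fun x => c * f x).
Proof. by move=> df; exact: cderivableM (cderivable_cst i c) df. Qed.

Lemma partialB i f g : cderivable i f -> cderivable i g ->
  partial i (f \- g) = partial i f \- partial i g.
Proof.
move=> df dg; rewrite (_ : f \- g = f \+ (fun x => (-1) * g x)).
  by rewrite (partialD df (cderivableZ (-1) dg)) (partialZ (-1) dg); apply/funext => x /=; rewrite mulN1r.
by apply/funext => x /=; rewrite mulN1r.
Qed.

Lemma cderivable_sum i (I : Type) (s : seq I) (F : I -> euclid3 R -> R[i]) :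
  (forall j, cderivable i (F j)) ->
  cderivable i (fun x => \sum_(j <- s) F j x).
Proof.
move=> dF; elim: s => [|j s IH].
  by rewrite (_ : (fun _ => _) = fun=> 0); [exact: cderivable_cst|];
    apply/funext => x; rewrite big_nil.
rewrite (_ : (fun _ => _) = F j \+ (fun x => \sum_(j <- s) F j x)).
  exact: cderivableD (dF j) IH.
by apply/funext => x; rewrite big_cons.
Qed.

Lemma partial_sum i (I : Type) (s : seq I) (F : I -> euclid3 R -> R[i]) :
  (forall j, cderivable i (F j)) ->
  partial i (fun x => \sum_(j <- s) F j x) =
  fun x => \sum_(j <- s) partial i (F j) x.
Proof.
move=> dF; elim: s => [|j s IH].
  rewrite (_ : (fun _ => _) = fun=> 0); last first.
    by apply/funext => x; rewrite big_nil.
  by rewrite partial_cst; apply/funext => x; rewrite big_nil.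
rewrite (_ : (fun _ => _) = F j \+ (fun x => \sum_(j <- s) F j x)); last first.
  by apply/funext => x; rewrite big_cons.
by rewrite (partialD (dF j) (cderivable_sum s dF)) IH; apply/funext => x /=; rewrite big_cons.
Qed.

End PartialDerivatives.

(** * Uniform bounds on all derivatives up to a given order *)

Section CkSeminorm.
Context {R : realType}.
Implicit Types (f g u : euclid3 R -> R[i]) (k : nat) (i : 'I_3) (x : euclid3 R).

(** A recursive counterpart of a bound on [Ck_norm]: it peels off derivatives in the same way as
    [diff_class], so that sums and products are bounded by induction on k with f generalized. *)
Fixpoint Ck_bounded k f (M : R) : Prop :=
  (forall x, normc (f x) <= M) /\
  if k is k'.+1 then forall i, Ck_bounded k' (partial i f) M else True.

Lemma Ck_bounded_sup k f M : Ck_bounded k f M -> forall x, normc (f x) <= M.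
Proof. by case: k => [|k] []. Qed.

Lemma Ck_boundedS k f M : Ck_bounded k.+1 f M -> Ck_bounded k f M.
Proof.
elim: k f => [|k IH] f [f0 fi]; split=> // i.
by apply: IH; exact: fi.
Qed.

Lemma Ck_bounded_le k f M N : M <= N -> Ck_bounded k f M -> Ck_bounded k f N.
Proof.
move=> MN; elim: k f => [|k IH] f [f0 fi]; split=> //.
- by move=> x; exact: le_trans (f0 x) MN.
- by move=> x; exact: le_trans (f0 x) MN.
- by move=> i; apply: IH; exact: fi.
Qed.

Lemma Ck_bounded_ge0 k f M : Ck_bounded k f M -> 0 <= M.
Proof. by move=> /Ck_bounded_sup /(_ 0); apply: le_trans; exact: normc_ge0. Qed.

Lemma Ck_bounded_norm k f M : Ck_bounded k f M -> (Ck_norm k f <= M%:E)%E.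
Proof.
move=> fM; apply: ge_ereal_sup => _ [s /= sk [x _ <-]]; rewrite lee_fin.
elim: k s f fM x sk => [|k IH] s f.
  by case: s => // -[f0 _] x _; exact: f0.
(* [foldr partial f] applies the last letter of the word first, so the word is split at its end to
   match [Ck_bounded]. *)
case/lastP: s => [|s i] [f0 fi] x; first by move=> _; exact: f0.
by rewrite size_rcons ltnS foldr_rcons => sk; exact: IH (fi i) _ sk.
Qed.

Lemma Ck_norm_bound k f s x (M : R) : (size s <= k)%N ->
  (Ck_norm k f < M%:E)%E -> normc (foldr partial f s x) <= M.
Proof.
move=> sk fM; rewrite -lee_fin; apply: le_trans (ltW fM).
by apply: ereal_sup_ubound; exists s => //; exists x.
Qed.

Lemma Ck_boundedD k f g M N : diff_class k f -> diff_class k g ->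
  Ck_bounded k f M -> Ck_bounded k g N -> Ck_bounded k (f \+ g) (M + N).
Proof.
elim: k f g => [|k IH] f g [cf df] [cg dg] [f0 fi] [g0 gi]; split=> //.
- by move=> x; apply: le_trans (le_normcD _ _) _; exact: lerD.
- by move=> x; apply: le_trans (le_normcD _ _) _; exact: lerD.
move=> i; have [df1 df2] := df i; have [dg1 dg2] := dg i.
by rewrite (partialD df1 dg1); exact: IH df2 dg2 (fi i) (gi i).
Qed.


Lemma periodic_int_shift f i x (n : int) : torus_fun f ->
  f (x + (n%:~R * (pi *+ 2)) *: evec i) = f x.
Proof.
move=> tf; have H (m : nat) y : f (y + (m%:R * (pi *+ 2)) *: evec i) = f y.
  elim: m y => [|m IH] y; first by rewrite mul0r scale0r addr0.
  by rewrite -addn1 natrD mulrDl mul1r scalerDl addrA tf IH.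
case: n => m; first exact: H.
rewrite NegzE mulrNz mulNr scaleNr.
by rewrite -[LHS](H m.+1) subrK.
Qed.

Lemma euclid3_add (u v : euclid3 R) :
  u + v = (u.1.1 + v.1.1, u.1.2 + v.1.2, u.2 + v.2).
Proof. by []. Qed.

Lemma euclid3_scale (c : R) (v : euclid3 R) :
  c *: v = (c * v.1.1, c * v.1.2, c * v.2).
Proof. by []. Qed.

(** Each coordinate is reduced by the floor of its quotient by 2 pi. The point is chosen before f,
    so it represents x for all periodic functions simultaneously. *)
Lemma cell_representative x : exists2 y, cell y &
  forall f, torus_fun f -> f y = f x.
Proof.
pose n (t : R) : int := - Num.floor (t / (pi *+ 2)).
have pi2 : 0 < pi *+ 2 :> R by rewrite pmulrn_lgt0 // pi_gt0.
have Hn (t : R) : 0 <= t + (n t)%:~R * (pi *+ 2) <= pi *+ 2.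
  have h1 := floor_le_tmp (t / (pi *+ 2)).
  have h2 := floorD1_gt (t / (pi *+ 2)).
  rewrite /n mulrNz mulNr subr_ge0 -ler_pdivlMr // h1 /=.
  move: h2; rewrite intrD1 ltr_pdivrMr // mulrDl mul1r => h2.
  by rewrite lerBlDl ltW.
exists (x + ((n x.1.1)%:~R * (pi *+ 2)) *: evec 0
          + ((n x.1.2)%:~R * (pi *+ 2)) *: evec 1
          + ((n x.2)%:~R * (pi *+ 2)) *: evec 2%:R); last first.
  by move=> f tf; rewrite !periodic_int_shift.
case: x => [[a b] c]; rewrite !euclid3_add !euclid3_scale /cell /=.
by rewrite ?(mulr0, mulr1, addr0, add0r) !in_itv /= !Hn.
Qed.

Lemma compact_cell : compact (@cell R).
Proof. by apply: compact_setX; [apply: compact_setX|]; exact: segment_compact. Qed.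

Lemma ccontinuous_bounded f : torus_fun f -> ccontinuous f ->
  exists M, forall x, normc (f x) <= M.
Proof.
move=> tf [cf1 cf2].
pose h x := (re_part f x) ^+ 2 + (im_part f x) ^+ 2.
have ch : continuous h.
  move=> x; have c1 := continuousM (cf1 x) (cf1 x).
  exact: continuousD c1 (continuousM (cf2 x) (cf2 x)).
have cell0 : cell ((0, 0, 0) : euclid3 R).
  by split; [split|]; rewrite /= in_itv /= lexx mulrn_wge0 // pi_ge0.
have [c _ cmax] := compact_EVT_max (ex_intro _ _ cell0) compact_cell
  (continuous_subspaceT ch).

exists (Num.sqrt (h c)) => x; have [y ycell yf] := cell_representative x.
rewrite -(yf f tf) -(ler_pXn2r (n := 2)) ?nnegrE ?normc_ge0 ?sqrtr_ge0 //.
rewrite sqr_normcE sqr_sqrtr; first exact: cmax (mem_set ycell).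
by rewrite addr_ge0 ?sqr_ge0.
Qed.

Lemma Cinfty_Ck_bounded k f : Cinfty f -> exists M, Ck_bounded k f M.
Proof.
elim: k f => [|k IH] f Cf.
  have /CinftyP[tf /(_ 0%N)/diff_class_ccontinuous cf] := Cf.
  by have [M fM] := ccontinuous_bounded tf cf; exists M.
have [M0 [f0 _]] : exists M, Ck_bounded 0 f M.
  have /CinftyP[tf /(_ 0%N)/diff_class_ccontinuous cf] := Cf.
  by have [M fM] := ccontinuous_bounded tf cf; exists M.
have /(_ _)/cid H i := IH _ (Cinfty_partial i Cf).
exists (M0 + \sum_i `|sval (H i)|); split=> [x|i].
  by apply: le_trans (f0 x) _; rewrite lerDl sumr_ge0.
apply: Ck_bounded_le (svalP (H i)); rewrite (bigD1 i) //=.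
have M00 : 0 <= M0 by apply: le_trans (f0 0); exact: normc_ge0.
rewrite addrCA; apply: le_trans (ler_norm _) _; rewrite lerDl.
by rewrite addr_ge0 // sumr_ge0.
Qed.

(* As Ck_bounded uses one constant for all orders, the Leibniz rule makes
   multiplication by f a bounded operation without binomial coefficients. *)
Lemma Ck_boundedM k f : Cinfty f -> exists2 C : R, 0 < C &
  forall u M, diff_class k u -> Ck_bounded k u M ->
    Ck_bounded k (f \* u) (C * M).
Proof.
have sup_mul g N u M x : (forall x, normc (g x) <= N) ->
    (forall x, normc (u x) <= M) -> normc (g x * u x) <= N * M.
  by move=> gN uM; rewrite Normc.normcM ler_pM ?normc_ge0.
elim: k f => [|k IH] f Cf.
  have [N [fN _]] := Cinfty_Ck_bounded 0 Cf.
  exists (`|N| + 1) => [|u M _ [uM _]]; first by rewrite ltr_wpDl.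
  split=> // x; apply: sup_mul => // y; apply: le_trans (fN y) _.
  by rewrite (le_trans (ler_norm _)) // lerDl.
have [N [fN _]] := Cinfty_Ck_bounded 0 Cf.
have [C0 C00 HC0] := IH _ Cf.
have /(_ _)/cid2 H i := IH _ (Cinfty_partial i Cf).
pose C i := s2val (H i).
have Cgt0 i : 0 < C i := s2valP (H i).
exists (`|N| + C0 + \sum_i C i) => [|u M du uM].
  by rewrite ltr_wpDr ?sumr_ge0 // 1?ltr_wpDl // => i _; exact: ltW.
have M0 := Ck_bounded_ge0 uM; have [u0 ui] := uM; split=> [x|i].
  apply: le_trans (sup_mul _ _ _ _ x fN u0) _; rewrite ler_wpM2r //.
  rewrite (le_trans (ler_norm _)) // -addrA lerDl addr_ge0 ?sumr_ge0 ?ltW //.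
  by move=> i _; exact: ltW.
have [cu /(_ i)[dui dku]] := du.
rewrite (partialM (Cinfty_cderivable i Cf) dui).
have /CinftyP[_ dCf] := Cf; have /CinftyP[_ dCfi] := Cinfty_partial i Cf.
have du' := diff_classS du.
apply: (@Ck_bounded_le _ _ (C i * M + C0 * M)); last first.
  apply: Ck_boundedD; [exact: diff_classM (dCfi _) du'|exact: diff_classM (dCf _) dku| |].
  - exact: (s2valP' (H i)) du' (Ck_boundedS uM).
  - exact: HC0 dku (ui i).
rewrite -mulrDl ler_wpM2r // (bigD1 i) //=.
have S0 : 0 <= \sum_(j < 3 | j != i) C j by apply: sumr_ge0 => j _; exact: ltW.
have := normr_ge0 N; lra.
Qed.

Lemma Ck_boundedZ k f (c : R[i]) M : diff_class k f ->
  Ck_bounded k f M -> Ck_bounded k (fun x => c * f x) (normc c * M).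
Proof.
elim: k f => [|k IH] f [cf df] [f0 fi]; split=> //.
- by move=> x; rewrite Normc.normcM ler_wpM2l ?normc_ge0.
- by move=> x; rewrite Normc.normcM ler_wpM2l ?normc_ge0.
move=> i; have [df1 df2] := df i.
by rewrite (partialZ c df1); exact: IH df2 (fi i).
Qed.

Lemma CinftyX f n : Cinfty f -> Cinfty (fun x => f x ^+ n).
Proof.
move=> Cf; elim: n => [|n IH]; first exact: Cinfty_cst.
rewrite (_ : (fun _ => _) = f \* (fun x => f x ^+ n)); first exact: CinftyM.
by apply/funext => x; rewrite exprS.
Qed.

Lemma partialX i f n : Cinfty f -> partial i (fun x => f x ^+ n) =
  fun x => n%:R * f x ^+ n.-1 * partial i f x.
Proof.
move=> Cf; elim: n => [|n IH].
  rewrite (_ : (fun _ => _) = fun=> 1); last exact/funext.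
  by rewrite partial_cst; apply/funext => x; rewrite !mul0r.
rewrite (_ : (fun _ => _) = f \* (fun x => f x ^+ n)); last first.
  by apply/funext => x; rewrite exprS.
rewrite (partialM (Cinfty_cderivable i Cf) (Cinfty_cderivable i (CinftyX n Cf))).
apply/funext => x /=; rewrite IH; case: n {IH} => [|n] /=.
  by rewrite expr0 !mul0r mulr0 addr0 mulr1 !mul1r.
by rewrite -(addn1 n.+1) natrD exprS; ring.
Qed.

(** In p^n - q^n = (p - q) * sum of p^(n-1-j) q^j, each of the n summands is at least q^(n-1). This
    is the price of differentiating an n-th power once: the factor n is absorbed by the larger ratio
    p. *)
Lemma mulrn_expr_le (p q : R) n : 0 <= q < p ->
  n%:R * q ^+ n.-1 <= p ^+ n / (p - q).
Proof.
move=> /andP[q0 qp]; have pq0 : 0 < p - q by rewrite subr_gt0.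
have p0 : 0 <= p by exact: le_trans (ltW qp).
rewrite ler_pdivlMr // mulrC.
apply: (@le_trans _ _ (p ^+ n - q ^+ n)); last by rewrite gerBl exprn_ge0.
rewrite subrXX ler_wpM2l ?(ltW pq0) //.
have -> : n%:R * q ^+ n.-1 = \sum_(j < n) q ^+ n.-1.
  by rewrite sumr_const card_ord mulr_natl.
apply: ler_sum => j _; rewrite -[in leLHS](subnK (n := n.-1) (m := j)).
  by rewrite exprD ler_wpM2r ?exprn_ge0 // lerXn2r ?nnegrE // ltW.
by case: n j => [[]|n] //= [j /=]; rewrite ltnS.
Qed.

(* The derivatives of h^N u are of the form N^j h^(N-j) v; keeping u general
   and enlarging the ratio at each order absorbs the polynomial factors. *)
Lemma Ck_bounded_geometric k (h u : euclid3 R -> R[i]) (q p : R) :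
  Cinfty h -> Cinfty u -> 0 <= q < p -> (forall x, normc (h x) <= q) ->
  exists C, forall N, Ck_bounded k (fun x => h x ^+ N * u x) (C * p ^+ N).
Proof.
move=> Ch + + hq.
have B0 u' p' : Cinfty u' -> 0 <= q < p' ->
    exists C, forall N, Ck_bounded 0 (fun x => h x ^+ N * u' x) (C * p' ^+ N).
  move=> Cu /andP[q0 qp]; have [M [uM _]] := Cinfty_Ck_bounded 0 Cu.
  exists M => N; split=> // x; rewrite Normc.normcM mulrC.
  rewrite ler_pM ?normc_ge0 //.
  have -> : normc (h x ^+ N) = normc (h x) ^+ N.
    elim: N => [|N IH]; first exact: Normc.normc1.
    by rewrite !exprS Normc.normcM IH.
  rewrite lerXn2r ?nnegrE ?normc_ge0 //; first exact: le_trans q0 (ltW qp).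
  exact: le_trans (hq x) (ltW qp).
elim: k u p => [|k IH] u p Cu qp; first exact: B0.
have [C0 HC0] := B0 u p Cu qp.
(* The term with the factor N is estimated with the intermediate ratio p', which leaves the gap p -
   p' for [mulrn_expr_le]. *)
pose p' := (q + p) / 2.
have qp' : 0 <= q < p' by rewrite /p'; move/andP: qp => [? ?]; apply/andP; split; lra.
have p'p : 0 <= p' < p by move: qp qp' => /andP[? ?] /andP[? ?]; apply/andP; rewrite /p'; split; lra.
have p0 : 0 <= p by move: p'p => /andP[a /ltW]; exact: le_trans.
have /(_ _)/cid H1 i := IH _ p' (CinftyM (Cinfty_partial i Ch) Cu) qp'.
have /(_ _)/cid H2 i := IH _ p (Cinfty_partial i Cu) qp.
have C1_ge0 i : 0 <= sval (H1 i).
  by have := Ck_bounded_ge0 (svalP (H1 i) 0%N); rewrite expr0 mulr1.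
have C2_ge0 i : 0 <= sval (H2 i).
  by have := Ck_bounded_ge0 (svalP (H2 i) 0%N); rewrite expr0 mulr1.
have C0_ge0 : 0 <= C0.
  by have := Ck_bounded_ge0 (HC0 0%N); rewrite expr0 mulr1.
pose D i := sval (H1 i) / (p - p') + sval (H2 i).
have D_ge0 i : 0 <= D i.
  rewrite addr_ge0 // mulr_ge0 // invr_ge0 subr_ge0.
  by move: p'p => /andP[_ /ltW].
exists (C0 + \sum_i D i) => N; split=> [x|i].
  have [/(_ x) HN _] := HC0 N; apply: le_trans HN _.
  by rewrite ler_wpM2r ?exprn_ge0 // lerDl sumr_ge0.
have -> : partial i (fun x => h x ^+ N * u x) =
    (fun x => N%:R * (h x ^+ N.-1 * (partial i h x * u x))) \+
    (fun x => h x ^+ N * partial i u x).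
  rewrite (partialM (Cinfty_cderivable i (CinftyX N Ch)) (Cinfty_cderivable i Cu)).
  by rewrite partialX //; apply/funext => x /=; congr (_ + _); rewrite -!mulrA.
have Ca : Cinfty (fun x => h x ^+ N.-1 * (partial i h x * u x)).
  by apply: CinftyM (CinftyX _ Ch) _; apply: CinftyM Cu; exact: Cinfty_partial.
have Cb : Cinfty (fun x => h x ^+ N * partial i u x).
  by apply: CinftyM (CinftyX _ Ch) _; exact: Cinfty_partial.
have /CinftyP[_ da] := Ca; have /CinftyP[_ db] := Cb.
have /CinftyP[_ dNa] := CinftyZ N%:R Ca.
have := Ck_boundedD (dNa k) (db k)
  (Ck_boundedZ N%:R (da k) (svalP (H1 i) N.-1)) (svalP (H2 i) N).
apply: Ck_bounded_le.
have -> : (N%:R : R[i]) = (N%:R : R)%:C by rewrite rmorph_nat.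
rewrite normc_real ger0_norm // (bigD1 i) //= {2}/D.
have S0 : 0 <= \sum_(j < 3 | j != i) D j by apply: sumr_ge0.
have E : N%:R * (sval (H1 i) * p' ^+ N.-1) <= sval (H1 i) / (p - p') * p ^+ N.
  by rewrite mulrCA -mulrA ler_wpM2l // [leRHS]mulrC mulrn_expr_le.
rewrite !mulrDl; have pN : 0 <= p ^+ N by rewrite exprn_ge0.
have := mulr_ge0 C0_ge0 pN; have := mulr_ge0 S0 pN; lra.
Qed.

End CkSeminorm.

(** * Characters of the torus, and smoothness of inverses *)

Section Characters.
Context {R : realType}.
Implicit Types (f g u : euclid3 R -> R[i]) (k : nat) (i : 'I_3) (x : euclid3 R).

(** The directional difference quotient of g at x is literally the quotient of phi at t, so
    one-variable calculus transfers to directional derivatives. The offset t allows any base point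
    on the line. *)
Lemma is_derive_line (g : euclid3 R -> R) (phi : R -> R) (v x : euclid3 R) t d :
  (forall h, g ((h - t) *: v + x) = phi h) -> is_derive t 1 phi d ->
  derivable g x v /\ 'D_v g x = d.
Proof.
move=> gphi [dphi <-].
have E : (fun h : R => h^-1 *: ((g \o shift x) (h *: v) - g x)) =
         (fun h : R => h^-1 *: ((phi \o shift t) (h *: 1) - phi t)).
  apply/funext => h /=; congr (_ *: (_ - _)).
    by rewrite -gphi /shift /= addrK scaler1.
  by rewrite -gphi subrr scale0r add0r.
by split; [rewrite /derivable E|rewrite /derive E].
Qed.

Lemma line_is_derive (g : euclid3 R -> R) (phi : R -> R) (v x : euclid3 R) t :
  (forall h, g ((h - t) *: v + x) = phi h) -> derivable g x v ->
  is_derive t 1 phi ('D_v g x).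
Proof.
move=> gphi dg.
have E : (fun h : R => h^-1 *: ((g \o shift x) (h *: v) - g x)) =
         (fun h : R => h^-1 *: ((phi \o shift t) (h *: 1) - phi t)).
  apply/funext => h /=; congr (_ *: (_ - _)).
    by rewrite -gphi /shift /= addrK scaler1.
  by rewrite -gphi subrr scale0r add0r.
by split; [rewrite /derivable -E|rewrite /derive E].
Qed.

Lemma expiD (a b : R) : expi (a + b) = expi a * expi b.
Proof. by rewrite /expi sinD cosD; congr (_ +i* _); rewrite addrC. Qed.

Lemma expi0 : expi (0 : R) = 1.
Proof. by rewrite /expi cos0 sin0. Qed.

Lemma expiN (a : R) : expi (- a) = (expi a)^*%C.
Proof. by rewrite /expi sinN cosN. Qed.

Lemma normc_expi (a : R) : normc (expi a) = 1.
Proof. by rewrite /= cos2Dsin2 sqrtr1. Qed.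

Definition frequency : Type := (int * int * int)%type.
Implicit Types n m : frequency.

Definition coordf n i : int :=
  if i == 0 then n.1.1 else if i == 1 then n.1.2 else n.2.

Definition phase n x : R :=
  n.1.1%:~R * x.1.1 + n.1.2%:~R * x.1.2 + n.2%:~R * x.2.

Definition character n x : R[i] := expi (phase n x).

Lemma phase_line n i x h : phase n (h *: evec i + x) =
  h * (coordf n i)%:~R + phase n x.
Proof.
rewrite euclid3_add euclid3_scale /phase /coordf.
by case: i => -[|[|[|//]]] ? /=; ring.
Qed.

Lemma characterD n m x :
  character (n.1.1 + m.1.1, n.1.2 + m.1.2, n.2 + m.2) x =
  character n x * character m x.
Proof. by rewrite /character -expiD; congr expi; rewrite /phase /= !intrD; ring. Qed.

Lemma character0 x : character (0, 0, 0) x = 1.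
Proof. by rewrite /character /phase /= !mul0r !addr0 expi0. Qed.

Lemma characterN n x :
  character (- n.1.1, - n.1.2, - n.2) x = (character n x)^*%C.
Proof. by rewrite /character -expiN; congr expi; rewrite /phase /= !intrN; ring. Qed.

Lemma normc_character n x : normc (character n x) = 1.
Proof. exact: normc_expi. Qed.

Lemma expi_int_period (a : R) (z : int) : expi (a + z%:~R * (pi *+ 2)) = expi a.
Proof.
have H (m : nat) b : expi (b + m%:R * (pi *+ 2)) = expi b :> R[i].
  by rewrite /expi mulr_natl (periodicn (@cosD2pi R)) (periodicn (@sinD2pi R)).
case: z => m; first exact: H.
by rewrite NegzE mulrNz mulNr -[LHS](H m.+1) subrK.
Qed.

Lemma torus_character n : torus_fun (character n).
Proof.
move=> i x; rewrite /character addrC phase_line addrC mulrC.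
exact: expi_int_period.
Qed.

Lemma continuous_phase n : continuous (phase n : euclid3 R -> R).
Proof.
move=> x.
have c1 : {for x, continuous (fun y : euclid3 R => y.1.1)}.
  by apply: (@continuous_comp _ _ _ fst fst); exact: cvg_fst.
have c2 : {for x, continuous (fun y : euclid3 R => y.1.2)}.
  by apply: (@continuous_comp _ _ _ fst snd); [exact: cvg_fst|exact: cvg_snd].
have c3 : {for x, continuous (fun y : euclid3 R => y.2)} by exact: cvg_snd.
by apply: cvgD; [apply: cvgD|]; apply: cvgMr.
Qed.

Lemma ccontinuous_character n : ccontinuous (character n).
Proof.
split=> x.
  apply: (@continuous_comp _ _ _ (phase n) (@cos R)); first exact: continuous_phase.
  exact: continuous_cos.
apply: (@continuous_comp _ _ _ (phase n) (@sin R)); first exact: continuous_phase.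
exact: continuous_sin.
Qed.

Lemma character_derive n i x :
  (derivable (re_part (character n)) x (evec i) /\
   'D_(evec i) (re_part (character n)) x =
     - (coordf n i)%:~R * sin (phase n x)) /\
  (derivable (im_part (character n)) x (evec i) /\
   'D_(evec i) (im_part (character n)) x =
     (coordf n i)%:~R * cos (phase n x)).
Proof.
pose L (h : R) := h * (coordf n i)%:~R + phase n x.
have dL : is_derive (0 : R) 1 L (coordf n i)%:~R.
  by rewrite /L; apply: is_derive_eq; rewrite ?scaler0 ?addr0 ?add0r /GRing.scale /= ?mulr1 ?mul1r.
split.
  apply: (@is_derive_line _ (cos \o L) _ _ 0).
    by move=> h; rewrite subr0 /re_part /character phase_line.
  apply: is_derive_eq (is_derive1_comp (is_derive_cos (L 0)) dL) _.
  by rewrite /L mul0r add0r /GRing.scale /=; ring.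
apply: (@is_derive_line _ (sin \o L) _ _ 0).
  by move=> h; rewrite subr0 /im_part /character phase_line.
apply: is_derive_eq (is_derive1_comp (is_derive_sin (L 0)) dL) _.
by rewrite /L mul0r add0r /GRing.scale /=; ring.
Qed.

Lemma cderivable_character n i : cderivable i (character n).
Proof. by move=> x; have [[? _] [? _]] := character_derive n i x. Qed.

Lemma partial_character n i : partial i (character n) =
  fun x => ('i * (coordf n i)%:~R) * character n x.
Proof.
apply/funext => x; have [[_ E1] [_ E2]] := character_derive n i x.
rewrite /partial E1 E2 -(rmorph_int (real_complex R)).
by apply: complexP; rewrite !(ReM, ImM) /=; ring.
Qed.

Lemma Cinfty_character n : Cinfty (character n).
Proof.
apply/CinftyP; split; first exact: torus_character.
elim=> [|k IH]; split=> //; try exact: ccontinuous_character.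
move=> i; split; first exact: cderivable_character.
by rewrite partial_character; apply: diff_classM => //; exact: diff_class_cst.
Qed.

(** By induction on k: the derivative of 1 / a is - a' / a^2, a product of functions whose class is
    already known. *)
Lemma diff_class_inv k (a : euclid3 R -> R) : (forall x, a x != 0) ->
  diff_class k (fun x => (a x)%:C) -> diff_class k (fun x => (a x)^-1%:C).
Proof.
move=> a0.
have ReV : re_part (fun x => (a x)^-1%:C) = fun x => (a x)^-1 by [].
have ImV : im_part (fun x => (a x)^-1%:C) = cst 0 by [].
have Rea : re_part (fun x => (a x)%:C) = a by [].
elim: k => [|k IH] da'; have [[ca _] da] := da'.
  split=> //; split; last by move=> x; exact: cvg_cst.
  by move=> x; rewrite ReV; exact: (@continuousV _ _ _ _ (a0 x) (ca x)).
have cda := diff_classS da'.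
have dVk := IH cda.
split.
  split; last by move=> x; exact: cvg_cst.
  by move=> x; rewrite ReV; exact: (@continuousV _ _ _ _ (a0 x) (ca x)).
move=> i; have [di dpi] := da i.
have dV : cderivable i (fun x => (a x)^-1%:C).
  move=> x; rewrite ReV ImV; split; last exact: derivable_cst.
  by apply: derivableV => //; have [] := di x.
split=> //.
suff -> : partial i (fun x => (a x)^-1%:C) =
    (fun=> -1) \* partial i (fun x => (a x)%:C) \* (fun x => (a x)^-1%:C)
    \* (fun x => (a x)^-1%:C).
  by do 3!(apply: diff_classM => //); exact: diff_class_cst.
(* The formula for the derivative of the inverse comes from differentiating a * a^-1 = 1. *)
have := partialM di dV.
have aC0 x : (a x)%:C != 0 :> R[i] by rewrite (inj_eq (@complexI _)) a0.
rewrite (_ : _ \* _ = fun=> 1); last first.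
  by apply/funext => x /=; rewrite fmorphV mulfV.
rewrite partial_cst => /(congr1 (fun F => F _)) E.
apply/funext => x; move: {E}(E x) => /= E.
apply: (mulfI (aC0 x)); move/esym/eqP: E; rewrite addrC addr_eq0 => /eqP ->.
rewrite fmorphV; field; exact: aC0.
Qed.

End Characters.

(** * The saturation step when one or two directions equal 1 *)

Section StepFormulas.
Context {R : realType}.
Implicit Types (z : R[i]) (a p q e : R).

Lemma mul_complex p q p' q' :
  (p +i* q) * (p' +i* q') = (p * p' - q * q') +i* (p * q' + q * p').
Proof. by []. Qed.

Lemma add_complex p q p' q' : (p +i* q) + (p' +i* q') = (p + p') +i* (q + q').
Proof. by []. Qed.

Lemma mul_real_complex e p q : e%:C * (p +i* q) = (e * p) +i* (e * q).
Proof. by rewrite mul_complex !mul0r subr0 addr0. Qed.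

Lemma imag_complex a : 'i * a%:C = 0 +i* a.
Proof. by rewrite mul_complex; congr (_ +i* _); ring. Qed.

(** This is 2 i a (2 z + conj z). It weighs Re z and Im z differently from the formula for an
    imaginary first slot, which is what makes the two parts separable. *)
Lemma opJ_D3N_real a z : opJ (D3N a%:C z 1) =
  (- 2 * complex.Im z * a) +i* (6 * complex.Re z * a).
Proof.
rewrite /opJ /D3N -(rmorph_nat (real_complex R) 2) -(rmorph1 (real_complex R)).
case: z => p q; rewrite /= !(mul_complex, add_complex).
by congr (_ +i* _); ring.
Qed.

(** This is - 2 a conj z: two of the three terms of [D3N] have opposite signs and cancel. *)
Lemma opJ_D3N_imag a z : opJ (D3N ('i * a%:C) z 1) =
  (- 2 * complex.Re z * a) +i* (2 * complex.Im z * a).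
Proof.
rewrite imag_complex.
rewrite /opJ /D3N -(rmorph_nat (real_complex R) 2) -(rmorph1 (real_complex R)).
case: z => p q; rewrite /= !(mul_complex, add_complex).
by congr (_ +i* _); ring.
Qed.

Lemma opJ_D3N_11 z : opJ (D3N z 1 1) =
  (- 2 * complex.Im z) +i* (6 * complex.Re z).
Proof.
rewrite /opJ /D3N -(rmorph_nat (real_complex R) 2) -(rmorph1 (real_complex R)).
case: z => p q; rewrite /= !(mul_complex, add_complex).
by congr (_ +i* _); ring.
Qed.

End StepFormulas.

(** * The algebra of multipliers inside the saturation space *)

Section SaturationAlgebra.
Context {R : realType}.
Implicit Types (f g u : euclid3 R -> R[i]) (a : euclid3 R -> R) (k : nat).

Lemma real_span_incl (S : set (euclid3 R -> R[i])) : S `<=` real_span S.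
Proof.
move=> f Sf; exists 1%N, (fun=> 1), (fun=> f); split=> //.
by rewrite big_ord1 scale1r.
Qed.

Lemma real_spanD (S : set (euclid3 R -> R[i])) f g :
  real_span S f -> real_span S g -> real_span S (f + g)%R.
Proof.
move=> [n [c [s [Ss ->]]]] [m [d [t [St ->]]]].
exists (n + m)%N, (fun j => match fintype.split j with inl a => c a | inr b => d b end),
  (fun j => match fintype.split j with inl a => s a | inr b => t b end); split.
  by move=> j; case: (fintype.split j).
rewrite big_split_ord /=; congr (_ + _); apply: eq_bigr => j _.
  by rewrite (unsplitK (inl j)).
by rewrite (unsplitK (inr j)).
Qed.

Lemma real_spanZ (S : set (euclid3 R -> R[i])) (e : R) f :
  real_span S f -> real_span S (e%:C *: f).
Proof.
move=> [n [c [s [Ss ->]]]]; exists n, (fun j => e * c j), s; split=> //.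
by rewrite scaler_sumr; apply: eq_bigr => j _; rewrite scalerA rmorphM.
Qed.

Section Family.
Context {m : nat} (b : 'I_m -> euclid3 R -> R[i]).
Local Notation W := (satW_infty b).

Lemma satW_mono n p : (n <= p)%N -> satW b n `<=` satW b p.
Proof.
elim: p => [|p IH]; first by rewrite leqn0 => /eqP ->.
rewrite leq_eqVlt => /predU1P[-> //|]; rewrite ltnS => /IH np f /np Wf.
by apply: real_span_incl; left.
Qed.

Lemma satW_D n f g : satW b n f -> satW b n g -> satW b n (f + g)%R.
Proof. by case: n => [|n]; exact: real_spanD. Qed.

Lemma satW_Z n (e : R) f : satW b n f -> satW b n (e%:C *: f).
Proof. by case: n => [|n]; exact: real_spanZ. Qed.

Lemma satW_inftyD f g : W f -> W g -> W (f \+ g).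
Proof.
move=> [n _ Wf] [p _ Wg]; exists (maxn n p) => //.
apply: satW_D; first by apply: satW_mono Wf; exact: leq_maxl.
by apply: satW_mono Wg; exact: leq_maxr.
Qed.

Lemma satW_inftyZ (e : R) f : W f -> W (fun x => e%:C * f x).
Proof. by move=> [n _ Wf]; exists n => //; exact: satW_Z. Qed.

Lemma satW_infty_gen j : W (b j).
Proof. by exists 0%N => //; apply: real_span_incl; exists j. Qed.

Lemma satW_infty_step f g h : W f -> real_span (range b) g ->
  real_span (range b) h -> W (fun x => opJ (D3N (f x) (g x) (h x))).
Proof.
move=> [n _ Wf] bg bh; exists n.+1 => //; apply: real_span_incl; right.
by exists f, g, h.
Qed.

Section Multipliers.
Context (j1 : 'I_m) (bj1 : b j1 = fun=> 1).

Let one_span : real_span (range b) (fun=> 1).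
Proof. by apply: real_span_incl; exists j1. Qed.

(** With both directions equal to 1, the step exchanges real and imaginary functions, up to the
    factors 6 and -2. *)
Lemma satW_infty_rotation f : W f ->
  W (fun x => (- 2 * complex.Im (f x)) +i* (6 * complex.Re (f x))).
Proof.
move=> Wf; have := satW_infty_step Wf one_span one_span.
by congr (W _); apply/funext => x; rewrite opJ_D3N_11.
Qed.

(** Both a and i a are recorded because the extraction of Re b_j and Im b_j applies the step to each
    of them; [real_part_spaceP] derives the second condition from the first by rotation. *)
Definition real_part_space a :=
  W (fun x => (a x)%:C) /\ W (fun x => 'i * (a x)%:C).
Local Notation V := real_part_space.

Lemma real_part_spaceP a : V a <-> W (fun x => (a x)%:C).
Proof.
split=> [[]//|Wa]; split=> //.
have := satW_inftyZ (1 / 6) (satW_infty_rotation Wa).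
congr (W _); apply/funext => x.
by rewrite mul_real_complex imag_complex /=; congr (_ +i* _); field.
Qed.

Lemma real_part_space1 : V (fun=> 1).
Proof. by apply/real_part_spaceP; rewrite -bj1; exact: satW_infty_gen. Qed.

Lemma real_part_spaceD a a' : V a -> V a' -> V (fun x => a x + a' x).
Proof.
move=> [Wa _] [Wa' _]; apply/real_part_spaceP.
have := satW_inftyD Wa Wa'; congr (W _); apply/funext => x /=.
by rewrite rmorphD.
Qed.

Lemma real_part_spaceZ (e : R) a : V a -> V (fun x => e * a x).
Proof.
move=> [Wa _]; apply/real_part_spaceP.
have := satW_inftyZ e Wa; congr (W _); apply/funext => x /=.
by rewrite rmorphM.
Qed.

(* With h = 1 in D^3 N[f, g, h], the second direction of rotation separates
   the contributions of Re g and Im g. *)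
Lemma real_part_spaceM_gen j a : V a ->
  V (fun x => complex.Re (b j x) * a x) /\ V (fun x => complex.Im (b j x) * a x).
Proof.
move=> [Wa Wia].
have bj : real_span (range b) (b j) by apply: real_span_incl; exists j.
have X1 := satW_infty_rotation (satW_infty_step Wa bj one_span).
have X2 := satW_infty_step Wia bj one_span.
have Vu : V (fun x => complex.Re (b j x) * a x).
  apply/real_part_spaceP.
  (* With b_j = p + i q, [X1] is - 12 (p + i q) a and [X2] is (- 2 p + 2 i q) a, so X1 + 6 X2 = - 24
     p a. *)
  have := satW_inftyZ (- 1 / 24) (satW_inftyD X1 (satW_inftyZ 6 X2)).
  congr (W _); apply/funext => x /=.
  rewrite opJ_D3N_real opJ_D3N_imag !(mul_real_complex, add_complex).
  by rewrite -complexr0 /=; congr (_ +i* _); field.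
split=> //; apply/real_part_spaceP; have [Wu _] := Vu.
(* Adding 2 p a to [X2] leaves 2 i q a, which the rotation turns into - 4 q a. *)
have := satW_inftyZ (- 1 / 4) (satW_infty_rotation (satW_inftyD X2 (satW_inftyZ 2 Wu))).
congr (W _); apply/funext => x /=.
rewrite opJ_D3N_imag -complexr0 !(mul_real_complex, add_complex).
by rewrite -complexr0 /=; congr (_ +i* _); field.
Qed.

(** An operator condition instead of membership in W: products of multipliers then act by
    composition, whereas W offers no product. *)
Definition multiplier f := Cinfty f /\ forall a, V a ->
  V (fun x => complex.Re (f x) * a x) /\ V (fun x => complex.Im (f x) * a x).

(** Acting on a = 1 gives Re f and i Im f in W, and their sum is f. *)
Lemma multiplier_satW f : multiplier f -> W f.
Proof.
move=> [_ /(_ _ real_part_space1)[[W1 _] [_ W2]]].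
have := satW_inftyD W1 W2; congr (W _); apply/funext => x /=.
rewrite !mulr1 imag_complex -complexr0 add_complex addr0 add0r.
by case: (f x).
Qed.

End Multipliers.
End Family.

Definition star_algebra (P : set (euclid3 R -> R[i])) :=
  [/\ P `<=` @Cinfty R, forall c, P (fun=> c),
      forall f g, P f -> P g -> P (f \+ g),
      forall f g, P f -> P g -> P (f \* g) &
      forall f, P f -> P (fun x => (f x)^*%C)].

Lemma multiplier_star_algebra m (b : 'I_m -> euclid3 R -> R[i]) j1 :
  b j1 = (fun=> 1) -> star_algebra (multiplier b).
Proof.
move=> bj1; have VD := real_part_spaceD bj1; have VZ := real_part_spaceZ bj1.
have VE a a' : a =1 a' -> real_part_space b a -> real_part_space b a'.
  by move=> /funext ->.
split=> [f [] //|c|f g [Cf Vf] [Cg Vg]|f g [Cf Vf] [Cg Vg]|f [Cf Vf]].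
- by split=> [|a Va]; [exact: Cinfty_cst|split; exact: VZ].
- split=> [|a Va]; first exact: CinftyD.
  have [f1 f2] := Vf a Va; have [g1 g2] := Vg a Va.
  split; [apply: VE (VD _ _ f1 g1)|apply: VE (VD _ _ f2 g2)] => x /=.
    by rewrite ReD mulrDl.
  by rewrite ImD mulrDl.
- split=> [|a Va]; first exact: CinftyM.
  have [g1 g2] := Vg a Va; have [p1 q1] := Vf _ g1; have [p2 q2] := Vf _ g2.
  split; [apply: VE (VD _ _ p1 (VZ (-1) _ q2))|apply: VE (VD _ _ q1 p2)] => x /=.
    by rewrite ReM; ring.
  by rewrite ImM; ring.
- split=> [|a Va]; first exact: Cinfty_conj.
  have [f1 f2] := Vf a Va; split; [apply: VE f1|apply: VE (VZ (-1) _ f2)] => x /=.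
    by case: (f x).
  by case: (f x) => p q /=; ring.
Qed.

Lemma multiplier_gen m (b : 'I_m -> euclid3 R -> R[i]) j1 j :
  b j1 = (fun=> 1) -> Cinfty (b j) -> multiplier b (b j).
Proof. by move=> bj1 Cb; split=> // a Va; exact: real_part_spaceM_gen bj1 j a Va. Qed.

End SaturationAlgebra.

(** * Closure of a star algebra in all C^k, and inversion of positive functions *)

Section SmoothClosure.
Context {R : realType}.
Implicit Types (f g u : euclid3 R -> R[i]) (a : euclid3 R -> R) (k : nat).

Lemma Cinfty_diff_class k f : Cinfty f -> diff_class k f.
Proof. by move=> /CinftyP[]. Qed.

Lemma Ck_bounded0 k (M : R) : 0 <= M -> Ck_bounded k (fun=> 0) M.
Proof.
move=> M0; elim: k => [|k IH]; split=> // *; rewrite ?Normc.normc0 //.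
by rewrite partial_cst.
Qed.

Lemma Ck_bounded_conj k f (M : R) : diff_class k f -> Ck_bounded k f M ->
  Ck_bounded k (fun x => (f x)^*%C) M.
Proof.
elim: k f => [|k IH] f [cf df] [f0 fi]; split=> //; try by move=> x; rewrite normc_conj.
by move=> i; have [df1 df2] := df i; rewrite (partial_conj df1); exact: IH df2 (fi i).
Qed.

Section Closure.
Context (P : set (euclid3 R -> R[i])) (HP : star_algebra P).

(** Elements stay smooth and are approximated at every order k, so multiplication by any of them is
    bounded in each C^k by [Ck_boundedM] and the closure is again an algebra. *)
Definition smooth_closure f := Cinfty f /\ forall k (e : R), 0 < e ->
  exists2 w, P w & Ck_bounded k (f \- w) e.
Local Notation A := smooth_closure.

Let PC : P `<=` @Cinfty R. Proof. by case: HP. Qed.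

Lemma smooth_closure_incl : P `<=` A.
Proof.
move=> f Pf; split=> [|k e e0]; first exact: PC.
exists f => //; rewrite (_ : f \- f = fun=> 0); first exact: Ck_bounded0 (ltW e0).
by apply/funext => x /=; rewrite subrr.
Qed.

Lemma smooth_closure_closed f : Cinfty f ->
  (forall k (e : R), 0 < e -> exists2 g, A g & Ck_bounded k (f \- g) e) -> A f.
Proof.
move=> Cf Hf; split=> // k e e0; have e20 : 0 < e / 2 by rewrite divr_gt0.
have [g [Cg Ag] fg] := Hf k _ e20; have [w Pw gw] := Ag k _ e20.
exists w => //; rewrite (_ : f \- w = (f \- g) \+ (g \- w)); last first.
  by apply/funext => x /=; rewrite addrA subrK.
rewrite (splitr e); apply: Ck_boundedD => //; apply: Cinfty_diff_class.
  exact: CinftyB.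
by apply: CinftyB => //; exact: PC.
Qed.

Lemma smooth_closureD f g : A f -> A g -> A (f \+ g).
Proof.
move=> [Cf Af] [Cg Ag]; split=> [|k e e0]; first exact: CinftyD.
have e20 : 0 < e / 2 by rewrite divr_gt0.
have [w Pw fw] := Af k _ e20; have [z Pz gz] := Ag k _ e20.
exists (w \+ z); first by case: HP => _ _ PD _ _; exact: PD.
rewrite (_ : _ \- _ = (f \- w) \+ (g \- z)); last first.
  by apply/funext => x /=; rewrite opprD addrACA.
rewrite (splitr e); apply: Ck_boundedD => //; apply: Cinfty_diff_class.
  by apply: CinftyB => //; exact: PC.
by apply: CinftyB => //; exact: PC.
Qed.

Lemma smooth_closureM_gen p f : P p -> A f -> A (p \* f).
Proof.
move=> Pp [Cf Af]; have Cp := PC Pp; split=> [|k e e0]; first exact: CinftyM.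
have [C C0 HC] := Ck_boundedM k Cp.
have [w Pw fw] := Af k _ (divr_gt0 e0 C0).
exists (p \* w); first by case: HP => _ _ _ PM _; exact: PM.
rewrite (_ : _ \- _ = p \* (f \- w)); last first.
  by apply/funext => x /=; rewrite mulrBr.
have -> : e = C * (e / C) by rewrite mulrC divfK // gt_eqF.
by apply: HC => //; apply/Cinfty_diff_class/CinftyB => //; exact: PC.
Qed.

(** The factors are approximated one at a time: for w in P, w f is in the closure by
    [smooth_closureM_gen], and f (g - w) is small because f is a fixed smooth function. No product
    of two approximants has to be estimated. *)
Lemma smooth_closureM f g : A f -> A g -> A (f \* g).
Proof.
move=> Af [Cg Ag]; have [Cf _] := Af.
apply: smooth_closure_closed => [|k e e0]; first exact: CinftyM.
have [C C0 HC] := Ck_boundedM k Cf.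
have [w Pw gw] := Ag k _ (divr_gt0 e0 C0).
exists (w \* f); first exact: smooth_closureM_gen.
rewrite (_ : _ \- _ = f \* (g \- w)); last first.
  by apply/funext => x /=; rewrite mulrBr [w x * _]mulrC.
have -> : e = C * (e / C) by rewrite mulrC divfK // gt_eqF.
by apply: HC => //; apply/Cinfty_diff_class/CinftyB => //; exact: PC.
Qed.

Lemma smooth_closure_cst (c : R[i]) : A (fun=> c).
Proof. by apply: smooth_closure_incl; case: HP. Qed.

Lemma smooth_closureZ (c : R[i]) f : A f -> A (fun x => c * f x).
Proof. by move=> Af; exact: smooth_closureM (smooth_closure_cst c) Af. Qed.

Lemma smooth_closureB f g : A f -> A g -> A (f \- g).
Proof.
move=> Af Ag; rewrite (_ : f \- g = f \+ (fun x => (-1) * g x)).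
  by apply: smooth_closureD => //; exact: smooth_closureZ.
by apply/funext => x /=; rewrite mulN1r.
Qed.

Lemma smooth_closure_conj f : A f -> A (fun x => (f x)^*%C).
Proof.
move=> [Cf Af]; split=> [|k e e0]; first exact: Cinfty_conj.
have [w Pw fw] := Af k _ e0.
exists (fun x => (w x)^*%C); first by case: HP => _ _ _ _; exact.
rewrite (_ : _ \- _ = fun x => ((f \- w) x)^*%C).
  apply: Ck_bounded_conj fw; apply/Cinfty_diff_class/CinftyB => //; exact: PC.
by apply/funext => x /=; rewrite rmorphB.
Qed.

Lemma smooth_closureX f n : A f -> A (fun x => f x ^+ n).
Proof.
move=> Af; elim: n => [|n IH]; first exact: smooth_closure_cst.
rewrite (_ : (fun _ => _) = f \* (fun x => f x ^+ n)); first exact: smooth_closureM.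
by apply/funext => x; rewrite exprS.
Qed.

Lemma smooth_closure_sum (I : Type) (s : seq I) (F : I -> euclid3 R -> R[i]) :
  (forall j, A (F j)) -> A (fun x => \sum_(j <- s) F j x).
Proof.
move=> AF; elim: s => [|j s IH].
  by rewrite (_ : (fun _ => _) = fun=> 0); [exact: smooth_closure_cst|];
    apply/funext => x; rewrite big_nil.
rewrite (_ : (fun _ => _) = F j \+ (fun x => \sum_(j <- s) F j x)).
  exact: smooth_closureD.
by apply/funext => x; rewrite big_cons.
Qed.

Lemma smooth_closure_Ck k f w (e : R) : diff_class k f -> A w ->
  Ck_bounded k (f \- w) e -> forall d : R, 0 < d ->
  exists2 p, P p & Ck_bounded k (f \- p) (e + d).
Proof.
move=> df [Cw Aw] fw d d0; have [p Pp wp] := Aw k d d0.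
exists p => //; rewrite (_ : f \- p = (f \- w) \+ (w \- p)); last first.
  by apply/funext => x /=; rewrite addrA subrK.
apply: Ck_boundedD => //.
  rewrite (_ : f \- w = f \+ (fun x => (-1) * w x)); last first.
    by apply/funext => x /=; rewrite mulN1r.
  by apply: diff_classD => //; apply/Cinfty_diff_class/CinftyZ.
by apply/Cinfty_diff_class/CinftyB => //; exact: PC.
Qed.

(* Neumann series: with h = 1 - a / M, the partial sums of M^-1 sum h^n differ
   from 1 / a by h^N / a, which tends to 0 in every C^k. *)
Lemma smooth_closureV a (m M : R) : 0 < m -> (forall x, m <= a x <= M) ->
  A (fun x => (a x)%:C) -> A (fun x => (a x)^-1%:C).
Proof.
move=> m0 amM Aa; have a0 x : a x != 0.
  by rewrite gt_eqF // (lt_le_trans m0) //; have /andP[] := amM x.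
have M0 : 0 < M.
  by apply: lt_le_trans m0 _; have /andP[] := amM 0; exact: le_trans.
have mM : m <= M by have /andP[] := amM 0; exact: le_trans.
have CV : Cinfty (fun x => (a x)^-1%:C).
  have [/CinftyP[ta da] _] := Aa; apply/CinftyP; split.
    by move=> i x; have /(congr1 (@complex.Re R)) /= -> := ta i x.
  by move=> k; exact: diff_class_inv.
pose h x : R[i] := (1 - a x / M)%:C.
have Ah : A h.
  rewrite (_ : h = (fun=> 1) \- (fun x => M^-1%:C * (a x)%:C)); last first.
    by apply/funext => x /=; rewrite /h rmorphB mulrC -rmorphM.
  by apply: smooth_closureB; [exact: smooth_closure_cst|exact: smooth_closureZ].
have hq x : normc (h x) <= 1 - m / M.
  have /andP[ma aM] := amM x.
  rewrite normc_real ger0_norm; last by rewrite subr_ge0 ler_pdivrMr // mul1r.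
  by rewrite lerD2l lerN2 ler_pM2r // invr_gt0.
apply: smooth_closure_closed => // k e e0.
have mM1 : 0 < m / M by rewrite divr_gt0.
have mM2 : m / M <= 1 by rewrite ler_pdivrMr // mul1r.
(* The function h takes values in [0, 1 - m / M]; the ratio 1 - m / M / 2 is the midpoint between
   that bound and 1. *)
have [C HC] := @Ck_bounded_geometric _ k h _ (1 - m / M) (1 - m / M / 2)
  Ah.1 CV ltac:(apply/andP; split; lra) hq.
have C0 : 0 <= C by have := Ck_bounded_ge0 (HC 0%N); rewrite expr0 mulr1.
have /cvgrPdist_lt /(_ (e / (C + 1))) : (1 - m / M / 2) ^+ n @[n --> \oo] --> 0.
  by apply: cvg_expr; rewrite ger0_norm; lra.
rewrite divr_gt0 ?ltr_wpDl // => /(_ isT) [N _ /(_ N (leqnn N))] /=.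
have p0 : 0 <= 1 - m / M / 2 by lra.
rewrite sub0r normrN ger0_norm ?exprn_ge0 //.
rewrite ltr_pdivlMr ?ltr_wpDl // => HN.
exists (fun x => M^-1%:C * \sum_(j < N) h x ^+ j).
  by apply: smooth_closureZ; apply: smooth_closure_sum => j; exact: smooth_closureX.
apply: (@Ck_bounded_le _ _ _ (C * (1 - m / M / 2) ^+ N)).
  rewrite ltW // (le_lt_trans _ HN) // mulrC ler_wpM2l ?exprn_ge0 //.
  by rewrite lerDl.
rewrite (_ : _ \- _ = fun x => h x ^+ N * (a x)^-1%:C) //.
apply/funext => x /=.
have aC0 : (a x)%:C != 0 :> R[i] by rewrite (inj_eq (@complexI _)).
have MC0 : M%:C != 0 :> R[i] by rewrite (inj_eq (@complexI _)) gt_eqF.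
have ha : (a x)%:C = M%:C * (1 - h x).
  rewrite /h -[1 in RHS](rmorph1 (real_complex R)) -rmorphB -rmorphM.
  by congr (_%:C); field; rewrite gt_eqF.
have h1 : 1 - h x != 0 by apply: contraNneq aC0; rewrite ha => ->; rewrite mulr0.
have S : \sum_(j < N) h x ^+ j = (1 - h x ^+ N) / (1 - h x).
  apply: (mulfI h1); rewrite mulrCA mulfV // mulr1.
  by have /(congr1 -%R) := subrX1 (h x) N; rewrite -mulNr !opprB.
have VC (c : R) : c^-1%:C = (c%:C)^-1 :> R[i] by exact: fmorphV.
rewrite S !VC ha; move: (h x) (h x ^+ N) h1 => t tN h1.
by field; rewrite h1.
Qed.

End Closure.

End SmoothClosure.

(** * All characters lie in the closure generated by the three profiles *)

Section TorusProfiles.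
Context {R : realType} (r R0 : R) (hr : 0 < r) (hrR : r < R0).
Local Notation b := (torus_profiles r R0).
Local Notation A := (smooth_closure (multiplier b)).

Lemma torus_profiles1 : b 0 = fun=> 1.
Proof. by []. Qed.

Lemma character100 (x : euclid3 R) : character (1, 0, 0) x = expi x.1.1.
Proof. by rewrite /character /phase /= mul1r !mul0r !addr0. Qed.
Lemma character010 (x : euclid3 R) : character (0, 1, 0) x = expi x.1.2.
Proof. by rewrite /character /phase /= mul1r !mul0r add0r addr0. Qed.
Lemma character001 (x : euclid3 R) : character (0, 0, 1) x = expi x.2.
Proof. by rewrite /character /phase /= mul1r !mul0r !add0r. Qed.

Lemma cos_character (x : euclid3 R) : (cos x.2)%:C =
  (2^-1)%:C * (character (0, 0, 1) x + (character (0, 0, 1) x)^*%C).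
Proof.
rewrite character001 /expi /= add_complex mul_real_complex -complexr0.
by congr (_ +i* _); field.
Qed.

Lemma sin_character (x : euclid3 R) : (sin x.2)%:C =
  (2^-1)%:C * ('i * ((character (0, 0, 1) x)^*%C - character (0, 0, 1) x)).
Proof.
rewrite character001 /expi /= -[- (_ +i* _)]/(_ +i* _) add_complex mul_complex.
by rewrite -complexr0; congr (_ +i* _); field.
Qed.

Lemma Cinfty_cos : Cinfty (fun x : euclid3 R => (cos x.2)%:C).
Proof.
rewrite (_ : (fun _ => _) = fun x => (2^-1)%:C *
  (character (0, 0, 1) x + (character (0, 0, 1) x)^*%C)); last first.
  by apply/funext => x; exact: cos_character.
apply: CinftyZ; apply: CinftyD; first exact: Cinfty_character.
exact: Cinfty_conj (Cinfty_character _).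
Qed.

Lemma Cinfty_sin : Cinfty (fun x : euclid3 R => (sin x.2)%:C).
Proof.
rewrite (_ : (fun _ => _) = fun x => (2^-1)%:C *
  ('i * ((character (0, 0, 1) x)^*%C - character (0, 0, 1) x))); last first.
  by apply/funext => x; exact: sin_character.
do 2!apply: CinftyZ; apply: CinftyB; last exact: Cinfty_character.
exact: Cinfty_conj (Cinfty_character _).
Qed.

Lemma Cinfty_torus_profiles j : Cinfty (b j).
Proof.
have affine (g : euclid3 R -> R) n : Cinfty (fun x => (g x)%:C) ->
    Cinfty (fun x => (R0 + r * g x)%:C * character n x).
  move=> Cg; apply: CinftyM (Cinfty_character n).
  rewrite (_ : (fun _ => _) = (fun=> R0%:C) \+ (fun x => r%:C * (g x)%:C)).
    by apply: CinftyD; [exact: Cinfty_cst|exact: CinftyZ].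
  by apply/funext => x /=; rewrite rmorphD rmorphM.
case: j => -[|[|[|//]]] j3.
- exact: Cinfty_cst.
- rewrite (_ : b _ = fun x => (R0 + r * cos x.2)%:C * character (1, 0, 0) x).
    exact: affine Cinfty_cos.
  by apply/funext => x; rewrite character100.
- rewrite (_ : b _ = fun x => (R0 + r * sin x.2)%:C * character (0, 1, 0) x).
    exact: affine Cinfty_sin.
  by apply/funext => x; rewrite character010.
Qed.

Let HP : star_algebra (multiplier b) := multiplier_star_algebra torus_profiles1.

Let AE f g : f =1 g -> A f -> A g.
Proof. by move=> /funext ->. Qed.

Let A_gen j : A (b j).
Proof.
apply: (smooth_closure_incl HP).
exact: multiplier_gen torus_profiles1 (Cinfty_torus_profiles j).
Qed.

Let expi_conj (t : R) : expi t * (expi t)^*%C = 1.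
Proof. by rewrite -expiN -expiD subrr expi0. Qed.

Let A_sqr (a t : euclid3 R -> R) :
  A (fun x => (a x)%:C * expi (t x)) -> A (fun x => (a x ^+ 2)%:C).
Proof.
move=> Aa; apply: AE (smooth_closureM HP Aa (smooth_closure_conj HP Aa)) => x.
transitivity ((a x)%:C * expi (t x) * ((a x)%:C * expi (t x))^*%C) => //.
by rewrite conjcM conjc_real mulrACA expi_conj mulr1 -rmorphM.
Qed.

Let A_div (a : euclid3 R -> R) (m M : R) : 0 < m ->
  (forall x, m <= a x <= M) -> A (fun x => (a x)%:C) ->
  forall f, A (fun x => (a x)%:C * f x) -> A f.
Proof.
move=> m0 amM Aa f Af.
apply: AE (smooth_closureM HP (smooth_closureV HP m0 amM Aa) Af) => x /=.
rewrite mulrA -rmorphM mulVf ?mul1r // gt_eqF // (lt_le_trans m0) //.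
by have /andP[] := amM x.
Qed.

Let R0_gt0 : 0 < R0 := lt_trans hr hrR.

(* |b_2|^2 + |b_3|^2 = 2 R0^2 + r^2 + 2 R0 r (cos x_3 + sin x_3) *)
Let A_cos_add_sin : A (fun x => (cos x.2 + sin x.2)%:C).
Proof.
have A2 := A_sqr (A_gen 1); have A3 := A_sqr (A_gen 2%:R).
have := smooth_closureZ HP ((2 * R0 * r)^-1)%:C (smooth_closureD HP
  (smooth_closureD HP A2 A3) (smooth_closure_cst HP (- (2 * R0 ^+ 2 + r ^+ 2))%:C)).
apply: AE => x /=; rewrite -!rmorphD -rmorphM; congr (_%:C).
have E : sin x.2 ^+ 2 = 1 - cos x.2 ^+ 2 by rewrite -(cos2Dsin2 x.2) addrAC subrr add0r.
rewrite !sqrrD !exprMn E; field.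
by rewrite !gt_eqF.
Qed.

(* |b_2|^2 - |b_3|^2 = (cos x_3 - sin x_3) (2 R0 r + r^2 (cos x_3 + sin x_3)) *)
Let A_cos_sub_sin : A (fun x => (cos x.2 - sin x.2)%:C).
Proof.
have A2 := A_sqr (A_gen 1); have A3 := A_sqr (A_gen 2%:R).
(* The factor lies between these bounds since |cos + sin| <= 2, and r < R0 keeps it away from 0. *)
apply: (@A_div (fun x => 2 * R0 + r * (cos x.2 + sin x.2)) (2 * (R0 - r)) (2 * (R0 + r))).
- by move: hr hrR; lra.
- move=> x; have := cos_geN1 x.2; have := cos_le1 x.2.
  have := sin_geN1 x.2; have := sin_le1 x.2.
  by move: (cos _) (sin _) => c s s1 s2 c1 c2; move: hr hrR => ? ?; apply/andP; split; nra.
- have := smooth_closureD HP (smooth_closure_cst HP (2 * R0)%:C)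
    (smooth_closureZ HP r%:C A_cos_add_sin).
  by apply: AE => x; rewrite rmorphD (rmorphM (real_complex R) r).
have := smooth_closureZ HP (r^-1)%:C (smooth_closureB HP A2 A3).
apply: AE => x /=; rewrite -rmorphB -!rmorphM; congr (_%:C).
by field; rewrite gt_eqF.
Qed.

Let A_cos : A (fun x => (cos x.2)%:C).
Proof.
have := smooth_closureZ HP (2^-1)%:C (smooth_closureD HP A_cos_add_sin A_cos_sub_sin).
by apply: AE => x /=; rewrite -rmorphD -rmorphM; congr (_%:C); field.
Qed.

Let A_sin : A (fun x => (sin x.2)%:C).
Proof.
have := smooth_closureZ HP (2^-1)%:C (smooth_closureB HP A_cos_add_sin A_cos_sub_sin).
by apply: AE => x /=; rewrite -rmorphB -rmorphM; congr (_%:C); field.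
Qed.

Let A_affine (a : euclid3 R -> R) : A (fun x => (a x)%:C) ->
  A (fun x => (R0 + r * a x)%:C).
Proof.
move=> Aa; have := smooth_closureD HP (smooth_closure_cst HP R0%:C) (smooth_closureZ HP r%:C Aa).
by apply: AE => x; rewrite rmorphD (rmorphM (real_complex R) r).
Qed.

Let A100 : A (character (1, 0, 0)).
Proof.
apply: (@A_div (fun x => R0 + r * cos x.2) (R0 - r) (R0 + r)).
- by move: hr hrR; lra.
- by move=> x; have := cos_geN1 x.2; have := cos_le1 x.2; move: (cos _) => c c1 c2;
    move: hr hrR => ? ?; apply/andP; split; nra.
- exact: A_affine A_cos.
by apply: AE (A_gen 1) => x; rewrite character100.
Qed.

Let A010 : A (character (0, 1, 0)).
Proof.
apply: (@A_div (fun x => R0 + r * sin x.2) (R0 - r) (R0 + r)).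
- by move: hr hrR; lra.
- by move=> x; have := sin_geN1 x.2; have := sin_le1 x.2; move: (sin _) => c c1 c2;
    move: hr hrR => ? ?; apply/andP; split; nra.
- exact: A_affine A_sin.
by apply: AE (A_gen 2%:R) => x; rewrite character010.
Qed.

Let A001 : A (character (0, 0, 1)).
Proof.
have := smooth_closureD HP A_cos (smooth_closureZ HP 'i%C A_sin).
apply: AE => x /=; rewrite character001 imag_complex -complexr0 add_complex.
by rewrite addr0 add0r.
Qed.

Lemma smooth_closure_character n : A (character n).
Proof.
have Aint (m : frequency) (z : int) : A (character m) ->
    A (character (z * m.1.1, z * m.1.2, z * m.2)).
  move=> Am; case: z => p; last rewrite NegzE.
    apply: AE (smooth_closureX HP p Am) => x.
    elim: p => [|p IH]; first by rewrite !mul0r character0.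
    rewrite exprS IH -characterD /=; congr (character _ x).
    by rewrite -addn1 PoszD !mulrDl !mul1r !(addrC _ (Posz p * _)).
  (* Characters have modulus 1, so negative powers are conjugates of positive ones. *)
  apply: AE (smooth_closure_conj HP (smooth_closureX HP p.+1 Am)) => x /=.
  have H q : character (Posz q * m.1.1, Posz q * m.1.2, Posz q * m.2) x = character m x ^+ q.
    elim: q => [|q IH]; first by rewrite !mul0r character0.
    rewrite exprS -IH -characterD /=; congr (character _ x).
    by rewrite -addn1 PoszD !mulrDl !mul1r !(addrC _ (Posz q * _)).
  by rewrite -H -characterN /= !mulNr.
have := smooth_closureM HP (smooth_closureM HP (Aint _ n.1.1 A100) (Aint _ n.1.2 A010))
  (Aint _ n.2 A001).
apply: AE => x /=; rewrite -!characterD /=; congr (character _ x).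
by case: n => [[n1 n2] n3] /=; rewrite !mulr0 !mulr1 !addr0 !add0r.
Qed.

End TorusProfiles.

(** * Two profiles never suffice: an infinitesimal phase relation that saturation preserves *)

Section Minimality.
Context {R : realType}.
Implicit Types (f g : euclid3 R -> R[i]).

Lemma Re_sum (I : Type) (s : seq I) (F : I -> R[i]) :
  complex.Re (\sum_(j <- s) F j) = \sum_(j <- s) complex.Re (F j).
Proof. by apply: (big_morph (@complex.Re R)); [exact: ReD|]. Qed.

Lemma Im_sum (I : Type) (s : seq I) (F : I -> R[i]) :
  complex.Im (\sum_(j <- s) F j) = \sum_(j <- s) complex.Im (F j).
Proof. by apply: (big_morph (@complex.Im R)); [exact: ImD|]. Qed.

Section Derivation.
Context (x0 : euclid3 R) (v : 'I_3 -> R).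

Definition directional f : R[i] := \sum_i (v i)%:C * partial i f x0.

(** The number c acts as a charge at x0: charges add under products and change sign under
    conjugation. Differentiability is included so that these rules can be proved. *)
Definition phase_rotated (c : R) f :=
  (forall i, cderivable i f) /\ directional f = 'i * c%:C * f x0.

Lemma phase_rotatedM c d f g : phase_rotated c f -> phase_rotated d g ->
  phase_rotated (c + d) (f \* g).
Proof.
move=> [df Df] [dg Dg]; split=> [i|]; first exact: cderivableM.
rewrite /directional.
under eq_bigr => i _ do rewrite (partialM (df i) (dg i)) /= mulrDr mulrA mulrCA.
rewrite big_split /= -mulr_suml -mulr_sumr -/(directional f) -/(directional g).
rewrite Df Dg rmorphD; ring.
Qed.

Lemma phase_rotatedD c f g : phase_rotated c f -> phase_rotated c g ->
  phase_rotated c (f \+ g).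
Proof.
move=> [df Df] [dg Dg]; split=> [i|]; first exact: cderivableD.
rewrite /directional.
under eq_bigr => i _ do rewrite (partialD (df i) (dg i)) /= mulrDr.
by rewrite big_split /= -/(directional f) -/(directional g) Df Dg mulrDr.
Qed.

Lemma phase_rotated_cst z : phase_rotated 0 (fun=> z).
Proof.
split=> [i|]; first exact: cderivable_cst.
rewrite mulr0 mul0r /directional big1 // => i _.
by rewrite partial_cst mulr0.
Qed.

Lemma phase_rotatedZ c z f : phase_rotated c f ->
  phase_rotated c (fun x => z * f x).
Proof. by move=> /(phase_rotatedM (phase_rotated_cst z)); rewrite add0r. Qed.

Lemma phase_rotated_conj c f : phase_rotated c f ->
  phase_rotated (- c) (fun x => (f x)^*%C).
Proof.
move=> [df Df]; split=> [i|]; first exact: cderivable_conj.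
transitivity ((directional f)^*%C).
  rewrite /directional rmorph_sum; apply: eq_bigr => i _.
  rewrite (partial_conj (df i)).
  by rewrite [RHS](rmorphM (@conjc R)) /= oppr0.
rewrite Df !(rmorphM (@conjc R)) rmorphN; congr (_ * _).
by apply: complexP; rewrite !(ReM, ImM, ReN, ImN) /=; ring.
Qed.

(** Every term of [D3N] has two plain factors and one conjugate, hence charge c + c - c = c. *)
Lemma phase_rotated_step c f g h : phase_rotated c f -> phase_rotated c g ->
  phase_rotated c h -> phase_rotated c (fun x => opJ (D3N (f x) (g x) (h x))).
Proof.
move=> rf rg rh.
have T f1 f2 f3 : phase_rotated c f1 -> phase_rotated c f2 ->
    phase_rotated c f3 -> phase_rotated c (fun x => f1 x * f2 x * (f3 x)^*%C).
  move=> r1 r2 r3.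
  have := phase_rotatedM (phase_rotatedM r1 r2) (phase_rotated_conj r3).
  by rewrite addrK.
have H := phase_rotatedD (phase_rotatedD (T _ _ _ rf rg rh) (T _ _ _ rf rh rg))
  (T _ _ _ rg rh rf).
have := phase_rotatedZ 'i%C (phase_rotatedZ 2 H).
exact.
Qed.

Lemma phase_rotated_span c (S : set (euclid3 R -> R[i])) :
  (forall f, S f -> phase_rotated c f) ->
  forall f, real_span S f -> phase_rotated c f.
Proof.
move=> HS _ [n [a [s [Ss ->]]]].
elim: n a s Ss => [|n IH] a s Ss.
  rewrite big_ord0; split=> [i|]; first exact: cderivable_cst.
  rewrite mulr0 /directional big1 // => i _.
  by rewrite (partial_cst i 0) mulr0.
rewrite big_ord_recl; apply: phase_rotatedD; last by apply: IH => j; exact: Ss.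
by apply: (@phase_rotatedZ c (a ord0)%:C); exact: HS.
Qed.

Lemma phase_rotated_satW_infty c m (b : 'I_m -> euclid3 R -> R[i]) :
  (forall j, phase_rotated c (b j)) ->
  forall f, satW_infty b f -> phase_rotated c f.
Proof.
move=> rb f [n _]; have r0 : forall f, real_span (range b) f -> phase_rotated c f.
  by apply: phase_rotated_span => _ [j _ <-].
elim: n f => [|n IH] f; first exact: r0.
apply: phase_rotated_span => {}f [/IH //|[phi [g [h [Wphi Sg Sh ->]]]]].
by apply: phase_rotated_step; [exact: IH|exact: r0|exact: r0].
Qed.

(** The relation involves only the value and the first derivatives at x0, so it is closed under C^1
    limits. *)
Lemma phase_rotated_dense c (W : set (euclid3 R -> R[i])) f :
  (forall g, W g -> phase_rotated c g) -> Ck_closure 1 W f -> phase_rotated c f.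
Proof.
move=> rW [[tf df] Hf]; have [_ df1] := df; split=> [i|]; first by have [] := df1 i.
apply/eqP; rewrite -subr_eq0; apply/eqP/Normc.eq0_normc/eqP.
rewrite eq_le normc_ge0 andbT; apply/ler_addgt0Pl => e e0; rewrite addr0.
(* The sum of |v_i| and |c| bounds the functional f |-> D_v f - i c f (x0) on the C^1 norm; adding 1
   makes K positive. *)
pose K : R := \sum_i `|v i| + `|c| + 1.
have K0 : 0 < K by rewrite /K ltr_wpDl // addr_ge0 // sumr_ge0.
have [w [Ww [_ dw]] fw] := Hf _ (divr_gt0 e0 K0).
have [_ Dw] := rW _ Ww.
have dfi i : cderivable i f by have [] := df1 i.
have dwi i : cderivable i w by have [_ /(_ i)[]] := dw.
(* The approximant w satisfies the relation, so the defect of f equals that of f - w. *)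
have -> : directional f - 'i * c%:C * f x0 =
    \sum_i (v i)%:C * partial i (f \- w) x0 - 'i * c%:C * (f \- w) x0.
  have -> : \sum_i (v i)%:C * partial i (f \- w) x0 = directional f - directional w.
    rewrite /directional -sumrB; apply: eq_bigr => i _.
    by rewrite (partialB (dfi i) (dwi i)) /= mulrBr.
  by rewrite Dw /= mulrBr opprB addrA subrK.
have N0 : normc ((f \- w) x0) <= e / K.
  exact: (@Ck_norm_bound _ 1 (f \- w) [::] x0 _ isT fw).
have N1 i : normc (partial i (f \- w) x0) <= e / K.
  exact: (@Ck_norm_bound _ 1 (f \- w) [:: i] x0 _ isT fw).
apply: le_trans (le_normcD _ _) _.
rewrite normcN !Normc.normcM.
have -> : normc ('i%C : R[i]) = 1 by rewrite /= expr0n expr1n add0r sqrtr1.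
rewrite normc_real mul1r.
have H3 : normc (\sum_i (v i)%:C * partial i (f \- w) x0) <=
    (\sum_i `|v i|) * (e / K).
  rewrite mulr_suml; apply: (big_ind2 (fun z y => normc z <= y)) => [|z1 y1 z2 y2 h1 h2|i _].
  - by rewrite Normc.normc0.
  - by apply: le_trans (le_normcD _ _) _; exact: lerD.
  - by rewrite Normc.normcM normc_real ler_wpM2l.
have H4 : `|c| * normc ((f \- w) x0) <= `|c| * (e / K) by rewrite ler_wpM2l.
apply: le_trans (lerD H3 H4) _; rewrite -mulrDl mulrA ler_pdivrMr // mulrC.
by rewrite ler_wpM2l ?ltW // /K ltrDl.
Qed.

End Derivation.

(** Fermat's rule on the line through x0 in direction e_i. *)
Lemma max_real_partial i f x0 : cderivable i f ->
  (forall x, re_part f x <= re_part f x0) -> complex.Re (partial i f x0) = 0.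
Proof.
move=> df fmax; pose phi (t : R) := re_part f (t *: evec i + x0).
have dphi (t : R) : derivable phi t 1.
  have [d1 _] := df (t *: evec i + x0).
  have H : forall h, re_part f ((h - t) *: evec i + (t *: evec i + x0)) = phi h.
    by move=> h; rewrite addrA -scalerDl subrK.
  by have [] := line_is_derive H d1.
have H0 : forall h, re_part f ((h - 0) *: evec i + x0) = phi h by move=> h; rewrite subr0.
have [_ E] := line_is_derive H0 (df x0).1.
have : is_derive (0 : R) 1 phi 0.
  apply: (@derive1_at_max _ phi (-1) 1).
  - by rewrite (@le_trans _ _ 0) // ?lerN10.
  - by move=> t _; exact: dphi.
  - by rewrite in_itv /= ltrN10 ltr01.
  - by move=> t _; rewrite /phi scale0r add0r.
by case=> _; rewrite E.
Qed.

Lemma phase_rotation_exists m (b : 'I_m -> euclid3 R -> R[i]) :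
  (m < 3)%N -> (forall j, Cinfty (b j)) ->
  exists x0 (v : 'I_3 -> R) (c : R), (c != 0 \/ exists i, v i != 0) /\
    forall j, phase_rotated x0 v c (b j).
Proof.
move=> m3 Cb.
pose rho x := \sum_j b j x * (b j x)^*%C.
have Crho : Cinfty rho.
  by apply: Cinfty_sum => j; apply: CinftyM => //; exact: Cinfty_conj.
have /CinftyP[trho drho] := Crho; have [crho _] := drho 0%N.
have cell0 : cell ((0, 0, 0) : euclid3 R).
  by split; [split|]; rewrite /= in_itv /= lexx mulrn_wge0 // pi_ge0.
have [x0 _ x0max] := compact_EVT_max (ex_intro _ _ cell0) (@compact_cell R)
  (continuous_subspaceT crho.1).
have rmax x : re_part rho x <= re_part rho x0.
  have [y cy yE] := cell_representative x.
  by rewrite /re_part -(yE _ trho); exact: x0max (mem_set cy).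
have Dj j i : cderivable i (b j) := Cinfty_cderivable i (Cb j).
(* The left side is half of the i-th derivative of [rho], which vanishes at its maximum; periodicity
   makes the maximum over the cell a global one. *)
have crit i : \sum_j (complex.Re (partial i (b j) x0) * complex.Re (b j x0) +
    complex.Im (partial i (b j) x0) * complex.Im (b j x0)) = 0.
  have := max_real_partial (Cinfty_cderivable i Crho) rmax.
  rewrite /rho (partial_sum _ (F := fun j => b j \* (fun x => (b j x)^*%C))); last first.
    by move=> j; apply: cderivableM => //; exact: cderivable_conj.
  rewrite Re_sum => E; apply: (mulfI (x := 2)) => //; rewrite mulr0 -[RHS]E mulr_sumr.
  apply: eq_bigr => j _.
  rewrite (partialM (Dj j i) (cderivable_conj (Dj j i))) (partial_conj (Dj j i)).
  transitivity (complex.Re (partial i (b j) x0 * (b j x0)^*%C +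
    b j x0 * (partial i (b j) x0)^*%C)) => //; rewrite ReD !ReM.
  case: (partial i (b j) x0) => p q; case: (b j x0) => s t /=; ring.
(* A row vector (v, c) kills M exactly when D_v Re b_j = - c Im b_j and D_v Im b_j = c Re b_j for
   all j, the two parts of D_v b_j = i c b_j. *)
pose M : 'M[R]_(3 + 1, m + m) := col_mx
  (row_mx (\matrix_(i, j) complex.Re (partial i (b j) x0))
          (\matrix_(i, j) complex.Im (partial i (b j) x0)))
  (row_mx (\matrix_(i, j) complex.Im (b j x0))
          (\matrix_(i, j) - complex.Re (b j x0))).
have kernel (k : 'rV[R]_(3 + 1)) : k *m M = 0 -> k != 0 ->
  exists x0 (v : 'I_3 -> R) (c : R), (c != 0 \/ exists i, v i != 0) /\
    forall j, phase_rotated x0 v c (b j).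
  move=> kM k0; exists x0, (fun i => lsubmx k 0 i), (rsubmx k 0 0); split.
    have [c0|] := eqVneq (rsubmx k 0 0) 0; last by left.
    right; apply: contrapT => /forallNP l0; move/eqP: k0; apply.
    rewrite -(hsubmxK k) -row_mx0; congr row_mx.
      by apply/rowP => i; have /negP/negPn/eqP -> := l0 i; rewrite mxE.
    by apply/rowP => i; rewrite ord1 c0 mxE.
  move=> j; split=> //.
  move: kM; rewrite -{1}(hsubmxK k) mul_row_col !mul_mx_row add_row_mx -row_mx0.
  move=> /eq_row_mx [/rowP /(_ j) E1 /rowP /(_ j) E2].
  move: E1 E2; rewrite !mxE !big_ord1 !mxE => E1 E2.
  rewrite /directional; apply: complexP; rewrite !(ReM, ImM) /= ?(Re_sum, Im_sum).
    move: E1 => /eqP; rewrite addr_eq0 => /eqP E1.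
    transitivity (- (rsubmx k 0 0 * complex.Im (b j x0))); last by rewrite mxE; ring.
    rewrite mxE -E1; apply: eq_bigr => i _; rewrite ReM !mxE /=; ring.
  move: E2 => /eqP; rewrite addr_eq0 => /eqP E2.
  transitivity (rsubmx k 0 0 * complex.Re (b j x0)); last by rewrite mxE; ring.
  rewrite mxE -[RHS]opprK -mulrN -E2; apply: eq_bigr => i _; rewrite ImM !mxE /=; ring.
(* If all profiles vanish at x0, the vector F below is zero and gives no information on the rank,
   but v = 0 and c = 1 satisfy the relation. The case m = 0 also lands here. *)
have [F0|/existsNP[j0 Fj0]] := pselect (forall j, b j x0 = 0).
  exists x0, (fun=> 0), 1; split; first by left; exact: oner_neq0.
  move=> j; split=> //; rewrite F0 mulr0 /directional big1 // => i _.
  by rewrite mul0r.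
pose F : 'cV[R]_(m + m) := col_mx (\col_j complex.Re (b j x0)) (\col_j complex.Im (b j x0)).
(* The first three rows are the critical point equations [crit]; the last one is Im b_j Re b_j - Re
   b_j Im b_j summed over j. *)
have MF : M *m F = 0.
  rewrite mul_col_mx !mul_row_col -col_mx0; congr col_mx.
    apply/colP => i; rewrite !mxE -big_split /= -[RHS](crit i); apply: eq_bigr => j _.
    by rewrite !mxE.
  apply/colP => i; rewrite !mxE -big_split /= big1 // => j _.
  by rewrite !mxE; ring.
(* There are m + m <= 4 columns, and full column rank is excluded by the nonzero vector F. *)
have rM : (\rank M < 3 + 1)%N.
  apply: (@leq_trans (m + m)); last first.
    by rewrite addnn -[(3 + 1)%N]/(2.*2) leq_double.
  rewrite ltn_neqAle rank_leq_col andbT; apply/negP => /row_fullP[B BM].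
  have F0 : F = 0 by rewrite -[F]mul1mx -BM -mulmxA MF mulmx0.
  apply: Fj0; apply: complexP.
    have /colP/(_ (lshift m j0)) := F0; by rewrite col_mxEu !mxE.
  have /colP/(_ (rshift m j0)) := F0; by rewrite col_mxEd !mxE.
have : kermx M != 0.
  by rewrite kermx_eq0 /row_free; apply: contraTneq rM => ->; rewrite ltnn.
by case/rowV0Pn => k /sub_kermxP kM k0; exact: kernel kM k0.
Qed.

(** Density would impose the phase relation on every smooth function, but the constant 1 forces c =
    0, and then the character e^(i x_i) forces v_i = 0. *)
Lemma Ck_dense_family_size m (b : 'I_m -> euclid3 R -> R[i]) :
  (forall j, Cinfty (b j)) -> Ck_closure 1 (satW_infty b) = Ck 1 -> (3 <= m)%N.
Proof.
move=> Cb bdense; rewrite leqNgt; apply/negP => m3.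
have [x0 [v [c [nz rb]]]] := phase_rotation_exists m3 Cb.
have rall f : Cinfty f -> phase_rotated x0 v c f.
  move=> Cf; apply: (phase_rotated_dense (phase_rotated_satW_infty rb)).
  by rewrite bdense; have := Cf 1%N I.
have c0 : c = 0.
  have [_] := rall _ (Cinfty_cst 1).
  rewrite /directional big1 => [|i _]; last by rewrite partial_cst mulr0.
  by rewrite mulr1 => /(congr1 (@complex.Im R)); rewrite ImM /= mul0r add0r mul1r.
case: nz => [|[i /eqP vi]]; first by rewrite c0 eqxx.
apply: vi.
pose n : frequency := ((i == 0)%:Z, (i == 1)%:Z, (i == 2%:R)%:Z).
have cn j : coordf n j = (j == i)%:Z.
  by rewrite /coordf /n; case: i {n} => -[|[|[|//]]] i3; case: j => -[|[|[|//]]] j3.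
have [_] := rall _ (Cinfty_character n).
rewrite c0 mulr0 mul0r /directional (bigD1 i) //= big1 => [|j ji]; last first.
  by rewrite partial_character cn (negbTE ji) mulr0 mul0r mulr0.
rewrite addr0 partial_character cn eqxx mulr1 => /(congr1 (@Normc.normc R)).
rewrite !Normc.normcM normc_character Normc.normc0 normc_real mulr1.
have -> : normc ('i%C : R[i]) = 1 by rewrite /= expr0n expr1n add0r sqrtr1.
by rewrite mulr1 => /normr0_eq0.
Qed.

End Minimality.

(** * Measurability on the cell, and integrals of derivatives of periodic functions *)

Section CellIntegral.
Context {R : realType}.
Local Notation mu := (@lebesgue_measure R).
Local Notation leb3 := ((mu \x mu) \x mu)%E.
Local Notation borel3 :=
  (measurableTypeR R * measurableTypeR R * measurableTypeR R)%type.

(** Balls of the product are boxes, and an open set is the countable union of the boxes with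
    rational centre and radius 1 / (n + 1) that it contains. This links the topology to the product
    sigma-algebra. *)
Lemma open_measurable3 (U : set (euclid3 R)) : open U ->
  measurable (U : set borel3).
Proof.
move=> oU.
pose box (q : rat * rat * rat * nat) : set (euclid3 R) :=
  ball ((ratr q.1.1.1, ratr q.1.1.2, ratr q.1.2) : euclid3 R) (q.2.+1%:R^-1).
have mbox q : measurable (box q : set borel3).
  have mb (a : R) : measurable (ball a (q.2.+1%:R^-1) : set (measurableTypeR R)).
    by apply: open_measurable; apply: ball_open; rewrite invr_gt0.
  rewrite (_ : box q = (ball (ratr q.1.1.1 : R) (q.2.+1%:R^-1) `*`
    ball (ratr q.1.1.2 : R) (q.2.+1%:R^-1)) `*` ball (ratr q.1.2 : R) (q.2.+1%:R^-1)) //.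
  by apply: measurableX; [apply: measurableX|]; exact: mb.
pose F q : set borel3 := if pselect (box q `<=` U) then box q else set0.
have -> : U = \bigcup_q F q.
  apply/seteqP; split=> [x Ux|x [q _]]; last first.
    by rewrite /F; case: pselect => // qU; exact: qU.
  have /nbhs_ballP[e /= e0 xeU] : nbhs x U by exact: open_nbhs_nbhs.
  have e20 : 0 < e / 2 by rewrite divr_gt0.
  have [n ne] : exists n : nat, n.+1%:R^-1 < e / 2.
    have /cvgrPdist_lt /(_ _ e20)[n _ /(_ n (leqnn n))] /= := @cvg_harmonic R.
    by rewrite sub0r normrN ger0_norm // ?invr_ge0 // => ?; exists n.
  have n0 : 0 < n.+1%:R^-1 :> R by rewrite invr_gt0.
  have rapprox (t : R) : exists q : rat, ball (ratr q : R) n.+1%:R^-1 t.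
    have [q] := rat_in_itvoo (ltr_pwDr n0 (lexx t)).
    rewrite in_itv /= => /andP[q1 q2]; exists q; rewrite -ball_normE /ball_ /=.
    by rewrite gtr0_norm ?subr_gt0 // ltrBlDl.
  have [q1 b1] := rapprox x.1.1; have [q2 b2] := rapprox x.1.2.
  have [q3 b3] := rapprox x.2.
  have bx : box (q1, q2, q3, n) x by [].
  exists (q1, q2, q3, n) => //; rewrite /F; case: pselect => // nU; exfalso; apply: nU.
  move=> y by_; apply: xeU; rewrite [e]splitr.
  apply: (ball_triangle (y := (ratr q1, ratr q2, ratr q3) : euclid3 R)).
    by apply: ball_sym; apply: (le_ball (ltW ne)); exact: bx.
  by apply: (le_ball (ltW ne)); exact: by_.
apply: countable_bigcupT_measurable => // q.
by rewrite /F; case: pselect => ?; [exact: mbox|exact: measurable0].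
Qed.

Lemma continuous_measurable3 (g : euclid3 R -> R) : continuous g ->
  measurable_fun [set: borel3] (g : borel3 -> R).
Proof.
move=> cg; apply: (measurability _ (RGenOpens.measurableE R)).
move=> _ [_ [a [b ->]] <-]; rewrite setTI; apply: open_measurable3.
by apply: open_comp => //; exact: interval_open.
Qed.


Let I2pi : set R := `[0, pi *+ 2].

Let pi2_gt0 : 0 < pi *+ 2 :> R.
Proof. by rewrite pmulrn_lgt0 // pi_gt0. Qed.

Let mI2pi : measurable (I2pi : set (measurableTypeR R)).
Proof. exact: measurable_itv. Qed.

Let mu_I2pi : mu I2pi = (pi *+ 2)%:E.
Proof. by rewrite /I2pi lebesgue_measure_itv /= lte_fin pi2_gt0 oppr0 adde0. Qed.

Lemma measurable_cell : measurable (cell : set borel3).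
Proof. by apply: measurableX; [apply: measurableX|]; exact: mI2pi. Qed.

Lemma leb3_cell : leb3 (cell : set borel3) = ((pi *+ 2) ^+ 3)%:E.
Proof.
have -> : leb3 (cell : set borel3) = (mu I2pi * mu I2pi * mu I2pi)%E.
  rewrite [LHS]product_measure1E //; last exact: measurableX.
  by congr (_ * _)%E; exact: product_measure1E.
rewrite !mu_I2pi -!EFinM.
by congr (_%:E); rewrite !exprS expr0; ring.
Qed.

Lemma leb3_cell_fin : (leb3 (cell : set borel3) < +oo)%E.
Proof. by rewrite leb3_cell ltry. Qed.

Section ZeroSections.
Context d1 d2 (T1 : measurableType d1) (T2 : measurableType d2)
  (m1 : {sigma_finite_measure set T1 -> \bar R})
  (m2 : {sigma_finite_measure set T2 -> \bar R})
  (A : set T1) (B : set T2) (f : T1 * T2 -> R).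
Hypotheses (mA : measurable A) (mB : measurable B).
Hypothesis intf : (m1 \x m2)%E.-integrable (A `*` B) (EFin \o f).

Let g := (EFin \o f) \_ (A `*` B).

Let ig : (m1 \x m2)%E.-integrable setT g.
Proof. by apply/(integrable_mkcond _ (measurableX mA mB)). Qed.

(** Fubini for the function extended by 0 outside the product set; the sections outside A then
    vanish identically. *)
Lemma integral_prod_sections1 :
  (forall x, A x -> (\int[m2]_(y in B) (f (x, y))%:E = 0)%E) ->
  (\int[(m1 \x m2)%E]_(z in A `*` B) (f z)%:E = 0)%E.
Proof.
move=> f0; rewrite integral_mkcond -(integral12_prod_meas1 ig).
apply: integral0_eq => x _; rewrite /fubini_F.
have [Ax|nAx] := pselect (A x).
  rewrite -(f0 x Ax) [RHS]integral_mkcond; apply: eq_integral => y _.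
  rewrite /g !patchE; have [yB|yB] := boolP (y \in B).
    by rewrite ifT // in_setX yB mem_set.
  by rewrite ifF // in_setX (negbTE yB) andbF.
apply: integral0_eq => y _; rewrite /g patchE ifF //.
by rewrite in_setX memNset.
Qed.

Lemma integral_prod_sections2 :
  (forall y, B y -> (\int[m1]_(x in A) (f (x, y))%:E = 0)%E) ->
  (\int[(m1 \x m2)%E]_(z in A `*` B) (f z)%:E = 0)%E.
Proof.
move=> f0; rewrite integral_mkcond -(integral21_prod_meas1 ig).
apply: integral0_eq => y _; rewrite /fubini_G.
have [By|nBy] := pselect (B y).
  rewrite -(f0 y By) [RHS]integral_mkcond; apply: eq_integral => x _.
  rewrite /g !patchE; have [xA|xA] := boolP (x \in A).
    by rewrite ifT // in_setX xA mem_set.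
  by rewrite ifF // in_setX (negbTE xA).
apply: integral0_eq => x _; rewrite /g patchE ifF //.
by rewrite in_setX (memNset nBy) andbF.
Qed.

End ZeroSections.

(* The library's sigma-finite instance on product measures is shadowed by the
   one for subprobabilities, so the plane measure gets its own name here. *)
Definition plane_measure : set (measurableTypeR R * measurableTypeR R) -> \bar R :=
  (mu \x mu)%E.

HB.instance Definition _ := Measure.copy plane_measure (mu \x mu)%E.

Let plane_measure_sigma_finite : sigma_finite setT plane_measure.
Proof.
have /sigma_finiteP[F [TF ndF Foo]] := sigma_finiteT mu.
exists (fun n => F n `*` F n).
  rewrite -setXTT {1 2}TF predeqE => -[x y]; split.
    move=> [/= [n _ Fnx] [k _ Fky]]; exists (maxn n k) => //; split.
      by move: x Fnx; exact/subsetPset/ndF/leq_maxl.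
    by move: y Fky; exact/subsetPset/ndF/leq_maxr.
  by move=> [n _ []/= ? ?]; split; exists n.
move=> k; have [mFk Fk_fin] := Foo k; split; first exact: measurableX.
rewrite [ltLHS]product_measure1E // lte_mul_pinfty // ge0_fin_numE //.
Qed.

HB.instance Definition _ := Measure_isSigmaFinite.Build _ _ _ plane_measure
  plane_measure_sigma_finite.

Lemma bounded_integrable_cell (g : borel3 -> R) (M : R) :
  measurable_fun setT g -> (forall x, `|g x| <= M) ->
  leb3.-integrable cell (EFin \o g).
Proof.
move=> mg gM; apply: measurable_bounded_integrable; first exact: measurable_cell.
- exact: leb3_cell_fin.
- exact: measurable_funTS.
exists M; split; first exact: num_real.
by move=> N MN x _; exact: le_trans (gM x) (ltW MN).
Qed.

Lemma integral_line_derivative (phi dphi : R -> R) :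
  (forall t : R, is_derive t 1 phi (dphi t)) -> continuous dphi ->
  phi (pi *+ 2) = phi 0 -> (\int[mu]_(t in I2pi) (dphi t)%:E = 0)%E.
Proof.
move=> Dphi cdphi phi2pi.
have dphi' (t : R) : derivable phi t 1 by case: (Dphi t).
have cphi : continuous phi.
  by move=> t; apply: differentiable_continuous; exact/derivable1_diffP.
rewrite (@continuous_FTC2 _ dphi phi) //.
- by rewrite phi2pi subee.
- exact: continuous_subspaceT.
- split=> [t _ //| |].
  + exact/cvg_at_right_filter/cphi.
  + exact/cvg_at_left_filter/cphi.
- by move=> t _; rewrite derive1E; case: (Dphi t).
Qed.


Let bounded_integrable2 (g : measurableTypeR R * measurableTypeR R -> R) (M : R) :
  measurable_fun setT g -> (forall x, `|g x| <= M) ->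
  (mu \x mu)%E.-integrable (I2pi `*` I2pi) (EFin \o g).
Proof.
move=> mg gM; apply: measurable_bounded_integrable; first exact: measurableX.
- apply: (@le_lt_trans _ _ (mu I2pi * mu I2pi)%E).
    by rewrite le_eqVlt; apply/orP; left; apply/eqP; exact: product_measure1E.
  by rewrite !mu_I2pi -EFinM ltry.
- exact: measurable_funTS.
exists M; split; first exact: num_real.
by move=> N MN x _; exact: le_trans (gM x) (ltW MN).
Qed.

(** By Fubini the integration is done first along the direction of the derivative, where the
    fundamental theorem of calculus and periodicity give 0. Since points are nested pairs, x_3 is
    reached by one splitting and x_1, x_2 by two. *)
Lemma integral_directional_derivative (F G : euclid3 R -> R) i (M : R) :
  (forall x, derivable F x (evec i) /\ 'D_(evec i) F x = G x) ->
  continuous G ->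
  (forall x, F (x + (pi *+ 2) *: evec i) = F x) ->
  (forall x, `|G x| <= M) ->
  (\int[leb3]_(x in cell) (G x)%:E = 0)%E.
Proof.
have mI2pi2 := measurableX mI2pi mI2pi.
move=> dF cG pF GM.
have mG := continuous_measurable3 cG.
have iG := bounded_integrable_cell mG GM.
have line (j : R -> euclid3 R) : continuous j ->
    (forall t h, j h = (h - t) *: evec i + j t) ->
    (\int[mu]_(t in I2pi) (G (j t))%:E = 0)%E.
  move=> cj jE; apply: (@integral_line_derivative (F \o j) (G \o j)).
  - move=> t; have [dFt DFt] := dF (j t).
    apply: is_derive_eq DFt; apply: line_is_derive dFt => h /=.
    by rewrite -jE.
  - by move=> t; apply: continuous_comp; [exact: cj|exact: cG].
  - by rewrite /= (jE 0) subr0 addrC pF.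
have cst_id (a : R) : continuous (fun _ : R => a) by exact: cst_continuous.
have ccid : continuous (@id R) by move=> t; exact: cvg_id.
have cpair (u v w : R -> R) : continuous u -> continuous v -> continuous w ->
    continuous (fun t => ((u t, v t), w t) : euclid3 R).
  by move=> cu cv cw t; exact: (cvg_pair (cvg_pair (cu t) (cv t)) (cw t)).
have [i2|i2] := eqVneq (i : nat) 2%N.
  apply: (@integral_prod_sections1 _ _ _ _ plane_measure mu _ _ G mI2pi2 mI2pi iG).
  move=> [x1 x2] _; apply: (line (fun t => (x1, x2, t))) => [|t h].
    exact: cpair.
  rewrite euclid3_add euclid3_scale /evec i2 /=.
  by rewrite !mulr0 !add0r mulr1 subrK.
apply: (@integral_prod_sections2 _ _ _ _ plane_measure mu _ _ G mI2pi2 mI2pi iG).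
move=> x3 _.
have iG3 : (mu \x mu)%E.-integrable (I2pi `*` I2pi) (EFin \o (fun p => G (p, x3))).
  apply: (bounded_integrable2 (M := M)) => [|p]; last exact: GM.
  exact: measurableT_comp mG (pair2_measurable _).
have [i1|i1] := eqVneq (i : nat) 1%N.
  apply: (integral_prod_sections1 mI2pi mI2pi iG3) => x1 _.
  apply: (line (fun t => (x1, t, x3))) => [|t h]; first exact: cpair.
  rewrite euclid3_add euclid3_scale /evec i1 /=.
  by rewrite !mulr0 !add0r mulr1 subrK.
have i0 : (i : nat) = 0%N by case: i {dF pF line} i1 i2 => -[|[|[|//]]].
apply: (integral_prod_sections2 mI2pi mI2pi iG3) => x2 _.
apply: (line (fun t => (t, x2, x3))) => [|t h]; first exact: cpair.
rewrite euclid3_add euclid3_scale /evec i0 /=.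
by rewrite !mulr0 !add0r mulr1 subrK.
Qed.

End CellIntegral.

(** * Complex integrals over the cell and integration by parts *)

Section FourierCoefficients.
Context {R : realType}.
Local Notation mu := (@lebesgue_measure R).
Local Notation leb3 := ((mu \x mu) \x mu)%E.
Local Notation borel3 :=
  (measurableTypeR R * measurableTypeR R * measurableTypeR R)%type.
Implicit Types (f g : euclid3 R -> R[i]).
Local Notation rint g := (Rintegral leb3 cell g).
Local Notation rintegrable g := (leb3.-integrable (cell : set borel3) (EFin \o g)).

Definition cmeasurable f :=
  measurable_fun [set: borel3] (re_part f : borel3 -> R) /\
  measurable_fun [set: borel3] (im_part f : borel3 -> R).

Definition cintegrable f := rintegrable (re_part f) /\ rintegrable (im_part f).

Lemma rintegrableD (u v : borel3 -> R) : rintegrable u -> rintegrable v ->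
  rintegrable (fun x => u x + v x).
Proof. by move=> iu iv; exact: (integrableD measurable_cell iu iv). Qed.

Lemma rintegrableZ (c : R) (u : borel3 -> R) : rintegrable u ->
  rintegrable (fun x => c * u x).
Proof. by move=> iu; exact: (integrableZl measurable_cell c iu). Qed.

Lemma rintD (u v : borel3 -> R) : rintegrable u -> rintegrable v ->
  rint (fun x => u x + v x) = rint u + rint v.
Proof. by move=> iu iv; exact: (RintegralD measurable_cell iu iv). Qed.

Lemma rintZ (c : R) (u : borel3 -> R) : rintegrable u ->
  rint (fun x => c * u x) = c * rint u.
Proof. by move=> iu; exact: (RintegralZl c measurable_cell iu). Qed.

Lemma cmeasurableM f g : cmeasurable f -> cmeasurable g -> cmeasurable (f \* g).
Proof.
move=> [f1 f2] [g1 g2]; rewrite /cmeasurable re_partM im_partM; split.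
  exact: measurable_funB (measurable_funM f1 g1) (measurable_funM f2 g2).
exact: measurable_funD (measurable_funM f1 g2) (measurable_funM f2 g1).
Qed.

Lemma cmeasurableD f g : cmeasurable f -> cmeasurable g -> cmeasurable (f \+ g).
Proof.
move=> [f1 f2] [g1 g2]; rewrite /cmeasurable re_partD im_partD; split.
  exact: measurable_funD f1 g1.
exact: measurable_funD f2 g2.
Qed.

Lemma re_part_conj f : re_part (fun x => (f x)^*%C) = re_part f.
Proof. by apply/funext => x; rewrite /re_part; case: (f x). Qed.

Lemma im_part_conj f : im_part (fun x => (f x)^*%C) = - im_part f.
Proof. by apply/funext => x; rewrite fctE /im_part; case: (f x). Qed.

Lemma cmeasurable_conj f : cmeasurable f -> cmeasurable (fun x => (f x)^*%C).
Proof.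
move=> [f1 f2]; rewrite /cmeasurable re_part_conj im_part_conj; split=> //.
exact: measurable_funN.
Qed.

Lemma ccontinuous_cmeasurable f : ccontinuous f -> cmeasurable f.
Proof. by move=> [c1 c2]; split; exact: continuous_measurable3. Qed.

Lemma cmeasurable_normc f : cmeasurable f ->
  measurable_fun [set: borel3] (fun x => normc (f x) ^+ 2 : R).
Proof.
move=> [f1 f2]; rewrite (_ : (fun _ => _) =
    fun x => re_part f x * re_part f x + im_part f x * im_part f x); last first.
  by apply/funext => x; rewrite sqr_normcE !expr2.
exact: measurable_funD (measurable_funM f1 f1) (measurable_funM f2 f2).
Qed.

Lemma cintegrableD f g : cintegrable f -> cintegrable g -> cintegrable (f \+ g).
Proof.
move=> [f1 f2] [g1 g2]; rewrite /cintegrable re_partD im_partD.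
by split; [exact: rintegrableD f1 g1|exact: rintegrableD f2 g2].
Qed.

Lemma cintegralD f g : cintegrable f -> cintegrable g ->
  cintegral (f \+ g) = cintegral f + cintegral g.
Proof.
move=> [f1 f2] [g1 g2]; rewrite /cintegral re_partD im_partD.
by rewrite add_complex -(rintD f1 g1) -(rintD f2 g2).
Qed.

Lemma re_partZ (c : R[i]) f : re_part (fun x => c * f x) = fun x =>
  complex.Re c * re_part f x + (- complex.Im c) * im_part f x.
Proof. by apply/funext => x; rewrite /re_part ReM mulNr. Qed.

Lemma im_partZ (c : R[i]) f : im_part (fun x => c * f x) = fun x =>
  complex.Re c * im_part f x + complex.Im c * re_part f x.
Proof. by apply/funext => x; rewrite /im_part ImM. Qed.

Lemma cintegrableZ (c : R[i]) f : cintegrable f -> cintegrable (fun x => c * f x).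
Proof.
move=> [f1 f2]; rewrite /cintegrable re_partZ im_partZ.
by split; exact: rintegrableD (rintegrableZ _ _) (rintegrableZ _ _).
Qed.

Lemma cintegralZ (c : R[i]) f : cintegrable f ->
  cintegral (fun x => c * f x) = c * cintegral f.
Proof.
move=> [f1 f2]; rewrite /cintegral re_partZ im_partZ.
rewrite !rintD; try exact: rintegrableZ.
rewrite !rintZ //; case: c => c1 c2 /=; rewrite mul_complex.
by rewrite mulNr.
Qed.

Lemma cintegrable0 : cintegrable (fun=> 0).
Proof. by split; exact: integrable0. Qed.

Lemma cintegral0 : cintegral (fun=> 0 : R[i]) = 0.
Proof.
by rewrite /cintegral /re_part /im_part /= !(Rintegral_cst _ measurable_cell) !mul0r.
Qed.

Lemma cintegrable_sum (I : Type) (s : seq I) (F : I -> euclid3 R -> R[i]) :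
  (forall j, cintegrable (F j)) -> cintegrable (fun x => \sum_(j <- s) F j x).
Proof.
move=> iF; elim: s => [|j s IH].
  by rewrite (_ : (fun _ => _) = fun=> 0); [exact: cintegrable0|];
    apply/funext => x; rewrite big_nil.
rewrite (_ : (fun _ => _) = F j \+ (fun x => \sum_(j <- s) F j x)).
  exact: cintegrableD.
by apply/funext => x; rewrite big_cons.
Qed.

Lemma cintegral_sum (I : Type) (s : seq I) (F : I -> euclid3 R -> R[i]) :
  (forall j, cintegrable (F j)) ->
  cintegral (fun x => \sum_(j <- s) F j x) = \sum_(j <- s) cintegral (F j).
Proof.
move=> iF; elim: s => [|j s IH].
  rewrite (_ : (fun _ => _) = fun=> 0); first by rewrite cintegral0 big_nil.
  by apply/funext => x; rewrite big_nil.
rewrite (_ : (fun _ => _) = F j \+ (fun x => \sum_(j <- s) F j x)); last first.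
  by apply/funext => x; rewrite big_cons.
by rewrite (cintegralD (iF j) (cintegrable_sum s iF)) IH big_cons.
Qed.

Lemma bounded_cintegrable f (M : R) : cmeasurable f ->
  (forall x, normc (f x) <= M) -> cintegrable f.
Proof.
move=> [f1 f2] fM; split; apply: (bounded_integrable_cell (M := M)) => // x.
  exact: le_trans (normc_geRe _) (fM x).
exact: le_trans (normc_geIm _) (fM x).
Qed.

Lemma ccontinuous_cintegrable f : torus_fun f -> ccontinuous f -> cintegrable f.
Proof.
move=> tf cf; have [M fM] := ccontinuous_bounded tf cf.
exact: bounded_cintegrable (ccontinuous_cmeasurable cf) fM.
Qed.

Lemma cintegral_partial i f : Ck 1 f -> cintegral (partial i f) = 0.
Proof.
move=> [tf [cf df]]; have [dfi [[cp1 cp2] _]] := df i.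
have [M pM] := ccontinuous_bounded (torus_partial i tf) (conj cp1 cp2).
rewrite /cintegral /Rintegral.
have -> := integral_directional_derivative (F := re_part f) (M := M) (i := i)
  (fun x => conj (dfi x).1 erefl) cp1 _ (fun x => le_trans (normc_geRe _) (pM x)).
  have -> := integral_directional_derivative (F := im_part f) (M := M) (i := i)
    (fun x => conj (dfi x).2 erefl) cp2 _ (fun x => le_trans (normc_geIm _) (pM x)).
    by [].
  by move=> x; rewrite /im_part tf.
by move=> x; rewrite /re_part tf.
Qed.

Lemma CkM k f g : Ck k f -> Ck k g -> Ck k (f \* g).
Proof. by move=> [tf df] [tg dg]; split; [exact: torusM|exact: diff_classM]. Qed.

Lemma Ck_cintegrable k f : Ck k f -> cintegrable f.
Proof. by move=> [tf /diff_class_ccontinuous]; exact: ccontinuous_cintegrable. Qed.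

Lemma integration_by_parts i f g : Ck 1 f -> Ck 1 g ->
  cintegral (f \* partial i g) = - cintegral (partial i f \* g).
Proof.
move=> Cf Cg; have := cintegral_partial i (CkM Cf Cg).
have [tf [cf df]] := Cf; have [tg [cg dg]] := Cg.
have [dfi [cpf _]] := df i; have [dgi [cpg _]] := dg i.
rewrite (partialM dfi dgi) cintegralD; last 2 first.
- by apply: ccontinuous_cintegrable; [apply: torusM (torus_partial i tf) tg|exact: ccontinuousM].
- by apply: ccontinuous_cintegrable; [apply: torusM tf (torus_partial i tg)|exact: ccontinuousM].
by move/eqP; rewrite addrC addr_eq0 => /eqP.
Qed.

End FourierCoefficients.

(** * Square integrable functions and the squared mean square norm *)

Section SquareIntegrable.
Context {R : realType}.
Local Notation mu := (@lebesgue_measure R).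
Local Notation leb3 := ((mu \x mu) \x mu)%E.
Local Notation borel3 :=
  (measurableTypeR R * measurableTypeR R * measurableTypeR R)%type.
Implicit Types (f g : euclid3 R -> R[i]) (n m : frequency).
Local Notation rint g := (Rintegral leb3 cell g).
Local Notation rintegrable g := (leb3.-integrable (cell : set borel3) (EFin \o g)).

Lemma rintegrable_le (u v : borel3 -> R) : measurable_fun setT u ->
  (forall x, `|u x| <= v x) -> rintegrable v -> rintegrable u.
Proof.
move=> mu' uv; apply: (le_integrable measurable_cell).
  by apply/measurable_EFinP; exact: measurable_funTS.
by move=> x _ /=; rewrite lee_fin (le_trans (uv x)) // ler_norm.
Qed.

Lemma rintegrable_cst (c : R) : rintegrable (fun=> c).
Proof.
apply: (bounded_integrable_cell (M := `|c|)) => //; exact: measurable_cst.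
Qed.

Lemma cintegrable_le f (v : borel3 -> R) : cmeasurable f ->
  (forall x, normc (f x) <= v x) -> rintegrable v -> cintegrable f.
Proof.
move=> [f1 f2] fv iv; split; apply: rintegrable_le iv => // x.
  exact: le_trans (normc_geRe _) (fv x).
exact: le_trans (normc_geIm _) (fv x).
Qed.

Lemma L2_cmeasurable f : L2 f -> cmeasurable f.
Proof. by case. Qed.

Lemma L2_rintegrable f : L2 f -> rintegrable (fun x => normc (f x) ^+ 2).
Proof.
move=> Lf; have [_ _ _ fin] := Lf; apply/integrableP; split.
  apply/measurable_EFinP; apply: measurable_funTS.
  exact: cmeasurable_normc (L2_cmeasurable Lf).
apply: le_lt_trans fin; rewrite /L2_sqnorm le_eqVlt; apply/orP; left; apply/eqP.
apply: eq_integral => x _ /=; by rewrite ger0_norm // sqr_ge0.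
Qed.

Definition norm2 f : R := rint (fun x => normc (f x) ^+ 2).

Lemma norm2_ge0 f : 0 <= norm2 f.
Proof. by apply: Rintegral_ge0 => x _; exact: sqr_ge0. Qed.

Lemma L2_sqnormE f : L2 f -> L2_sqnorm f = (norm2 f)%:E.
Proof.
move=> [_ _ _ fin]; rewrite /norm2 /Rintegral fineK // ge0_fin_numE //.
by apply: integral_ge0 => x _; rewrite lee_fin sqr_ge0.
Qed.

Lemma sqr_normcD (z w : R[i]) : normc (z + w) ^+ 2 =
  normc z ^+ 2 + normc w ^+ 2 + 2 * complex.Re (z * w^*%C).
Proof.
rewrite !sqr_normcE; case: z => a b; case: w => c d /=; ring.
Qed.

Lemma sqr_normcD_le (z w : R[i]) :
  normc (z + w) ^+ 2 <= 2 * normc z ^+ 2 + 2 * normc w ^+ 2.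
Proof.
rewrite !sqr_normcE; case: z => a b; case: w => c d /=.
by have := sqr_ge0 (a - c); have := sqr_ge0 (b - d); nra.
Qed.

Lemma normcM_le (z w : R[i]) : normc (z * w) <= normc z ^+ 2 + normc w ^+ 2.
Proof.
rewrite Normc.normcM; have := normc_ge0 z; have := normc_ge0 w.
by move: (normc z) (normc w) => a b; have := sqr_ge0 (a - b); nra.
Qed.

Lemma L2I f : torus_fun f -> cmeasurable f ->
  rintegrable (fun x => normc (f x) ^+ 2) -> L2 f.
Proof.
move=> tf [f1 f2] /integrableP[_ fin]; split=> //; apply: le_lt_trans fin.
rewrite /L2_sqnorm le_eqVlt; apply/orP; left; apply/eqP.
by apply: eq_integral => x _ /=; rewrite ger0_norm // sqr_ge0.
Qed.

Lemma L2D f g : L2 f -> L2 g -> L2 (f \+ g).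
Proof.
move=> Lf Lg; apply: L2I.
- by apply: torusD; [case: Lf|case: Lg].
- by apply: cmeasurableD; exact: L2_cmeasurable.
apply: (rintegrable_le (v := fun x => 2 * normc (f x) ^+ 2 + 2 * normc (g x) ^+ 2)).
- exact: cmeasurable_normc (cmeasurableD (L2_cmeasurable Lf) (L2_cmeasurable Lg)).
- by move=> x; rewrite ger0_norm ?sqr_ge0 //; exact: sqr_normcD_le.
by apply: rintegrableD; apply: rintegrableZ; exact: L2_rintegrable.
Qed.

Lemma bounded_L2 f (M : R) : torus_fun f -> cmeasurable f ->
  (forall x, normc (f x) <= M) -> L2 f.
Proof.
move=> tf mf fM; apply: L2I => //.
apply: (rintegrable_le (v := fun=> M ^+ 2)) => [|x|]; last exact: rintegrable_cst.
  exact: cmeasurable_normc.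
rewrite ger0_norm ?sqr_ge0 // lerXn2r ?nnegrE ?normc_ge0 //.
exact: le_trans (normc_ge0 _) (fM x).
Qed.

Lemma ccontinuous_L2 f : torus_fun f -> ccontinuous f -> L2 f.
Proof.
move=> tf cf; have [M fM] := ccontinuous_bounded tf cf.
exact: bounded_L2 tf (ccontinuous_cmeasurable cf) fM.
Qed.

Lemma Ck_L2 k f : Ck k f -> L2 f.
Proof. by move=> [tf /diff_class_ccontinuous]; exact: ccontinuous_L2. Qed.

Lemma L2M_bounded f g (M : R) : L2 f -> torus_fun g -> cmeasurable g ->
  (forall x, normc (g x) <= M) -> L2 (f \* g).
Proof.
move=> Lf tg mg gM; have M0 : 0 <= M := le_trans (normc_ge0 _) (gM 0).
apply: L2I.
- by apply: torusM => //; case: Lf.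
- by apply: cmeasurableM => //; exact: L2_cmeasurable.
apply: (rintegrable_le (v := fun x => M ^+ 2 * normc (f x) ^+ 2)).
- exact: cmeasurable_normc (cmeasurableM (L2_cmeasurable Lf) mg).
- move=> x; rewrite ger0_norm ?sqr_ge0 // Normc.normcM exprMn mulrC.
  by rewrite ler_wpM2r ?sqr_ge0 // lerXn2r ?nnegrE ?normc_ge0.
by apply: rintegrableZ; exact: L2_rintegrable.
Qed.

Lemma L2Z (c : R[i]) f : L2 f -> L2 (fun x => c * f x).
Proof.
move=> Lf; rewrite (_ : (fun _ => _) = f \* (fun=> c)); last first.
  by apply/funext => x; rewrite mulrC.
apply: (@L2M_bounded _ _ (normc c)) => //.
by apply/ccontinuous_cmeasurable/ccontinuous_cst.
Qed.

Lemma L2B f g : L2 f -> L2 g -> L2 (f \- g).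
Proof.
move=> Lf Lg; rewrite (_ : f \- g = f \+ (fun x => (-1) * g x)).
  by apply: L2D => //; exact: L2Z.
by apply/funext => x /=; rewrite mulN1r.
Qed.

Lemma L2_conj f : L2 f -> L2 (fun x => (f x)^*%C).
Proof.
move=> Lf; apply: L2I.
- by apply: torus_conj; case: Lf.
- by apply/cmeasurable_conj/L2_cmeasurable.
by under [X in EFin \o X]eq_fun do rewrite normc_conj; exact: L2_rintegrable.
Qed.

Lemma L2M_cintegrable f g : L2 f -> L2 g -> cintegrable (f \* g).
Proof.
move=> Lf Lg; have mfg := cmeasurableM (L2_cmeasurable Lf) (L2_cmeasurable Lg).
apply: (cintegrable_le (v := fun x => normc (f x) ^+ 2 + normc (g x) ^+ 2)) => //.
  by move=> x; exact: normcM_le.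
by apply: rintegrableD; exact: L2_rintegrable.
Qed.

(** The pointwise inequality |z + w|^2 <= 2 |z|^2 + 2 |w|^2 is integrated; it takes the place of
    Minkowski's inequality, without square roots. *)
Lemma norm2D_le f g : L2 f -> L2 g ->
  norm2 (f \+ g) <= 2 * norm2 f + 2 * norm2 g.
Proof.
move=> Lf Lg; have if2 := L2_rintegrable Lf; have ig2 := L2_rintegrable Lg.
rewrite /norm2 -!rintZ // -rintD; try exact: rintegrableZ.
apply: le_Rintegral; first exact: measurable_cell.
- exact: L2_rintegrable (L2D Lf Lg).
- by apply: rintegrableD; exact: rintegrableZ.
- by move=> x _; exact: sqr_normcD_le.
Qed.

Lemma norm2_pythagoras f g : L2 f -> L2 g ->
  cintegral (f \* (fun x => (g x)^*%C)) = 0 ->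
  norm2 (f \+ g) = norm2 f + norm2 g.
Proof.
move=> Lf Lg fg0; have if2 := L2_rintegrable Lf; have ig2 := L2_rintegrable Lg.
have [ifg _] := L2M_cintegrable Lf (L2_conj Lg).
have E : norm2 (f \+ g) = rint (fun x => normc (f x) ^+ 2 + normc (g x) ^+ 2 +
    2 * re_part (f \* (fun x => (g x)^*%C)) x).
  by apply: eq_Rintegral => x _; rewrite sqr_normcD.
rewrite E rintD; [|exact: rintegrableD|exact: rintegrableZ].
rewrite rintD // rintZ //.
have -> : rint (re_part (f \* (fun x => (g x)^*%C))) = 0.
  by have /(congr1 (@complex.Re R)) := fg0.
by rewrite mulr0 addr0.
Qed.

Lemma norm2_le f (M : R) : cmeasurable f -> 0 <= M ->
  (forall x, normc (f x) <= M) -> norm2 f <= M ^+ 2 * (pi *+ 2) ^+ 3.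
Proof.
move=> mf M0 fM.
have H x : normc (f x) ^+ 2 <= M ^+ 2 by rewrite lerXn2r ?nnegrE ?normc_ge0.
have : norm2 f <= rint (fun=> M ^+ 2).
  apply: le_Rintegral => //; first exact: measurable_cell.
  - apply: (rintegrable_le (v := fun=> M ^+ 2)) => [|x|]; last exact: rintegrable_cst.
      exact: cmeasurable_normc.
    by rewrite ger0_norm ?sqr_ge0.
  - exact: rintegrable_cst.
by rewrite (Rintegral_cst _ measurable_cell) [X in fine X]leb3_cell.
Qed.

End SquareIntegrable.

(** * Fourier coefficients and the best approximation property *)

Section FourierSeries.
Context {R : realType}.
Implicit Types (f g : euclid3 R -> R[i]) (n m : frequency).

Definition volume : R := (pi *+ 2) ^+ 3.

Lemma volume_gt0 : 0 < volume.
Proof. by rewrite exprn_gt0 // pmulrn_lgt0 // pi_gt0. Qed.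

Definition fhat f n : R[i] :=
  (volume^-1)%:C * cintegral (f \* (fun x => (character n x)^*%C)).

Definition oppf n : frequency := (- n.1.1, - n.1.2, - n.2).
Definition addf n m : frequency := (n.1.1 + m.1.1, n.1.2 + m.1.2, n.2 + m.2).

Lemma conj_character n :
  (fun x : euclid3 R => (character n x)^*%C) = character (oppf n).
Proof. by apply/funext => x; rewrite characterN. Qed.

Lemma Ck_character k n : Ck k (character n : euclid3 R -> R[i]).
Proof. by have := @Cinfty_character R n k I. Qed.

Lemma L2_character n : L2 (character n : euclid3 R -> R[i]).
Proof. exact: Ck_L2 (Ck_character 0 n). Qed.

Lemma fhat_cintegrable f n : L2 f ->
  cintegrable (f \* (fun x => (character n x)^*%C)).
Proof. by move=> Lf; rewrite conj_character; exact: L2M_cintegrable (L2_character _). Qed.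

Lemma fhatD f g n : L2 f -> L2 g -> fhat (f \+ g) n = fhat f n + fhat g n.
Proof.
move=> Lf Lg; rewrite /fhat -mulrDr -cintegralD; try exact: fhat_cintegrable.
by congr (_ * cintegral _); apply/funext => x /=; rewrite mulrDl.
Qed.

Lemma fhatZ (c : R[i]) f n : L2 f -> fhat (fun x => c * f x) n = c * fhat f n.
Proof.
move=> Lf; rewrite /fhat mulrCA -(cintegralZ c (fhat_cintegrable n Lf)).
by congr (_ * cintegral _); apply/funext => x /=; rewrite mulrA.
Qed.

Lemma fhatB f g n : L2 f -> L2 g -> fhat (f \- g) n = fhat f n - fhat g n.
Proof.
move=> Lf Lg; rewrite (_ : f \- g = f \+ (fun x => (-1) * g x)).
  by rewrite (fhatD _ Lf (L2Z _ Lg)) fhatZ // mulN1r.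
by apply/funext => x /=; rewrite mulN1r.
Qed.

Lemma L2_sum (T : Type) (s : seq T) (F : T -> euclid3 R -> R[i]) :
  (forall j, L2 (F j)) -> L2 (fun x => \sum_(j <- s) F j x).
Proof.
move=> LF; elim: s => [|j s IH].
  rewrite (_ : (fun _ => _) = fun=> 0); last first.
    by apply/funext => x; rewrite big_nil.
  by have := @Cinfty_cst R 0 0%N I; exact: Ck_L2.
rewrite (_ : (fun _ => _) = F j \+ (fun x => \sum_(j <- s) F j x)).
  exact: L2D.
by apply/funext => x; rewrite big_cons.
Qed.

Lemma coordf0P n : (forall i, coordf n i = 0) -> n = (0, 0, 0).
Proof.
case: n => [[n1 n2] n3] H; have h0 := H 0; have h1 := H 1; have h2 := H 2%:R.
by rewrite /coordf /= in h0 h1 h2; rewrite h0 h1 h2.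
Qed.

(** If some n_i is nonzero, the character is its own i-th derivative divided by i n_i, and
    derivatives of periodic functions integrate to 0. *)
Lemma cintegral_character n : cintegral (character n) =
  if n == (0, 0, 0) then volume%:C else 0 :> R[i].
Proof.
case: eqVneq => [->|n0].
  rewrite (_ : character _ = fun=> 1); last by apply/funext => x; exact: character0.
  rewrite /cintegral /re_part /im_part /= !(Rintegral_cst _ measurable_cell).
  by rewrite mul0r mul1r [X in fine X]leb3_cell.
have [i ni] : exists i, coordf n i != 0.
  apply: contrapT => /forallNP H; move/eqP: n0; apply; apply: coordf0P => i.
  by have /negP/negPn/eqP := H i.
have := cintegral_partial i (Ck_character 1 n).
rewrite partial_character cintegralZ; last exact: Ck_cintegrable (Ck_character 0 n).
move/eqP; rewrite mulf_eq0 mulf_eq0 => /orP[/orP[]|/eqP //].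
  by rewrite eq_complex /= oner_eq0 andbF.
by rewrite intr_eq0 (negbTE ni).
Qed.

Lemma character_mul_conj n m :
  (character n : euclid3 R -> R[i]) \* (fun x => (character m x)^*%C) =
  character (addf n (oppf m)).
Proof. by rewrite conj_character; apply/funext => x; rewrite characterD. Qed.

Lemma addf_opp_eq0 n m : (addf n (oppf m) == (0, 0, 0)) = (n == m).
Proof.
case: n => [[a b] c]; case: m => [[d e] f]; rewrite /addf /oppf /= !xpair_eqE.
by rewrite !subr_eq0.
Qed.

Lemma fhat_character n m : fhat (character n) m = (n == m)%:R.
Proof.
rewrite /fhat character_mul_conj cintegral_character addf_opp_eq0.
case: eqVneq => _; last by rewrite mulr0.
by rewrite -rmorphM mulVf // gt_eqF // volume_gt0.
Qed.

Lemma fhat_sum (T : Type) (s : seq T) (F : T -> euclid3 R -> R[i]) n :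
  (forall j, L2 (F j)) ->
  fhat (fun x => \sum_(j <- s) F j x) n = \sum_(j <- s) fhat (F j) n.
Proof.
move=> LF; rewrite /fhat -mulr_sumr -cintegral_sum; last first.
  by move=> j; exact: fhat_cintegrable.
by congr (_ * cintegral _); apply/funext => x /=; rewrite mulr_suml.
Qed.

(** The weak derivative is tested against the character of frequency - n. *)
Lemma fhat_weak_partial i f g n : L2 f -> weak_partials i f g ->
  fhat g n = ('i * (coordf n i)%:~R) * fhat f n.
Proof.
move=> Lf [Lg Hg]; have := Hg _ (@Cinfty_character R (oppf n)).
rewrite partial_character /fhat conj_character => H.
have E : coordf (oppf n) i = - coordf n i.
  by rewrite /coordf /oppf; case: (i == 0) => //; case: (i == 1).
have -> : cintegral (g \* character (oppf n)) =
   - cintegral (f \* (fun x => 'i * (coordf (oppf n) i)%:~R * character (oppf n) x)).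
  by rewrite H opprK.
rewrite mulrN mulrCA -mulrN; congr (_ * _).
rewrite (_ : _ \* _ = fun x => - ('i * (coordf n i)%:~R) * (f \* character (oppf n)) x).
  rewrite cintegralZ ?mulNr ?opprK //.
  exact: L2M_cintegrable Lf (L2_character _).
by apply/funext => x /=; rewrite E intrN; ring.
Qed.

Lemma Ck_weak_partial i f : Ck 1 f -> weak_partials i f (partial i f).
Proof.
move=> Cf; have [tf [cf df]] := Cf; have [dfi [cpf _]] := df i; split.
  exact: ccontinuous_L2 (torus_partial i tf) cpf.
by move=> phi Cphi; exact: integration_by_parts Cf (Cphi 1%N I).
Qed.

Definition fourier_sum (s : seq frequency) f (x : euclid3 R) : R[i] :=
  \sum_(n <- s) fhat f n * character n x.

Lemma Cinfty_fourier_sum s f : Cinfty (fourier_sum s f).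
Proof. by apply: Cinfty_sum => n; apply: CinftyZ; exact: Cinfty_character. Qed.

Lemma fhat_fourier_sum s f m : uniq s -> m \in s ->
  fhat (fourier_sum s f) m = fhat f m.
Proof.
move=> us ms; rewrite fhat_sum; last by move=> n; exact: L2Z (L2_character n).
rewrite (bigD1_seq m) //= big1 => [|n nm].
  by rewrite fhatZ ?fhat_character ?eqxx ?mulr1 ?addr0 //; exact: L2_character.
rewrite fhatZ ?fhat_character ?(negbTE nm) ?mulr0 //; exact: L2_character.
Qed.

Lemma fourier_sum_partial s i f g : (forall n, fhat g n = ('i * (coordf n i)%:~R) * fhat f n) ->
  partial i (fourier_sum s f) = fourier_sum s g.
Proof.
move=> fg; rewrite partial_sum => [|n]; last first.
  by apply: cderivableZ; exact: cderivable_character.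
apply/funext => x; apply: eq_bigr => n _.
rewrite partialZ; last exact: cderivable_character.
by rewrite partial_character fg; ring.
Qed.

Lemma fhat_orthogonal f (t : seq frequency) (c : frequency -> R[i]) :
  L2 f -> (forall n, n \in t -> fhat f n = 0) ->
  cintegral (f \* (fun x => (\sum_(n <- t) c n * character n x)^*%C)) = 0.
Proof.
move=> Lf f0.
rewrite (_ : _ \* _ = fun x => \sum_(n <- t) (c n)^*%C * (f x * (character n x)^*%C)).
  rewrite cintegral_sum; last by move=> n; apply: cintegrableZ; exact: fhat_cintegrable.
  rewrite big_seq big1 // => n nt; rewrite cintegralZ; last exact: fhat_cintegrable.
  have := f0 n nt; rewrite /fhat => /eqP; rewrite mulf_eq0 => /orP[|/eqP E].
    by rewrite (inj_eq (@complexI _)) invr_eq0 gt_eqF // volume_gt0.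
  by rewrite [cintegral _]E mulr0.
apply/funext => x /=.
have -> : (\sum_(n <- t) c n * character n x)^*%C =
    \sum_(n <- t) (c n)^*%C * (character n x)^*%C.
  by rewrite conjc_sum; apply: eq_bigr => n _; rewrite conjcM.
by rewrite mulr_sumr; apply: eq_bigr => n _; rewrite mulrCA.
Qed.

(** f - S is orthogonal to all characters with frequency in s, hence to S - P, and Pythagoras
    applies. Allowing t to be smaller than s is what lets several approximations share one frequency
    set. *)
Lemma fourier_sum_best s t f (c : frequency -> R[i]) : L2 f -> uniq s ->
  {subset t <= s} ->
  norm2 (f \- fourier_sum s f) <=
  norm2 (f \- (fun x => \sum_(n <- t) c n * character n x)).
Proof.
move=> Lf us ts; set S := fourier_sum s f; set P := fun x => \sum_(n <- t) _.
have LS : L2 S by have CS := Cinfty_fourier_sum s f; exact: Ck_L2 (CS 0%N I).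
have LP : L2 P by apply: L2_sum => n; apply: L2Z; exact: L2_character.
have LfS := L2B Lf LS.
have o n : n \in s -> fhat (f \- S) n = 0.
  by move=> ns; rewrite fhatB // fhat_fourier_sum // subrr.
have oS : cintegral ((f \- S) \* (fun x => (S x)^*%C)) = 0 by exact: fhat_orthogonal.
have oP : cintegral ((f \- S) \* (fun x => (P x)^*%C)) = 0.
  by apply: fhat_orthogonal => // n /ts; exact: o.
have -> : f \- P = (f \- S) \+ (S \- P).
  by apply/funext => x /=; rewrite addrA subrK.
suff o0 : cintegral ((f \- S) \* (fun x => ((S \- P) x)^*%C)) = 0.
  by rewrite (norm2_pythagoras LfS (L2B LS LP) o0) lerDl norm2_ge0.
rewrite (_ : _ \* _ = ((f \- S) \* (fun x => (S x)^*%C)) \+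
   (fun x => (-1) * ((f \- S) \* (fun x => (P x)^*%C)) x)).
  rewrite cintegralD ?cintegralZ ?oS ?oP ?mulr0 ?addr0 //.
  - exact: L2M_cintegrable LfS (L2_conj LP).
  - exact: L2M_cintegrable LfS (L2_conj LS).
  - by apply: cintegrableZ; exact: L2M_cintegrable LfS (L2_conj LP).
apply/funext => x /=.
have -> : (S x - P x)^*%C = (S x)^*%C - (P x)^*%C by exact: rmorphB.
by rewrite mulN1r mulrBr.
Qed.

End FourierSeries.

(** * Fejer means, their positive kernel and their weights *)

Section Fejer.
Context {R : realType}.
Implicit Types (f g : euclid3 R -> R[i]) (n m : frequency) (N : nat).
Local Notation mu := (@lebesgue_measure R).
Local Notation leb3 := ((mu \x mu) \x mu)%E.
Local Notation borel3 :=
  (measurableTypeR R * measurableTypeR R * measurableTypeR R)%type.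
Local Notation rint g := (Rintegral leb3 cell g).
Local Notation rintegrable g := (leb3.-integrable (cell : set borel3) (EFin \o g)).

Definition cube N : finType := ('I_N.+1 * 'I_N.+1 * 'I_N.+1)%type.

Definition cube_freq N (j : cube N) : frequency :=
  (Posz j.1.1, Posz j.1.2, Posz j.2).

Definition diff_freq N (j l : cube N) : frequency :=
  addf (cube_freq j) (oppf (cube_freq l)).

(** The frequency n occurs as a difference j - l with multiplicity the product of the N + 1 - |n_i|,
    which gives the usual Fejer weights. The sum over pairs makes the kernel a squared modulus. *)
Definition fejer N f (x : euclid3 R) : R[i] :=
  ((N.+1%:R ^+ 3)^-1)%:C * \sum_(j : cube N) \sum_(l : cube N)
    fhat f (diff_freq j l) * character (diff_freq j l) x.

Lemma Cinfty_fejer N f : Cinfty (fejer N f).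
Proof.
apply: CinftyZ; apply: Cinfty_sum => j; apply: Cinfty_sum => l.
by apply: CinftyZ; exact: Cinfty_character.
Qed.

Lemma fejer_partial N i f : Ck 1 f ->
  partial i (fejer N f) = fejer N (partial i f).
Proof.
move=> Cf; have Lf := Ck_L2 Cf.
have D n : cderivable i (fun x => fhat f n * character n x).
  by apply: cderivableZ; exact: cderivable_character.
have DD (j : cube N) : cderivable i (fun x => \sum_(l : cube N)
    fhat f (diff_freq j l) * character (diff_freq j l) x).
  by apply: cderivable_sum => l; exact: D.
rewrite partialZ; last exact: cderivable_sum.
apply/funext => x; congr (_ * _).
rewrite partial_sum //; apply: eq_bigr => j _.
rewrite partial_sum => [|l]; last exact: D.
apply: eq_bigr => l _; rewrite partialZ; last exact: cderivable_character.
rewrite partial_character (fhat_weak_partial _ Lf (Ck_weak_partial i Cf)).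
by ring.
Qed.

Definition dirichlet N (x t : euclid3 R) : R[i] :=
  \sum_(j : cube N) character (cube_freq j) x * (character (cube_freq j) t)^*%C.

(** Written as a squared modulus, the kernel is visibly nonnegative, the property on which the
    convergence proof rests. *)
Definition fejer_kernel N (x t : euclid3 R) : R :=
  volume^-1 * (N.+1%:R ^+ 3)^-1 * normc (dirichlet N x t) ^+ 2.

Lemma fejer_kernel_ge0 N x t : 0 <= fejer_kernel N x t.
Proof.
have v0 := ltW (@volume_gt0 R).
apply: mulr_ge0 (sqr_ge0 _); apply: mulr_ge0; first by rewrite invr_ge0.
by rewrite invr_ge0 exprn_ge0.
Qed.

Lemma fejer_kernelE N x t : (fejer_kernel N x t)%:C =
  (volume^-1)%:C * (((N.+1%:R ^+ 3)^-1)%:C * \sum_(j : cube N) \sum_(l : cube N)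
    character (diff_freq j l) x * (character (diff_freq j l) t)^*%C).
Proof.
have sq (z : R[i]) : (normc z ^+ 2)%:C = z * z^*%C.
  by case: z => a b; rewrite sqr_normcE /= mul_complex -complexr0; congr (_ +i* _); ring.
have mulC (a b c : R) : (a * b * c)%:C = a%:C * (b%:C * c%:C) :> R[i].
  by rewrite -!(rmorphM (real_complex R)) mulrA.
rewrite /fejer_kernel mulC sq; congr (_ * (_ * _)).
rewrite /dirichlet conjc_sum mulr_suml; apply: eq_bigr => j _.
rewrite mulr_sumr; apply: eq_bigr => l _.
rewrite /diff_freq !characterD !conjcM.
by rewrite -!characterN /oppf; ring.
Qed.

Lemma fejer_integral N f x : L2 f ->
  fejer N f x = cintegral (fun t => (fejer_kernel N x t)%:C * f t).
Proof.
move=> Lf.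
rewrite (_ : (fun _ => _) = fun t => (volume^-1)%:C * (((N.+1%:R ^+ 3)^-1)%:C *
    \sum_(j : cube N) \sum_(l : cube N) character (diff_freq j l) x *
    (f t * (character (diff_freq j l) t)^*%C))); last first.
  apply/funext => t; rewrite fejer_kernelE -!mulrA; congr (_ * (_ * _)).
  rewrite mulr_suml; apply: eq_bigr => j _; rewrite mulr_suml; apply: eq_bigr => l _.
  by rewrite mulrAC mulrA.
have I1 n : cintegrable (fun t => character n x * (f t * (character n t)^*%C)).
  by apply: cintegrableZ; exact: fhat_cintegrable.
have I2 (j : cube N) : cintegrable (fun t => \sum_(l : cube N)
    character (diff_freq j l) x * (f t * (character (diff_freq j l) t)^*%C)).
  by apply: cintegrable_sum => l.
have I3 : cintegrable (fun t => \sum_(j : cube N) \sum_(l : cube N)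
    character (diff_freq j l) x * (f t * (character (diff_freq j l) t)^*%C)).
  exact: cintegrable_sum.
rewrite cintegralZ; last exact: cintegrableZ.
rewrite (cintegralZ _ I3) (cintegral_sum _ I2) mulrCA; congr (_ * _).
rewrite mulr_sumr; apply: eq_bigr => j _.
rewrite cintegral_sum // mulr_sumr; apply: eq_bigr => l _.
rewrite cintegralZ; last exact: fhat_cintegrable.
by rewrite mulrCA mulrC.
Qed.

Definition fejer_weight N n : R :=
  (N.+1%:R ^+ 3)^-1 * \sum_(j : cube N) \sum_(l : cube N) (n == diff_freq j l)%:R.

Lemma fejer_character N n x :
  fejer N (character n) x = (fejer_weight N n)%:C * character n x.
Proof.
rewrite /fejer_weight (rmorphM (real_complex R)) -mulrA; congr (_ * _).
rewrite (rmorph_sum (real_complex R)) mulr_suml; apply: eq_bigr => j _.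
rewrite (rmorph_sum (real_complex R)) mulr_suml; apply: eq_bigr => l _.
rewrite fhat_character; case: eqVneq => [->|_]; first by rewrite rmorph1.
by rewrite rmorph0 !mul0r.
Qed.

Lemma sum_cube N (u v w : 'I_N.+1 -> R) :
  \sum_(l : cube N) u l.1.1 * v l.1.2 * w l.2 =
  (\sum_a u a) * (\sum_a v a) * (\sum_a w a).
Proof.
rewrite -(pair_bigA _ (fun (p : 'I_N.+1 * 'I_N.+1) c => u p.1 * v p.2 * w c)) /=.
under eq_bigr => p _ do rewrite -mulr_sumr.
rewrite -mulr_suml; congr (_ * _).
rewrite -(pair_bigA _ (fun a b => u a * v b)) /= mulr_suml.
by apply: eq_bigr => a _; rewrite mulr_sumr.
Qed.

(** Only the (N + 1)^3 diagonal pairs have difference 0. *)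
Lemma fejer_weight0 N : fejer_weight N (0, 0, 0) = 1.
Proof.
rewrite /fejer_weight.
have -> : \sum_(j : cube N) \sum_(l : cube N) ((0, 0, 0) == diff_freq j l)%:R =
    \sum_(j : cube N) (1 * 1 * 1 : R).
  apply: eq_bigr => j _; rewrite (bigD1 j) //= big1 => [|l lj].
    by rewrite /diff_freq eq_sym addf_opp_eq0 eqxx addr0 !mulr1.
  rewrite /diff_freq eq_sym addf_opp_eq0; case: eqP => // -[/val_inj a /val_inj b /val_inj c].
  by move: lj; case: j l a b c => [[? ?] ?] [[? ?] ?] /= -> -> ->; rewrite eqxx.
rewrite (sum_cube (fun=> 1) (fun=> 1) (fun=> 1)) !sumr_const !card_ord.
by rewrite -expr2 -exprSr mulVf // expf_neq0 // pnatr_eq0.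
Qed.


Definition unit_freq (i : 'I_3) : frequency :=
  (Posz (i == 0), Posz (i == 1), Posz (i == 2%:R)).

Lemma sum_neq_max N : \sum_(a : 'I_N.+1) (a != ord_max)%:R = N%:R :> R.
Proof.
rewrite big_ord_recr /= eqxx addr0 (eq_bigr (fun=> 1)) => [|a _].
  by rewrite sumr_const card_ord.
by rewrite -val_eqE /= ltn_eqF.
Qed.

(* The pairs (j, j + e_i) with j_i < N already number N (N + 1)^2. *)
Lemma fejer_weight_unit N i :
  1 - N.+1%:R^-1 <= fejer_weight N (oppf (unit_freq i)).
Proof.
pose c (l : cube N) (k : 'I_3) : 'I_N.+1 :=
  if k == 0 then l.1.1 else if k == 1 then l.1.2 else l.2.
have step (j : cube N) : (c j i != ord_max)%:R <=
    \sum_(l : cube N) (oppf (unit_freq i) == diff_freq j l)%:R :> R.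
  case: eqVneq => [_|ji]; first by apply: sumr_ge0 => l _.
  have lt : ((c j i).+1 < N.+1)%N.
    by move: ji (ltn_ord (c j i)); rewrite -val_eqE /= ltnS leq_eqVlt => /negbTE ->.
  (* l is j + e_i, which stays in the cube because j_i is not the last index. *)
  pose l : cube N := (if i == 0 then Ordinal lt else j.1.1,
    if i == 1 then Ordinal lt else j.1.2, if i == 2%:R then Ordinal lt else j.2).
  have jl : oppf (unit_freq i) = diff_freq j l.
    rewrite /diff_freq /oppf /addf /unit_freq /cube_freq /l /c.
    by case: i {ji l} lt => -[|[|[|//]]] i3 lt /=; congr (_, _, _); lia.
  by rewrite (bigD1 l) //= jl eqxx lerDl sumr_ge0.
pose u (k : 'I_3) (a : 'I_N.+1) : R := if i == k then (a != ord_max)%:R else 1.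
have count : \sum_(j : cube N) (c j i != ord_max)%:R = N%:R * N.+1%:R ^+ 2 :> R.
  rewrite (eq_bigr (fun j : cube N => u 0 j.1.1 * u 1 j.1.2 * u 2%:R j.2)).
    rewrite sum_cube /u; case: i {c step u} => -[|[|[|//]]] i3 /=;
      rewrite sum_neq_max sumr_const card_ord; ring.
  move=> j _; rewrite /u /c.
  by case: i {c step u} => -[|[|[|//]]] i3 /=; rewrite ?mulr1 ?mul1r.
have N3 : 0 < (N.+1%:R ^+ 3 : R) by rewrite exprn_gt0.
apply: (@le_trans _ _ ((N.+1%:R ^+ 3)^-1 * \sum_(j : cube N) (c j i != ord_max)%:R)).
  rewrite count le_eqVlt; apply/orP; left; apply/eqP.
  by rewrite -[in LHS]natr1 -[in RHS]natr1; field; rewrite natr1 pnatr_eq0.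
by rewrite ler_pM2l ?invr_gt0 //; apply: ler_sum => j _; exact: step.
Qed.

End Fejer.

(** * A periodic gap function and the modulus of continuity it controls *)

Section Korovkin.
Context {R : realType}.
Implicit Types (f g : euclid3 R -> R[i]) (n m : frequency) (N : nat).

(** By the double angle formula sin (d / 2) = 0, and on [- pi, pi] the sine vanishes only at 0 and
    at the end points. *)
Lemma cos_eq1_bounded (d : R) : - (pi *+ 2) <= d <= pi *+ 2 -> cos d = 1 ->
  [\/ d = 0, d = pi *+ 2 | d = - (pi *+ 2)].
Proof.
move=> /andP[d1 d2] cd; pose e := d / 2.
have de : d = e *+ 2 by rewrite /e -mulr_natr divfK.
have se : sin e = 0.
  apply/eqP; rewrite -sqrf_eq0 sin2cos2; apply/eqP.
  by move: cd; rewrite de cos_mulr2n; lra.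
have pi2 : pi *+ 2 = pi + pi :> R by rewrite mulr2n.
have [e0|e0|e0] := ltrgtP e 0.
- have [ep|ep] := ltP (- e) pi.
    by have := @sin_gt0_pi _ (- e); rewrite sinN se oppr0 ltxx oppr_gt0 e0 ep => /(_ isT).
  by apply: Or33; move: d1 ep; rewrite pi2 de mulr2n; lra.
- have [ep|ep] := ltP e pi.
    by have := @sin_gt0_pi _ e; rewrite se ltxx e0 ep => /(_ isT).
  by apply: Or32; move: d2 ep; rewrite pi2 de mulr2n; lra.
- by apply: Or31; rewrite de e0 mul0rn.
Qed.

Definition axis_char i : euclid3 R -> R[i] := character (unit_freq i).

(** This is the sum of 1 - cos (x_i - t_i), a periodic substitute for |x - t|^2 that is a
    trigonometric polynomial in t. *)
Definition torus_gap (x t : euclid3 R) : R :=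
  \sum_i (1 - (re_part (axis_char i) x * re_part (axis_char i) t +
               im_part (axis_char i) x * im_part (axis_char i) t)).

Lemma torus_gap_term_ge0 i x t :
  0 <= 1 - (re_part (axis_char i) x * re_part (axis_char i) t +
            im_part (axis_char i) x * im_part (axis_char i) t).
Proof.
rewrite /axis_char /character /re_part /im_part /=.
set a := phase _ x; set b := phase _ t.
have := cos2Dsin2 a; have := cos2Dsin2 b.
move: (cos a) (sin a) (cos b) (sin b) => c s c' s' h1 h2.
by have := sqr_ge0 (c - c'); have := sqr_ge0 (s - s'); nra.
Qed.

Lemma torus_gap_ge0 x t : 0 <= torus_gap x t.
Proof. by apply: sumr_ge0 => i _; exact: torus_gap_term_ge0. Qed.

Lemma phase_unit (x : euclid3 R) :
  [/\ phase (unit_freq 0) x = x.1.1, phase (unit_freq 1) x = x.1.2 &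
      phase (unit_freq 2%:R) x = x.2].
Proof. by rewrite /phase /unit_freq /= !mul0r !mul1r !addr0 !add0r. Qed.

(** A vanishing gap makes each coordinate difference 0 or a full period. Since the closed cell
    contains both 0 and 2 pi, the points may be distinct, and the conclusion is equality of periodic
    functions. *)
Lemma torus_gap_eq0 x t : cell x -> cell t -> torus_gap x t = 0 ->
  forall f, torus_fun f -> f x = f t.
Proof.
move=> cx ct /eqP; rewrite psumr_eq0 => [/allP H f tf|i _]; last first.
  exact: torus_gap_term_ge0.
have E i : - (pi *+ 2) <= phase (unit_freq i) x - phase (unit_freq i) t <= pi *+ 2 ->
    exists z : int, phase (unit_freq i) x = phase (unit_freq i) t + z%:~R * (pi *+ 2).
  move=> bd; have /(_ (mem_index_enum _))/eqP := H i.
  rewrite /axis_char /character /re_part /im_part /= => /eqP.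
  rewrite subr_eq0 eq_sym -cosB => /eqP /(cos_eq1_bounded bd) [] E.
  - by exists 0; move/eqP: E; rewrite subr_eq0 mul0r addr0 => /eqP.
  - by exists 1; move/eqP: E; rewrite subr_eq mul1r addrC => /eqP.
  - by exists (-1); move/eqP: E; rewrite subr_eq mulN1r addrC => /eqP.
have bd (a b : R) : `[0, pi *+ 2]%classic a -> `[0, pi *+ 2]%classic b ->
    - (pi *+ 2) <= a - b <= pi *+ 2.
  by rewrite /= !in_itv /= => /andP[? ?] /andP[? ?]; apply/andP; split; lra.
have [x0 x1 x2] := phase_unit x; have [t0 t1 t2] := phase_unit t.
case: cx => -[cx1 cx2] cx3; case: ct => -[ct1 ct2] ct3.
have := E 0; rewrite x0 t0 => /(_ (bd _ _ cx1 ct1))[z1 E1].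
have := E 1; rewrite x1 t1 => /(_ (bd _ _ cx2 ct2))[z2 E2].
have := E 2%:R; rewrite x2 t2 => /(_ (bd _ _ cx3 ct3))[z3 E3].
have -> : x = t + (z1%:~R * (pi *+ 2)) *: evec 0 + (z2%:~R * (pi *+ 2)) *: evec 1
    + (z3%:~R * (pi *+ 2)) *: evec 2%:R.
  rewrite !euclid3_add !euclid3_scale /evec /= !mulr0 !mulr1 !addr0 -E1 -E2 -E3.
  by case: (x) => [[? ?] ?].
by rewrite !periodic_int_shift.
Qed.

(** Compactness: on the pairs of cell points with |f t - f x| >= e the gap is positive, as a zero
    gap would force f t = f x, so it has a positive minimum there. *)
Lemma torus_modulus f (e : R) : torus_fun f -> ccontinuous f -> 0 < e ->
  exists2 C : R, 0 <= C &
    forall x t, normc (f t - f x) <= e + C * torus_gap x t.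
Proof.
move=> tf cf e0.
suff [C C0 HC] : exists2 C : R, 0 <= C & forall x t, cell x -> cell t ->
    normc (f t - f x) <= e + C * torus_gap x t.
  exists C => // x t.
  have [x' cx' xE] := cell_representative x.
  have [t' ct' tE] := cell_representative t.
  rewrite -(xE f tf) -(tE f tf); apply: le_trans (HC _ _ cx' ct') _.
  rewrite lerD2l ler_wpM2l // le_eqVlt; apply/orP; left; apply/eqP.
  apply: eq_bigr => i _; rewrite /re_part /im_part /axis_char.
  by rewrite !(xE _ (torus_character (unit_freq i))) !(tE _ (torus_character (unit_freq i))).
have [M fM] := ccontinuous_bounded tf cf.
have M0 : 0 <= M := le_trans (normc_ge0 _) (fM 0).
pose T := (euclid3 R * euclid3 R)%type.
have cfst (h : euclid3 R -> R) : continuous h -> continuous (h \o fst : T -> R).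
  by move=> ch z; apply: continuous_comp; [exact: cvg_fst|exact: ch].
have csnd (h : euclid3 R -> R) : continuous h -> continuous (h \o snd : T -> R).
  by move=> ch z; apply: continuous_comp; [exact: cvg_snd|exact: ch].
pose q (z : T) : R := (re_part f z.2 - re_part f z.1) ^+ 2 +
  (im_part f z.2 - im_part f z.1) ^+ 2.
have qE x t : q (x, t) = normc (f t - f x) ^+ 2.
  by rewrite sqr_normcE !(ReD, ImD, ReN, ImN).
have cq : continuous q.
  move=> z; have [c1 c2] := cf.
  have d1 := continuousB (csnd _ c1 z) (cfst _ c1 z).
  have d2 := continuousB (csnd _ c2 z) (cfst _ c2 z).
  exact: continuousD (continuousM d1 d1) (continuousM d2 d2).
pose S (z : T) := torus_gap z.1 z.2.
have cS : continuous S.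
  pose F i (z : T) : R := 1 - (re_part (axis_char i) z.1 * re_part (axis_char i) z.2 +
    im_part (axis_char i) z.1 * im_part (axis_char i) z.2).
  have cF i : continuous (F i).
    move=> z; have [c1 c2] := @ccontinuous_character R (unit_freq i).
    have c := continuousD (continuousM (cfst _ c1 z) (csnd _ c1 z))
                          (continuousM (cfst _ c2 z) (csnd _ c2 z)).
    exact: continuousB (cvg_cst (1 : R)) c.
  rewrite (_ : S = fun z => \sum_(i <- index_enum 'I_3) F i z) //.
  elim: (index_enum _) => [|i s IH].
    rewrite (_ : (fun _ => _) = fun=> 0); first by move=> z; exact: cvg_cst.
    by apply/funext => z; rewrite big_nil.
  rewrite (_ : (fun _ => _) = (F i + (fun z => \sum_(i <- s) F i z))%R).
    by move=> z; exact: continuousD (cF i z) (IH z).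
  by apply/funext => z; rewrite big_cons.
pose K : set T := (cell `*` cell) `&` q @^-1` [set y | e ^+ 2 <= y].
have cK : compact K.
  apply: compact_closedI; first exact: compact_setX (compact_cell) (compact_cell).
  by apply: preimage_closed; [move=> z _; exact: cq|exact: closed_ge].
have far x t : cell x -> cell t -> ~ K (x, t) -> normc (f t - f x) <= e.
  move=> cx ct nK; rewrite leNgt; apply/negP => ge; apply: nK; split=> //=.
  by rewrite qE lerXn2r ?nnegrE ?normc_ge0 ?ltW.
have [[z0 Kz0]|K0] := pselect (K !=set0); last first.
  exists 0 => // x t cx ct; rewrite mul0r addr0; apply: far => // Kz.
  by apply: K0; exists (x, t).
have [z1 Kz1 z1min] := compact_EVT_min (ex_intro _ _ Kz0) cK (continuous_subspaceT cS).
have S1 : 0 < S z1.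
  rewrite lt_neqAle torus_gap_ge0 andbT eq_sym; apply/negP => /eqP S0.
  case: z1 Kz1 S0 {z1min} => x t /set_mem [[/= cx ct]] + S0.
  rewrite /= qE (torus_gap_eq0 cx ct S0 tf) subrr Normc.normc0 expr0n /=.
  by rewrite leNgt exprn_gt0.
(* |f t - f x| is at most 2 M everywhere, and on K the gap is at least its minimum [S z1]. *)
exists (2 * M / S z1) => [|x t cx ct]; first by rewrite divr_ge0 ?mulr_ge0 // ltW.
have gap0 := torus_gap_ge0 x t.
have [Kz|Kz] := pselect (K (x, t)); last first.
  apply: le_trans (far _ _ cx ct Kz) _; rewrite lerDl mulr_ge0 // divr_ge0 ?mulr_ge0 //.
  exact: ltW.
apply: (@le_trans _ _ (2 * M)).
  apply: le_trans (le_normcD _ _) _; rewrite normcN.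
  by have := fM x; have := fM t; lra.
apply: (@le_trans _ _ (2 * M / S z1 * torus_gap x t)); last by rewrite lerDr ltW.
rewrite -mulrA ler_peMr ?mulr_ge0 // mulrC ler_pdivlMr // mul1r.
exact: z1min (mem_set Kz).
Qed.

End Korovkin.

(** * Convergence of Fejer means in C^k, and density for the three profiles *)

Section FejerConvergence.
Context {R : realType}.
Implicit Types (f g : euclid3 R -> R[i]) (n m : frequency) (N : nat).
Local Notation mu := (@lebesgue_measure R).
Local Notation leb3 := ((mu \x mu) \x mu)%E.
Local Notation rint g := (Rintegral leb3 cell g).

Lemma fejerD N f g x : L2 f -> L2 g ->
  fejer N (f \+ g) x = fejer N f x + fejer N g x.
Proof.
move=> Lf Lg; rewrite /fejer -mulrDr -big_split; congr (_ * _).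
apply: eq_bigr => j _; rewrite -big_split; apply: eq_bigr => l _ /=.
by rewrite fhatD // mulrDl.
Qed.

Lemma fejerZ N (c : R[i]) f x : L2 f ->
  fejer N (fun t => c * f t) x = c * fejer N f x.
Proof.
move=> Lf; rewrite /fejer mulrCA; congr (_ * _); rewrite mulr_sumr.
apply: eq_bigr => j _; rewrite mulr_sumr; apply: eq_bigr => l _.
by rewrite fhatZ // -mulrA.
Qed.

Lemma fejer_sum N (T : Type) (s : seq T) (F : T -> euclid3 R -> R[i]) x :
  (forall j, L2 (F j)) ->
  fejer N (fun t => \sum_(j <- s) F j t) x = \sum_(j <- s) fejer N (F j) x.
Proof.
move=> LF; elim: s => [|j s IH].
  rewrite (_ : (fun _ => _) = fun t => 0 * (fun=> 0) t); last first.
    by apply/funext => t; rewrite big_nil mul0r.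
  rewrite fejerZ ?mul0r ?big_nil //.
  by apply: ccontinuous_L2; [exact: torus_cst|exact: ccontinuous_cst].
rewrite (_ : (fun _ => _) = F j \+ (fun t => \sum_(j <- s) F j t)); last first.
  by apply/funext => t; rewrite big_cons.
by rewrite (fejerD _ _ (LF j) (L2_sum s LF)) IH big_cons.
Qed.

Lemma Cinfty_fejer_kernel N (x : euclid3 R) : Cinfty (fun t => (fejer_kernel N x t)%:C).
Proof.
have -> : (fun t => (fejer_kernel N x t)%:C) = (fun t => (volume^-1)%:C *
    (((N.+1%:R ^+ 3)^-1)%:C * \sum_(j : cube N) \sum_(l : cube N)
    character (diff_freq j l) x * (character (diff_freq j l) t)^*%C)).
  by apply/funext => t; exact: fejer_kernelE.
apply: CinftyZ; apply: CinftyZ; apply: Cinfty_sum => j; apply: Cinfty_sum => l.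
by apply: CinftyZ; exact: Cinfty_conj (Cinfty_character _).
Qed.

Lemma fejer_cst N (c : R[i]) (x : euclid3 R) : fejer N (fun=> c) x = c.
Proof.
rewrite (_ : (fun _ : euclid3 R => c) = fun t => c * character (0, 0, 0) t); last first.
  by apply/funext => t; rewrite character0 mulr1.
rewrite (fejerZ _ _ _ (L2_character _)) fejer_character fejer_weight0 character0.
by rewrite (rmorph1 (real_complex R)) !mulr1.
Qed.

Lemma conj_axis_char i (x : euclid3 R) :
  axis_char i x * (axis_char i x)^*%C = 1.
Proof. by rewrite /axis_char /character -expiN -expiD subrr expi0. Qed.

(* Korovkin's argument: a positive operator fixing constants is controlled on
   f by its action on the gap function. *)
Lemma fejer_gap N (e C : R) (x : euclid3 R) : 0 <= C ->
  let V := fun t => (e + 3 * C)%:C - C%:C * \sum_i axis_char i x * (axis_char i t)^*%C in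
  [/\ Cinfty V, forall t, complex.Re (V t) = e + C * torus_gap x t &
      complex.Re (fejer N V x) <= e + 3 * C / N.+1%:R].
Proof.
move=> C0 V.
have CS : Cinfty (fun t => \sum_i axis_char i x * (axis_char i t)^*%C).
  apply: Cinfty_sum => i; apply: CinftyZ; exact: Cinfty_conj (Cinfty_character _).
have CV : Cinfty V by apply: CinftyB; [exact: Cinfty_cst|exact: CinftyZ].
split=> // [t|].
  have -> : torus_gap x t = 3 - \sum_i complex.Re (axis_char i x * (axis_char i t)^*%C).
    rewrite /torus_gap sumrB big_const_ord iter_addr_0; congr (_ - _).
    apply: eq_bigr => i _; rewrite ReM /re_part /im_part.
    by case: (axis_char i x) => a b; case: (axis_char i t) => c d /=; ring.
  rewrite /V ReD ReN ReM -Re_sum.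
  by move: (\sum_i _) => z /=; ring.
have LS : L2 (fun t => \sum_i axis_char i x * (axis_char i t)^*%C).
  by apply: (@Ck_L2 _ 0%N); exact: (CS 0%N I).
have -> : V = (fun=> (e + 3 * C)%:C) \+ (fun t => (- C)%:C *
    \sum_i axis_char i x * (axis_char i t)^*%C).
  by apply/funext => t; rewrite /V /= rmorphN mulNr.
rewrite fejerD; [|by apply: (@Ck_L2 _ 0%N); have := @Cinfty_cst R (e + 3 * C)%:C; exact|exact: L2Z].
rewrite fejer_cst fejerZ // fejer_sum; last first.
  by move=> i; exact: L2Z (L2_conj (L2_character _)).
have -> : \sum_i fejer N (fun t => axis_char i x * (axis_char i t)^*%C) x =
    (\sum_i fejer_weight N (oppf (unit_freq i)))%:C.
  rewrite (rmorph_sum (real_complex R)); apply: eq_bigr => i _.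
  rewrite (fejerZ _ _ _ (L2_conj (L2_character _))) conj_character fejer_character.
  by rewrite -conj_character mulrCA conj_axis_char mulr1.
rewrite -(rmorphM (real_complex R)) -(rmorphD (real_complex R)) /=.
(* At x each axis term is multiplied by its weight, so the mean of V is e + 3 C - C * (sum of the
   weights), and each weight is at least 1 - 1 / (N + 1). *)
have : 3 * (1 - N.+1%:R^-1) <= \sum_i fejer_weight N (oppf (unit_freq i)) :> R.
  rewrite (_ : 3 * _ = \sum_(i < 3) (1 - N.+1%:R^-1)); last first.
    by rewrite sumr_const card_ord mulr_natl.
  by apply: ler_sum => i _; exact: fejer_weight_unit.
move: (\sum_i _) (N.+1%:R^-1) => w v wv.
nra.
Qed.

Lemma fejer_uniform f (e : R) : torus_fun f -> ccontinuous f -> 0 < e ->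
  exists N0, forall N, (N0 <= N)%N ->
  forall x, normc (f x - fejer N f x) <= e.
Proof.
(* A quarter of e for the modulus and a quarter for the gap term bound the real and the imaginary
   part by e / 2 each. *)
move=> tf cf e0; have e40 : 0 < e / 4 by rewrite divr_gt0.
have [C C0 HC] := torus_modulus tf cf e40.
have : (3 * C) * @harmonic R n @[n --> \oo] --> 3 * C * 0.
  by apply: cvgMr; exact: cvg_harmonic.
rewrite mulr0 => /cvgrPdist_lt /(_ _ e40)[N0 _ HN0]; exists N0 => N /HN0 /=.
rewrite sub0r normrN => HN x.
have {}HN : 3 * C / N.+1%:R < e / 4 by exact: le_lt_trans (ler_norm _) HN.
have [CV ReV FV] := fejer_gap N (e / 4) x C0.
set V := (fun t => _) in CV ReV FV.
pose k t : R[i] := (fejer_kernel N x t)%:C.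
have /CinftyP[tk dk] := Cinfty_fejer_kernel N x.
have ck := diff_class_ccontinuous (dk 0%N).
have /CinftyP[tV dV] := CV; have cV := diff_class_ccontinuous (dV 0%N).
have Lf := ccontinuous_L2 tf cf.
pose g := f \+ (fun=> - f x).
have tg : torus_fun g by apply: torusD.
have cg : ccontinuous g by apply: ccontinuousD => //; exact: ccontinuous_cst.
have Lg := ccontinuous_L2 tg cg.
(* Fejer means fix constants, so f x can be moved under the integral against the positive kernel. *)
have E : f x - fejer N f x = - cintegral (fun t => k t * g t).
  rewrite -(fejer_integral N x Lg) fejerD //; last first.
    by apply: ccontinuous_L2; [exact: torus_cst|exact: ccontinuous_cst].
  by rewrite fejer_cst opprD opprK addrC.
have [ig1 ig2] := ccontinuous_cintegrable (torusM tk tg) (ccontinuousM ck cg).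
have [iV1 _] := ccontinuous_cintegrable (torusM tk tV) (ccontinuousM ck cV).
have IV : rint (re_part (k \* V)) <= e / 2.
  have -> : rint (re_part (k \* V)) = complex.Re (fejer N V x).
    by rewrite (fejer_integral N x (ccontinuous_L2 tV cV)).
  by apply: le_trans FV _; move: (3 * C / _) HN => z; lra.
have bound (u : euclid3 R -> R) :
    leb3.-integrable cell (EFin \o (fun t => fejer_kernel N x t * u t)) ->
    (forall t, `|u t| <= normc (g t)) ->
    `|rint (fun t => fejer_kernel N x t * u t)| <= e / 2.
  move=> iu ug; apply: le_trans IV.
  apply: le_trans (le_normr_Rintegral measurable_cell iu) _.
  apply: (le_Rintegral measurable_cell) => //.
    exact: integrable_norm iu.
  move=> t _; rewrite normrM ger0_norm ?fejer_kernel_ge0 //.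
  rewrite /re_part /= /k ReM /= mul0r subr0 ler_wpM2l ?fejer_kernel_ge0 //.
  by rewrite ReV; apply: le_trans (ug t) _; exact: HC.
rewrite E normcN; apply: le_trans (normc_le_ReIm _) _.
rewrite [leRHS](_ : e = e / 2 + e / 2); last by rewrite -splitr.
have ReK : re_part (k \* g) = fun t => fejer_kernel N x t * re_part g t.
  by apply/funext => t; rewrite /re_part /k /= ReM /= mul0r subr0.
have ImK : im_part (k \* g) = fun t => fejer_kernel N x t * im_part g t.
  by apply/funext => t; rewrite /im_part /k /= ImM /= mul0r addr0.
rewrite ReK in ig1; rewrite ImK in ig2.
apply: lerD; rewrite /cintegral -/(k \* g) ?ReK ?ImK /=.
  by apply: bound => // t; exact: normc_geRe.
by apply: bound => // t; exact: normc_geIm.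
Qed.

Lemma fejer_Ck k f (e : R) : Ck k f -> 0 < e ->
  exists N0, forall N, (N0 <= N)%N -> Ck_bounded k (f \- fejer N f) e.
Proof.
move=> Cf e0; elim: k f Cf => [|k IH] f Cf.
  have [tf [cf _]] := Cf; have [N0 HN] := fejer_uniform tf cf e0.
  by exists N0 => N N0N; split=> // x; exact: HN.
have [tf [cf df]] := Cf; have [N0 HN] := fejer_uniform tf cf e0.
have C1 : Ck 1 f.
  split=> //; split=> // i; have [di dki] := df i; split=> //.
  by split=> //; exact: diff_class_ccontinuous dki.
have Ci i : Ck k (partial i f) by have [_ dki] := df i; split=> //; exact: torus_partial.
have /(_ _)/cid H i := IH _ (Ci i).
exists (maxn N0 (\max_i sval (H i))) => N; rewrite geq_max => /andP[/HN H0 HiN].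
split=> [x|i]; first exact: H0.
have [di _] := df i.
rewrite (partialB di (Cinfty_cderivable i (Cinfty_fejer N f))) (fejer_partial N i C1).
by apply: (svalP (H i)); apply: leq_trans HiN; exact: leq_bigmax.
Qed.

(** A Fejer mean is a finite combination of characters, hence lies in the closure of the
    multipliers, and multipliers lie in W. *)
Lemma torus_profiles_Ck_closure (r R0 : R) k : 0 < r -> r < R0 ->
  Ck_closure k (satW_infty (torus_profiles r R0)) = Ck k.
Proof.
move=> hr hrR; apply/seteqP; split=> [f []//|f Cf]; split=> // e e0.
have e40 : 0 < e / 4 by rewrite divr_gt0.
have [N0 /(_ N0 (leqnn N0)) fN] := fejer_Ck Cf e40.
have HP := multiplier_star_algebra (@torus_profiles1 R r R0).
have [_ dkf] := Cf.
have AF : smooth_closure (multiplier (torus_profiles r R0)) (fejer N0 f).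
  apply: (smooth_closureZ HP); apply: (smooth_closure_sum HP) => j.
  apply: (smooth_closure_sum HP) => l; apply: (smooth_closureZ HP).
  exact: smooth_closure_character.
have [p Pp fp] := smooth_closure_Ck HP dkf AF fN e40.
exists p.
  split; first exact: multiplier_satW (@torus_profiles1 R r R0) _ Pp.
  by have [Cp _] := Pp; exact: Cp.
apply: le_lt_trans (Ck_bounded_norm fp) _; rewrite lte_fin; lra.
Qed.

End FejerConvergence.

(** * Mean square approximation by continuous periodic functions *)

Section MeanSquareApproximation.
Context {R : realType}.
Local Notation mu := (@lebesgue_measure R).
Local Notation leb3 := ((mu \x mu) \x mu)%E.
Local Notation borel1 := (measurableTypeR R).
Local Notation borel3 :=
  (measurableTypeR R * measurableTypeR R * measurableTypeR R)%type.
Local Notation rint g := (Rintegral leb3 cell g).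
Local Notation rintegrable g := (leb3.-integrable (cell : set borel3) (EFin \o g)).
Implicit Types u v w : borel3 -> R.

Definition sq_integrable u :=
  measurable_fun setT u /\ rintegrable (fun x => u x ^+ 2).

Lemma sqrD_le (a b : R) : (a + b) ^+ 2 <= 2 * a ^+ 2 + 2 * b ^+ 2.
Proof. by have := sqr_ge0 (a - b); nra. Qed.

Lemma sq_integrable_le u v : measurable_fun setT u ->
  (forall x, u x ^+ 2 <= v x) -> rintegrable v -> sq_integrable u.
Proof.
move=> mu' uv iv; split=> //; apply: rintegrable_le iv => [|x].
  exact: measurable_funX.
by rewrite ger0_norm ?sqr_ge0.
Qed.

Lemma sq_integrableD u v : sq_integrable u -> sq_integrable v ->
  sq_integrable (fun x => u x + v x).
Proof.
move=> [mu' iu] [mv iv].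
apply: (sq_integrable_le (v := fun x => 2 * u x ^+ 2 + 2 * v x ^+ 2)).
- exact: measurable_funD.
- by move=> x; exact: sqrD_le.
- by apply: rintegrableD; exact: rintegrableZ.
Qed.

Lemma sq_integrableZ (c : R) u : sq_integrable u -> sq_integrable (fun x => c * u x).
Proof.
move=> [mu' iu].
apply: (sq_integrable_le (v := fun x => c ^+ 2 * u x ^+ 2)).
- by apply: measurable_funM => //; exact: measurable_cst.
- by move=> x; rewrite exprMn.
- exact: rintegrableZ.
Qed.

Lemma sq_integrableB u v : sq_integrable u -> sq_integrable v ->
  sq_integrable (fun x => u x - v x).
Proof.
move=> su sv; have := sq_integrableD su (sq_integrableZ (-1) sv).
by under eq_fun do rewrite mulN1r.
Qed.

Lemma bounded_sq_integrable u (M : R) : measurable_fun setT u ->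
  (forall x, `|u x| <= M) -> sq_integrable u.
Proof.
move=> mu' uM; apply: (sq_integrable_le (v := fun=> M ^+ 2)) => //.
  move=> x; rewrite -real_normK ?num_real // lerXn2r ?nnegrE //.
  exact: le_trans (normr_ge0 _) (uM x).
exact: rintegrable_cst.
Qed.

Definition sqdist u v : R := rint (fun x => (u x - v x) ^+ 2).

Lemma sqdist_triangle u v w : sq_integrable u -> sq_integrable v ->
  sq_integrable w -> sqdist u w <= 2 * sqdist u v + 2 * sqdist v w.
Proof.
move=> su sv sw; have [_ iuv] := sq_integrableB su sv.
have [_ ivw] := sq_integrableB sv sw; have [_ iuw] := sq_integrableB su sw.
rewrite /sqdist -!rintZ // -rintD; try exact: rintegrableZ.
apply: le_Rintegral; first exact: measurable_cell.
- exact: iuw.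
- by apply: rintegrableD; exact: rintegrableZ.
- move=> x _; have := sqrD_le (u x - v x) (v x - w x).
  by rewrite addrA subrK.
Qed.

Lemma sqdistD_le u u' v v' : sq_integrable u -> sq_integrable u' ->
  sq_integrable v -> sq_integrable v' ->
  sqdist (fun x => u x + u' x) (fun x => v x + v' x) <=
  2 * sqdist u v + 2 * sqdist u' v'.
Proof.
move=> su su' sv sv'.
have [_ iD] := sq_integrableB (sq_integrableD su su') (sq_integrableD sv sv').
have [_ iuv] := sq_integrableB su sv; have [_ iuv'] := sq_integrableB su' sv'.
rewrite /sqdist -!rintZ // -rintD; try exact: rintegrableZ.
apply: le_Rintegral; first exact: measurable_cell.
- exact: iD.
- by apply: rintegrableD; exact: rintegrableZ.
- move=> x _; have := sqrD_le (u x - v x) (u' x - v' x).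
  by rewrite addrACA opprD.
Qed.

Lemma sqdistZ (c : R) u v : sq_integrable u -> sq_integrable v ->
  sqdist (fun x => c * u x) (fun x => c * v x) = c ^+ 2 * sqdist u v.
Proof.
move=> su sv; have [_ iuv] := sq_integrableB su sv.
rewrite /sqdist -rintZ //; apply: eq_Rintegral => x _.
by rewrite -mulrBr exprMn.
Qed.

Definition periodic_continuous (g : euclid3 R -> R) :=
  (forall i x, g (x + (pi *+ 2) *: evec i) = g x) /\ continuous g.

Lemma periodic_continuous_ccontinuous g : periodic_continuous g ->
  torus_fun (fun x => (g x)%:C) /\ ccontinuous (fun x => (g x)%:C).
Proof.
move=> [pg cg]; split; first by move=> i x; rewrite pg.
by split; [exact: cg|exact: cst_continuous].
Qed.

Lemma periodic_continuous_sq_integrable g : periodic_continuous g ->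
  sq_integrable g.
Proof.
move=> pg; have [_ cg] := pg; have [tg ccg] := periodic_continuous_ccontinuous pg.
have [M gM] := ccontinuous_bounded tg ccg.
apply: (bounded_sq_integrable (M := M)); first exact: continuous_measurable3.
by move=> x; have := gM x; rewrite normc_real.
Qed.

Lemma periodic_continuousD g h : periodic_continuous g ->
  periodic_continuous h -> periodic_continuous (fun x => g x + h x).
Proof.
move=> [pg cg] [ph ch]; split=> [i x|x]; first by rewrite pg ph.
exact: continuousD (cg x) (ch x).
Qed.

Lemma periodic_continuousM g h : periodic_continuous g ->
  periodic_continuous h -> periodic_continuous (fun x => g x * h x).
Proof.
move=> [pg cg] [ph ch]; split=> [i x|x]; first by rewrite pg ph.
exact: continuousM (cg x) (ch x).
Qed.

Lemma periodic_continuous_cst (c : R) : periodic_continuous (fun=> c).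
Proof. by split=> [//|]; exact: cst_continuous. Qed.

(** Only the approximants are periodic; u may be any square integrable function on the cell, such as
    the indicator of a measurable set. *)
Definition approximable u := sq_integrable u /\ forall e : R, 0 < e ->
  exists2 g, periodic_continuous g & sqdist u g <= e.

Lemma sqdist_self u : sqdist u u = 0.
Proof.
rewrite /sqdist (_ : (fun _ => _) = fun=> 0).
  by rewrite (Rintegral_cst _ measurable_cell) mul0r.
by apply/funext => x; rewrite subrr expr0n.
Qed.

Lemma approximable_periodic g : periodic_continuous g -> approximable g.
Proof.
move=> pg; split; first exact: periodic_continuous_sq_integrable.
by move=> e e0; exists g => //; rewrite sqdist_self ltW.
Qed.

Lemma approximable_closed u : sq_integrable u ->
  (forall e : R, 0 < e -> exists2 v, approximable v & sqdist u v <= e) ->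
  approximable u.
Proof.
move=> su Hu; split=> // e e0; have e40 : 0 < e / 4 by rewrite divr_gt0.
have [v [sv Hv] uv] := Hu _ e40; have [g pg vg] := Hv _ e40.
exists g => //.
apply: le_trans (sqdist_triangle su sv (periodic_continuous_sq_integrable pg)) _.
lra.
Qed.

Lemma approximableD u v : approximable u -> approximable v ->
  approximable (fun x => u x + v x).
Proof.
move=> [su Hu] [sv Hv]; split; first exact: sq_integrableD.
move=> e e0; have e40 : 0 < e / 4 by rewrite divr_gt0.
have [g pg ug] := Hu _ e40; have [h ph vh] := Hv _ e40.
exists (fun x => g x + h x); first exact: periodic_continuousD.
have sg := periodic_continuous_sq_integrable pg.
have sh := periodic_continuous_sq_integrable ph.
apply: le_trans (sqdistD_le su sv sg sh) _; lra.
Qed.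

Lemma approximableZ (c : R) u : approximable u -> approximable (fun x => c * u x).
Proof.
move=> [su Hu]; split; first exact: sq_integrableZ.
move=> e e0; have c0 : 0 < c ^+ 2 + 1 by rewrite ltr_wpDl ?sqr_ge0.
have [g pg ug] := Hu _ (divr_gt0 e0 c0).
exists (fun x => c * g x).
  by apply: periodic_continuousM => //; exact: periodic_continuous_cst.
rewrite sqdistZ //; last exact: periodic_continuous_sq_integrable.
apply: le_trans (ler_wpM2l (sqr_ge0 c) ug) _.
by rewrite mulrCA ler_piMr ?(ltW e0) // ler_pdivrMr // mul1r lerDl.
Qed.

Lemma approximable0 : approximable (fun=> 0).
Proof. exact: approximable_periodic (periodic_continuous_cst 0). Qed.

(** Dominated convergence for (u - u_n)^2, with w as integrable majorant. *)
Lemma approximable_limit u (u_ : nat -> borel3 -> R) w :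
  measurable_fun setT u -> sq_integrable u ->
  (forall n, approximable (u_ n)) ->
  rintegrable w -> (forall n x, (u x - u_ n x) ^+ 2 <= w x) ->
  {ae leb3, forall x, cell x -> u_ n x @[n --> \oo] --> u x} ->
  approximable u.
Proof.
move=> mu' su Au iw uw cvu; apply: approximable_closed => // e e0.
pose f_ n (x : borel3) : \bar R := ((u x - u_ n x) ^+ 2)%:E.
have mf_ n : measurable_fun cell (f_ n).
  apply/measurable_EFinP; apply: measurable_funTS.
  by apply: measurable_funX; apply: measurable_funB => //; have [[]] := Au n.
have f_0 : {ae leb3, forall x, cell x -> f_ ^~ x @ \oo --> 0%E}.
  have [Z [mZ Z0 cvZ]] := cvu; exists Z; split=> // x nx; apply: cvZ => ux; apply: nx => cx.
  have {}ux := ux cx.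
  apply/cvg_EFin; first exact: nearW.
  have cB : u x - u_ n x @[n --> \oo] --> u x - u x.
    by apply: cvgB ux; exact: cvg_cst.
  have : (u x - u_ n x) * (u x - u_ n x) @[n --> \oo] --> (u x - u x) * (u x - u x).
    exact: cvgM.
  by rewrite subrr mulr0.
have f_w : {ae leb3, forall x n, cell x -> (`|f_ n x| <= (EFin \o w) x)%E}.
  apply: aeW => x n _ /=; rewrite ger0_norm ?sqr_ge0 // lee_fin.
  exact: uw.
have [_ _] := dominated_convergence measurable_cell mf_ (measurable_cst _) f_0 iw f_w.
rewrite integral0 => /fine_cvgP[_] /cvgrPdist_le /(_ _ e0)[n _ /(_ n (leqnn n))] /=.
rewrite sub0r normrN => un; exists (u_ n) => //.
exact: le_trans (ler_norm _) un.
Qed.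

End MeanSquareApproximation.

(** * Indicators of rays as limits of continuous periodic functions *)

Section IndicatorApproximation.
Context {R : realType}.
Local Notation mu := (@lebesgue_measure R).
Local Notation leb3 := ((mu \x mu) \x mu)%E.
Local Notation borel1 := (measurableTypeR R).
Local Notation borel3 :=
  (measurableTypeR R * measurableTypeR R * measurableTypeR R)%type.

(** The six faces lie in coordinate planes of measure 0. They are set aside because a periodic
    function takes equal values on opposite faces, whereas an indicator need not. *)
Lemma cell_boundary_negligible :
  {ae leb3, forall x, cell x -> [/\ 0 < x.1.1 < pi *+ 2,
    0 < x.1.2 < pi *+ 2 & 0 < x.2 < pi *+ 2]}.
Proof.
have null1 c : leb3.-negligible (([set c] `*` setT) `*` setT : set borel3).
  exists (([set c] `*` setT) `*` setT : set borel3); split=> //.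
    by apply: measurableX => //; exact: measurableX.
  transitivity ((mu \x mu)%E ([set c] `*` setT : set (borel1 * borel1)) * mu setT)%E.
    by apply: product_measure1E => //; exact: measurableX.
  have -> : (mu \x mu)%E ([set c] `*` setT : set (borel1 * borel1)) = (mu [set c] * mu setT)%E.
    exact: product_measure1E.
  by rewrite lebesgue_measure_set1 !mul0e.
have null2 c : leb3.-negligible ((setT `*` [set c]) `*` setT : set borel3).
  exists ((setT `*` [set c]) `*` setT : set borel3); split=> //.
    by apply: measurableX => //; exact: measurableX.
  transitivity ((mu \x mu)%E (setT `*` [set c] : set (borel1 * borel1)) * mu setT)%E.
    by apply: product_measure1E => //; exact: measurableX.
  have -> : (mu \x mu)%E (setT `*` [set c] : set (borel1 * borel1)) = (mu setT * mu [set c])%E.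
    exact: product_measure1E.
  by rewrite lebesgue_measure_set1 mule0 mul0e.
have null3 c : leb3.-negligible (setT `*` [set c] : set borel3).
  exists (setT `*` [set c] : set borel3); split=> //.
    by apply: measurableX.
  transitivity ((mu \x mu)%E (setT : set (borel1 * borel1)) * mu [set c])%E.
    by apply: product_measure1E.
  by rewrite lebesgue_measure_set1 mule0.
have := negligibleU (negligibleU (null1 0) (null1 (pi *+ 2)))
  (negligibleU (negligibleU (null2 0) (null2 (pi *+ 2)))
               (negligibleU (null3 0) (null3 (pi *+ 2)))).
apply: negligibleS => x /=; apply: contra_notP => nx cx.
have inner (t : R) : `[0, pi *+ 2]%classic t -> t <> 0 -> t <> pi *+ 2 -> 0 < t < pi *+ 2.
  rewrite /= in_itv /= => /andP[t0 t1] /eqP n0 /eqP n1.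
  by rewrite !lt_neqAle t0 t1 n1 eq_sym n0.
have [[c1 c2] c3] := cx.
split; apply: inner => // E; apply: nx.
- by left; left; split=> //; split.
- by left; right; split=> //; split.
- by right; left; left; split=> //; split.
- by right; left; right; split=> //; split.
- by right; right; left; split.
- by right; right; right; split.
Qed.

(** Convergence is asked only on the open period: periodicity ties h(0) to h(2 pi), while A may
    contain just one of these points. *)
Definition cell_nice (A : set R) := measurable (A : set borel1) /\
  exists h : nat -> R -> R,
  [/\ forall n, continuous (h n), forall n x, h n (x + pi *+ 2) = h n x,
      forall n x, 0 <= h n x <= 1 &
      forall x, 0 < x < pi *+ 2 -> h n x @[n --> \oo] --> (\1_A x : R)].

Lemma cell_nice_setT : cell_nice setT.
Proof.
split=> //; exists (fun _ _ => 1); split=> //.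
- by move=> n; exact: cst_continuous.
- by move=> n x; rewrite ler01 lexx.
- by move=> x _; rewrite indicT; exact: cvg_cst.
Qed.

(* cos (a / 2) - cos (x - a / 2) = 2 sin (x / 2) sin ((x - a) / 2) is periodic
   and, for a in the period, positive on the period exactly to the right of a. *)
Lemma cos_ray (a x : R) : 0 <= a <= pi *+ 2 -> 0 < x < pi *+ 2 ->
  (0 < cos (a / 2) - cos (x - a / 2)) = (a < x).
Proof.
move=> /andP[a0 a2] /andP[x0 x2].
pose p := x / 2; pose q := (x - a) / 2.
have -> : a / 2 = p - q by rewrite /p /q; field.
have -> : x - (p - q) = p + q by rewrite /p /q; field.
have -> : cos (p - q) - cos (p + q) = 2 * (sin p * sin q).
  by rewrite cosB cosD; ring.
rewrite pmulr_rgt0 //.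
have pi2 : pi *+ 2 = pi + pi :> R by rewrite mulr2n.
have sp : 0 < sin p.
  by apply: sin_gt0_pi; rewrite /p; move: x2; rewrite pi2 => x2; apply/andP; split; lra.
rewrite pmulr_rgt0 //; have [ax|xa] := ltP a x.
  by apply: sin_gt0_pi; rewrite /q; move: x2; rewrite pi2 => x2; apply/andP; split; lra.
apply/negbTE; rewrite -leNgt -oppr_ge0 -sinN; apply: sin_ge0_pi.
by rewrite /q; move: a2; rewrite pi2 => a2'; apply/andP; split; lra.
Qed.

Lemma cell_nice_ray (b : R) : cell_nice `]b, +oo[%classic.
Proof.
split; first exact: measurable_itv.
have pi2 : 0 < pi *+ 2 :> R by rewrite pmulrn_lgt0 // pi_gt0.
(* Clamping b to the period does not change the ray inside the open period, and puts a in the range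
   required by [cos_ray]. *)
pose a := Num.max 0 (Num.min b (pi *+ 2)).
have a02 : 0 <= a <= pi *+ 2.
  by rewrite /a le_max lexx /= ge_max (ltW pi2) /= ge_min lexx orbT.
have abE x : 0 < x < pi *+ 2 -> (b < x) = (a < x).
  by move=> /andP[x0 x2]; rewrite /a gt_max x0 /= gt_min (ltNge (pi *+ 2) x) (ltW x2) orbF.
pose theta x := cos (a / 2) - cos (x - a / 2).
(* The truncated ramp is 0 where [theta] is not positive, and is eventually 1 where it is
   positive. *)
pose h n x := Num.min 1 (n%:R * Num.max 0 (theta x)).
exists h; split.
- move=> n x.
  have ctheta : {for x, continuous theta}.
    have c1 : {for x, continuous (fun y => y - a / 2)}.
      by apply: cvgB; [exact: cvg_id|exact: cvg_cst].
    have c2 : {for x, continuous (fun y => cos (y - a / 2))}.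
      by apply: continuous_comp c1 _; exact: continuous_cos.
    exact: (cvgB (cvg_cst (cos (a / 2))) c2).
  have cmax : {for x, continuous (fun y => Num.max 0 (theta y) : R)}.
    exact: (@continuous_max _ _ (fun=> 0) theta x (cvg_cst (0 : R)) ctheta).
  have cmul : {for x, continuous (fun y => n%:R * Num.max 0 (theta y))}.
    by apply: cvgM cmax; exact: cvg_cst.
  exact: (@continuous_min _ _ (fun=> 1) _ x (cvg_cst (1 : R)) cmul).
- by move=> n x; rewrite /h /theta addrAC cosD2pi.
- move=> n x; rewrite /h le_min ler01 ge_min lexx /= mulr_ge0 // le_max lexx //.
- move=> x x02; rewrite indicE.
  have -> : (x \in `]b, +oo[%classic) = (a < x) by rewrite mem_setE in_itv /= andbT abE.
  rewrite -(cos_ray a02 x02) -/(theta x); have [t0|t0] := ltP 0 (theta x).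
    have tx : 0 < theta x := t0.
    apply: cvg_near_cst; near=> n.
    rewrite /h max_r ?ltW //; apply/eqP; rewrite eq_le ge_min lexx /= le_min lexx /=.
    rewrite -ler_pdivrMr // mul1r ltW //.
    by near: n; exact: nbhs_infty_gtr.
  rewrite /h; under eq_fun do rewrite max_l // mulr0.
  by rewrite min_r //; exact: cvg_cst.
Unshelve. all: by end_near.
Qed.

End IndicatorApproximation.

(** * Approximation of indicators of all measurable sets *)

Section MeanSquareDensity.
Context {R : realType}.
Local Notation mu := (@lebesgue_measure R).
Local Notation leb3 := ((mu \x mu) \x mu)%E.
Local Notation borel1 := (measurableTypeR R).
Local Notation borel3 :=
  (measurableTypeR R * measurableTypeR R * measurableTypeR R)%type.
Local Notation rintegrable g := (leb3.-integrable (cell : set borel3) (EFin \o g)).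

Definition approx_set (E : set borel3) :=
  measurable E /\ approximable (\1_E : borel3 -> R).

Let indic_sq_integrable (E : set borel3) : measurable E ->
  sq_integrable (\1_E : borel3 -> R).
Proof.
move=> mE; apply: (bounded_sq_integrable (M := 1)); first exact: measurable_indic.
by move=> x; rewrite indicE; case: (x \in E); rewrite ?normr1 ?normr0.
Qed.

(** All values lie in [0, 1], so the squared differences are dominated by the constant 1, integrable
    on the cell. *)
Lemma approx_set_limit (E : set borel3) (u_ : nat -> borel3 -> R) : measurable E ->
  (forall n, approximable (u_ n)) -> (forall n x, 0 <= u_ n x <= 1) ->
  {ae leb3, forall x, cell x -> u_ n x @[n --> \oo] --> (\1_E x : R)} ->
  approx_set E.
Proof.
move=> mE Au u01 cvu; split=> //.
have [mI sI] := indic_sq_integrable mE.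
apply: (approximable_limit mI (conj mI sI) Au (rintegrable_cst 1) _ cvu).
move=> n x; have /andP[h0 h1] := u01 n x; rewrite indicE.
by case: (x \in E); rewrite /= ?sub0r ?sqrrN expr_le1 ?subr_ge0 // lerBlDl lerDr.
Qed.

Lemma approx_setD (A B : set borel3) : B `<=` A ->
  approx_set A -> approx_set B -> approx_set (A `\` B).
Proof.
move=> BA [mA aA] [mB aB]; split; first exact: measurableD.
have := approximableD aA (approximableZ (-1) aB); congr approximable.
apply/funext => x; rewrite !indicE in_setD.
have [xB|xB] := boolP (x \in B); last by rewrite andbT mulr0 addr0.
have -> : x \in A by apply/mem_set/BA/set_mem.
by rewrite /= mulr1 subrr.
Qed.

Lemma approx_set_bigcup (F : nat -> set borel3) : nondecreasing_seq F ->
  (forall n, approx_set (F n)) -> approx_set (\bigcup_n F n).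
Proof.
move=> ndF aF; apply: (approx_set_limit (u_ := fun n => \1_(F n))).
- by apply: bigcupT_measurable => n; have [] := aF n.
- by move=> n; have [] := aF n.
- by move=> n x; rewrite indicE; case: (x \in F n); rewrite ler01 lexx.
apply: aeW => x _.
have [[n _ Fnx]|nF] := pselect ((\bigcup_n F n) x).
  apply: cvg_near_cst; exists n => // p /= np.
  rewrite !indicE (mem_set (ex_intro2 _ _ n I Fnx)) mem_set //.
  by have /subsetPset := ndF _ _ np; apply.
apply: cvg_near_cst; apply: nearW => p.
rewrite !indicE (memNset nF) memNset // => Fpx; apply: nF.
by exists p.
Qed.

Lemma approx_set_transfer d (T : measurableType d) (G : set (set T))
    (p : borel3 -> T) (K : set borel3) :
  setI_closed G -> @measurable d T = <<s G >> ->
  measurable_fun setT p -> measurable K ->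
  approx_set K -> (forall A, G A -> approx_set (p @^-1` A `&` K)) ->
  forall A, measurable A -> approx_set (p @^-1` A `&` K).
Proof.
move=> GI GE mp mK aK aG A; rewrite GE => sA.
apply: (@lambda_system_subset _ G GI setT
  [set A | approx_set (p @^-1` A `&` K)]) sA => //.
split=> //=.
- by rewrite preimage_setT setTI.
- move=> B C CB aB aC /=.
  rewrite (_ : _ `&` _ = (p @^-1` B `&` K) `\` (p @^-1` C `&` K)).
    by apply: approx_setD => // x [pC Kx]; split=> //; exact: CB.
  apply/seteqP; split=> [x [[pB npC] Kx]|x [[pB Kx] nCK]]; split=> //.
    by case.
  by split=> // pC; apply: nCK.
- move=> F ndF aF /=.
  rewrite (_ : _ `&` _ = \bigcup_n (p @^-1` F n `&` K)); last first.
    by apply/seteqP; split=> [x [[n _ Fn] Kx]|x [n _ [Fn Kx]]]; [exists n|split=> //; exists n].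
  apply: approx_set_bigcup => // n m nm; apply/subsetPset => x [pF Kx].
  by split=> //; have /subsetPset := ndF _ _ nm; apply.
Qed.

Definition box (A B C : set R) : set borel3 :=
  [set x | [/\ A x.1.1, B x.1.2 & C x.2]].

Lemma measurable_box (A B C : set R) : measurable (A : set borel1) ->
  measurable (B : set borel1) -> measurable (C : set borel1) -> measurable (box A B C).
Proof.
move=> mA mB mC; rewrite (_ : box A B C = (A `*` B) `*` C).
  by apply: measurableX => //; exact: measurableX.
by apply/seteqP; split=> x [] => [Ax Bx Cx|[Ax Bx] Cx]; split.
Qed.

(** The products of the one-variable approximants are periodic, continuous and converge off the
    boundary of the cell. *)
Lemma approx_set_nice_box (A B C : set R) : cell_nice A -> cell_nice B ->
  cell_nice C -> approx_set (box A B C).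
Proof.
move=> [mA [f [cf pf f01 fA]]] [mB [g [cg pg g01 gB]]] [mC [h [ch ph h01 hC]]].
apply: (approx_set_limit (u_ := fun n x => f n x.1.1 * g n x.1.2 * h n x.2)).
- exact: measurable_box.
- move=> n; apply: approximable_periodic; split.
    move=> i x; rewrite euclid3_add euclid3_scale /evec /=.
    by case: i => -[|[|[|//]]] i3 /=; rewrite ?(mulr0, mulr1, addr0) ?(pf, pg, ph).
  move=> x.
  have c1 : {for x, continuous (fun y : euclid3 R => f n y.1.1)}.
    apply: (@continuous_comp _ _ _ (fun y : euclid3 R => y.1.1)); last exact: cf.
    by apply: (@continuous_comp _ _ _ fst fst); exact: cvg_fst.
  have c2 : {for x, continuous (fun y : euclid3 R => g n y.1.2)}.
    apply: (@continuous_comp _ _ _ (fun y : euclid3 R => y.1.2)); last exact: cg.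
    by apply: (@continuous_comp _ _ _ fst snd); [exact: cvg_fst|exact: cvg_snd].
  have c3 : {for x, continuous (fun y : euclid3 R => h n y.2)}.
    apply: (@continuous_comp _ _ _ snd); last exact: ch.
    exact: cvg_snd.
  exact: continuousM (continuousM c1 c2) c3.
- move=> n x; have /andP[f0 f1] := f01 n x.1.1; have /andP[g0 g1] := g01 n x.1.2.
  have /andP[h0 h1] := h01 n x.2.
  by rewrite !mulr_ge0 //= !mulr_ile1 // mulr_ge0.
have [Z [mZ Z0 sZ]] := @cell_boundary_negligible R.
exists Z; split=> // x nx; apply: sZ => bd; apply: nx => /bd[x1 x2 x3].
have -> : (\1_(box A B C) x : R) = \1_A x.1.1 * \1_B x.1.2 * \1_C x.2.
  have inE : (x \in box A B C) = [&& x.1.1 \in A, x.1.2 \in B & x.2 \in C].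
    apply/idP/and3P => [/set_mem[a b c]|[/set_mem a /set_mem b /set_mem c]].
      by split; exact: mem_set.
    by apply/mem_set; split.
  rewrite !indicE inE; case: (x.1.1 \in A); case: (x.1.2 \in B); case: (x.2 \in C);
    by rewrite /= ?(mulr1, mulr0, mul0r).
have c1 : f n x.1.1 * g n x.1.2 @[n --> \oo] --> (\1_A x.1.1 * \1_B x.1.2 : R).
  by apply: cvgM; [exact: fA|exact: gB].
by apply: cvgM; [exact: c1|exact: hC].
Qed.

Lemma approx_set_measurable (E : set borel3) : measurable E -> approx_set E.
Proof.
have mE1 : @measurable _ borel1 = <<s (@RGenOInfty.G R) >> by exact: RGenOInfty.measurableE.
have raysI : setI_closed (@RGenOInfty.G R).
  move=> _ _ [a ->] [b ->]; exists (Num.max a b); apply/seteqP.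
  split=> t /=; rewrite !in_itv /= !andbT gt_max.
    by move=> [-> ->].
  by move=> /andP[].
have m11 : measurable_fun [set: borel3] (fun x : borel3 => x.1.1).
  exact: measurableT_comp measurable_fst measurable_fst.
have m12 : measurable_fun [set: borel3] (fun x : borel3 => x.1.2).
  exact: measurableT_comp measurable_snd measurable_fst.
have m2 : measurable_fun [set: borel3] (fun x : borel3 => x.2).
  exact: measurable_snd.
have boxE1 A B C : (fun x : borel3 => x.1.1) @^-1` A `&` box setT B C = box A B C.
  by apply/seteqP; split=> x => [[Ax [_ Bx Cx]]|[Ax Bx Cx]].
have boxE2 A B C : (fun x : borel3 => x.1.2) @^-1` B `&` box A setT C = box A B C.
  by apply/seteqP; split=> x => [[Ax [? _ Cx]]|[Ax Bx Cx]].
have boxE3 A B C : (fun x : borel3 => x.2) @^-1` C `&` box A B setT = box A B C.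
  by apply/seteqP; split=> x => [[Ax [? ? _]]|[Ax Bx Cx]].
have nT := @cell_nice_setT R.
have nray A : RGenOInfty.G A -> cell_nice A by move=> [b ->]; exact: cell_nice_ray.
have mnice A : cell_nice A -> measurable (A : set borel1) by case.
(* [s1], [s2] and [s3] pass from rays to Borel sets in one coordinate each. *)
have s1 A B C : measurable (A : set borel1) -> cell_nice B -> cell_nice C ->
    approx_set (box A B C).
  move=> mA nB nC; rewrite -boxE1; apply: (approx_set_transfer raysI mE1) => //.
  - by apply: measurable_box => //; exact: mnice.
  - exact: approx_set_nice_box.
  - by move=> A' GA'; rewrite boxE1; apply: approx_set_nice_box => //; exact: nray.
have s2 A B C : measurable (A : set borel1) -> measurable (B : set borel1) ->
    cell_nice C -> approx_set (box A B C).
  move=> mA mB nC; rewrite -boxE2; apply: (approx_set_transfer raysI mE1) => //.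
  - by apply: measurable_box => //; exact: mnice.
  - exact: s1.
  - by move=> B' GB'; rewrite boxE2; apply: s1 => //; exact: nray.
have s3 A B C : measurable (A : set borel1) -> measurable (B : set borel1) ->
    measurable (C : set borel1) -> approx_set (box A B C).
  move=> mA mB mC; rewrite -boxE3; apply: (approx_set_transfer raysI mE1) => //.
  - exact: measurable_box.
  - exact: s2.
  - by move=> C' GC'; rewrite boxE3; apply: s2 => //; exact: nray.
(* Rectangles A x B generate the plane sigma-algebra, and [s3] settles them. *)
have s4 (D : set (borel1 * borel1)) C : measurable D -> measurable (C : set borel1) ->
    approx_set (fst @^-1` D `&` box setT setT C).
  move=> mD mC.
  apply: (approx_set_transfer _ (measurable_prod_measurableType borel1 borel1)) => //.
  - move=> _ _ [A mA [B mB <-]] [A' mA' [B' mB' <-]].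
    exists (A `&` A'); first exact: measurableI.
    by exists (B `&` B'); [exact: measurableI|rewrite setXI].
  - exact: measurable_box.
  - exact: s3.
  move=> _ [A mA [B mB <-]].
  rewrite (_ : _ `&` _ = box A B C); first exact: s3.
  by apply/seteqP; split=> x => [[[Ax Bx] [_ _ Cx]]|[Ax Bx Cx]].
(* The same argument with p the identity, K the whole space, and the products D x C as
   generators. *)
move=> mE; rewrite -[E](setIT) -[E]/(id @^-1` E).
apply: (approx_set_transfer _ (measurable_prod_measurableType
  (borel1 * borel1)%type borel1)) => //.
- move=> _ _ [A mA [B mB <-]] [A' mA' [B' mB' <-]].
  exists (A `&` A'); first exact: measurableI.
  by exists (B `&` B'); [exact: measurableI|rewrite setXI].
- have := s3 setT setT setT measurableT measurableT measurableT.
  by congr approx_set; apply/seteqP; split.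
move=> _ [D mD [C mC <-]].
have := s4 D C mD mC; congr approx_set.
by apply/seteqP; split=> x => [[Dx [_ _ Cx]]|[[Dx Cx] _]].
Qed.

End MeanSquareDensity.

(** * Density of trigonometric polynomials in L^2 *)

Section SquareIntegrableDensity.
Context {R : realType}.
Local Notation mu := (@lebesgue_measure R).
Local Notation leb3 := ((mu \x mu) \x mu)%E.
Local Notation borel3 :=
  (measurableTypeR R * measurableTypeR R * measurableTypeR R)%type.
Local Notation rintegrable g := (leb3.-integrable (cell : set borel3) (EFin \o g)).
Implicit Types (f g : euclid3 R -> R[i]) (u : borel3 -> R).

Import HBNNSimple.

Lemma approximable_sum (T : Type) (s : seq T) (F : T -> borel3 -> R) :
  (forall j, approximable (F j)) -> approximable (fun x => \sum_(j <- s) F j x).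
Proof.
move=> AF; elim: s => [|j s IH].
  rewrite (_ : (fun _ => _) = fun=> 0); first exact: approximable0.
  by apply/funext => x; rewrite big_nil.
rewrite (_ : (fun _ => _) = fun x => F j x + \sum_(j <- s) F j x).
  exact: approximableD.
by apply/funext => x; rewrite big_cons.
Qed.

Lemma approximable_nnsfun (h : {nnsfun borel3 >-> R}) : approximable h.
Proof.
rewrite (_ : (h : borel3 -> R) = fun x =>
    \sum_(r <- finmap.enum_fset (fset_set (range h))) r * \1_(h @^-1` [set r]) x).
  apply: approximable_sum => r; apply: approximableZ.
  by have [] := approx_set_measurable (measurable_funPTI h (measurable_set1 r)).
by apply/funext => x; rewrite fimfunE fsbig_finite.
Qed.

(** The increasing simple approximants satisfy 0 <= s_n <= u, so (u - s_n)^2 is dominated by u^2. *)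
Lemma approximable_ge0 u : sq_integrable u -> (forall x, 0 <= u x) -> approximable u.
Proof.
move=> su u0; have [mu' iu] := su.
have mEu : measurable_fun setT (EFin \o u) by apply/measurable_EFinP.
have u0' x : [set: borel3] x -> (0 <= (EFin \o u) x)%E by rewrite lee_fin.
pose s n := nnsfun_approx measurableT mEu n.
have su_le n x : s n x <= u x.
  by rewrite -lee_fin /s nnsfun_approxE; exact: le_approx.
apply: (approximable_limit mu' su (fun n => approximable_nnsfun (s n)) iu).
  move=> n x; rewrite lerXn2r ?nnegrE ?subr_ge0 // gerBl.
  exact: fun_ge0.
apply: aeW => x _; have := cvg_nnsfun_approx measurableT mEu u0' (x := x) I.
by move/fine_cvgP => [_].
Qed.

Lemma sq_integrable_approximable u : sq_integrable u -> approximable u.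
Proof.
move=> su; have [mu' iu] := su.
have H (v : borel3 -> R) : measurable_fun setT v -> (forall x, 0 <= v x <= `|u x|) -> approximable v.
  move=> mv vu; apply: approximable_ge0 => [|x]; last by have /andP[] := vu x.
  apply: sq_integrable_le iu => // x; have /andP[v0 v1] := vu x.
  by rewrite -(real_normK (num_real (u x))) lerXn2r ?nnegrE.
have Hp : approximable (fun x => Num.max (u x) 0).
  apply: H; first exact: measurable_maxr mu' (measurable_cst _).
  move=> x; rewrite le_max lexx orbT /= ge_max normr_ge0 ler_norm //.
have Hn : approximable (fun x => Num.max (- u x) 0).
  apply: H; first by apply: measurable_maxr => //; exact: measurable_funN.
  move=> x; rewrite le_max lexx orbT /= ge_max normr_ge0 -normrN ler_norm //.
have := approximableD Hp (approximableZ (-1) Hn); congr approximable.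
apply/funext => x; rewrite mulN1r.
case: (boolP (0 <= u x)) => [u0|]; last rewrite -ltNge => /ltW u0.
  have -> : Num.max (u x) 0 = u x by apply/max_idPl.
  have -> : Num.max (- u x) 0 = 0 by apply/max_idPr; rewrite oppr_le0.
  by rewrite subr0.
have -> : Num.max (u x) 0 = 0 by apply/max_idPr.
have -> : Num.max (- u x) 0 = - u x by apply/max_idPl; rewrite oppr_ge0.
by rewrite opprK add0r.
Qed.

Lemma L2_continuous_dense f (e : R) : L2 f -> 0 < e ->
  exists g, [/\ torus_fun g, ccontinuous g & norm2 (f \- g) <= e].
Proof.
move=> Lf e0; have e20 : 0 < e / 2 by rewrite divr_gt0.
have [mre mim] := L2_cmeasurable Lf; have if2 := L2_rintegrable Lf.
have sre : sq_integrable (re_part f).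
  apply: sq_integrable_le if2 => // x.
  by rewrite sqr_normcE lerDl sqr_ge0.
have sim : sq_integrable (im_part f).
  apply: sq_integrable_le if2 => // x.
  by rewrite sqr_normcE lerDr sqr_ge0.
have [_ /(_ _ e20)[g pg fg]] := sq_integrable_approximable sre.
have [_ /(_ _ e20)[h ph fh]] := sq_integrable_approximable sim.
exists (fun x => g x +i* h x); split.
- by move=> i x; have [-> _] := pg; have [-> _] := ph.
- by split; [have [] := pg|have [] := ph].
have sg := periodic_continuous_sq_integrable pg.
have sh := periodic_continuous_sq_integrable ph.
have [_ i1] := sq_integrableB sre sg; have [_ i2] := sq_integrableB sim sh.
rewrite [e]splitr; apply: le_trans (lerD fg fh); rewrite /sqdist -rintD //.
rewrite /norm2 le_eqVlt; apply/orP; left; apply/eqP.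
apply: eq_Rintegral => x _; rewrite sqr_normcE ReD ImD ReN ImN //.
Qed.

Lemma L2_trig_dense f (e : R) : L2 f -> 0 < e ->
  exists (t : seq frequency) (c : frequency -> R[i]),
    norm2 (f \- (fun x => \sum_(n <- t) c n * character n x)) <= e.
Proof.
move=> Lf e0; have e40 : 0 < e / 4 by rewrite divr_gt0.
have [g [tg cg fg]] := L2_continuous_dense Lf e40.
have v0 := @volume_gt0 R.
(* A uniform error d costs d^2 times the volume, that is e / 4, in squared norm; then 2 (e / 4) + 2
   (e / 4) = e. *)
pose d := Num.sqrt (e / 4 / volume).
have d0 : 0 < d by rewrite sqrtr_gt0 divr_gt0.
have [N /(_ N (leqnn N)) gN] := fejer_uniform tg cg d0.
(* Frequencies are repeated in this list, and their multiplicities produce the Fejer weights. *)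
exists [seq diff_freq p.1 p.2 | p <- enum {: cube N * cube N}],
  (fun n => ((N.+1%:R ^+ 3)^-1)%:C * fhat g n).
set P := fun x => \sum_(n <- _) _.
have PE : P = fejer N g.
  apply/funext => x; rewrite /P big_map big_enum /= /fejer pair_bigA mulr_sumr /=.
  by apply: eq_bigr => p _; rewrite mulrA.
rewrite PE; have LF : L2 (fejer N g).
  by have CF := Cinfty_fejer N g; exact: Ck_L2 (CF 0%N I).
have Lg := ccontinuous_L2 tg cg.
have -> : f \- fejer N g = (f \- g) \+ (g \- fejer N g).
  by apply/funext => x /=; rewrite addrA subrK.
apply: le_trans (norm2D_le (L2B Lf Lg) (L2B Lg LF)) _.
have : norm2 (g \- fejer N g) <= d ^+ 2 * (pi *+ 2) ^+ 3.
  by apply: norm2_le gN; [exact: L2_cmeasurable (L2B Lg LF)|exact: ltW].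
rewrite sqr_sqrtr ?(ltW (divr_gt0 e40 v0)) // divfK ?gt_eqF //; lra.
Qed.

End SquareIntegrableDensity.

(** * Density of the saturation space in H^1 *)

Section SobolevDensity.
Context {R : realType}.
Implicit Types (f g h : euclid3 R -> R[i]).

Lemma weak_partialsB i f g f' g' : L2 f -> L2 f' ->
  weak_partials i f g -> weak_partials i f' g' ->
  weak_partials i (f \- f') (g \- g').
Proof.
move=> Lf Lf' [Lg Hg] [Lg' Hg']; split; first exact: L2B.
move=> phi Cphi.
have Lphi : L2 phi by exact: Ck_L2 (Cphi 0%N I).
have Ldphi : L2 (partial i phi).
  by have CP := Cinfty_partial i Cphi; exact: Ck_L2 (CP 0%N I).
have sub u v p : L2 u -> L2 v -> L2 p ->
    cintegral ((u \- v) \* p) = cintegral (u \* p) - cintegral (v \* p).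
  move=> Lu Lv Lp; rewrite -mulN1r.
  rewrite -(cintegralZ (-1) (L2M_cintegrable Lv Lp)) -cintegralD.
  - by congr cintegral; apply/funext => x /=; rewrite mulN1r mulrBl.
  - exact: L2M_cintegrable.
  - by apply: cintegrableZ; exact: L2M_cintegrable.
by rewrite !sub // Hg // Hg' // opprD.
Qed.

(** Every Fourier sum of h is zero, so by best approximation the norm of h is at most its distance
    to any trigonometric polynomial, which can be made arbitrarily small. *)
Lemma fhat_eq0_norm2 h : L2 h -> (forall n, fhat h n = 0) -> norm2 h = 0.
Proof.
move=> Lh h0; apply/eqP; rewrite eq_le norm2_ge0 andbT.
apply/ler_addgt0Pl => e e0; rewrite addr0.
have [t [c tc]] := L2_trig_dense Lh e0; apply: le_trans tc.
have := fourier_sum_best (s := undup t) c Lh (undup_uniq t).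
move=> /(_ t); rewrite (_ : h \- fourier_sum (undup t) h = h).
  by apply => n; rewrite mem_undup.
apply/funext => x /=; rewrite /fourier_sum big1 ?subr0 // => n _.
by rewrite h0 mul0r.
Qed.

(** Two weak derivatives have the same Fourier coefficients, so their difference has norm 0; the
    factor 2 comes from [norm2D_le]. This controls whichever weak derivative [xget] selects in
    [H1_norm]. *)
Lemma weak_partial_norm2_le i f g g' : L2 f -> weak_partials i f g ->
  weak_partials i f g' -> norm2 g <= 2 * norm2 g'.
Proof.
move=> Lf wg wg'; have [Lg _] := wg; have [Lg' _] := wg'.
have -> : g = (g \- g') \+ g' by apply/funext => x /=; rewrite subrK.
apply: le_trans (norm2D_le (L2B Lg Lg') Lg') _.
rewrite fhat_eq0_norm2 ?mulr0 ?add0r //; first exact: L2B.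
move=> n; rewrite fhatB // (fhat_weak_partial n Lf wg) (fhat_weak_partial n Lf wg').
by rewrite subrr.
Qed.

Lemma torus_profiles_H1_dense (r R0 : R) : 0 < r -> r < R0 ->
  H1_dense (satW_infty (torus_profiles r R0)).
Proof.
move=> hr hrR f [Lf Hf] e e0.
have /(_ _)/cid H i := Hf i; pose g i := sval (H i).
have wg i : weak_partials i f (g i) := svalP (H i).
have Lg i : L2 (g i) by have [] := wg i.
(* The function contributes at most 4 eta and each of the three derivatives 8 eta, in total 28 eta =
   e^2 / 2, strictly below e^2. *)
pose eta := e ^+ 2 / 56.
have eta0 : 0 < eta by rewrite divr_gt0 // exprn_gt0.
have [tf [cf tfP]] := L2_trig_dense Lf eta0.
have /(_ _)/cid T i := L2_trig_dense (Lg i) eta0.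
(* One frequency set for f and its three weak derivatives. *)
pose s := undup (tf ++ flatten [seq sval (T i) | i <- enum 'I_3]).
have us : uniq s := undup_uniq _.
have tfs : {subset tf <= s} by move=> n nt; rewrite mem_undup mem_cat nt.
have tgs i : {subset sval (T i) <= s}.
  move=> n nt; rewrite mem_undup mem_cat; apply/orP; right.
  by apply/flattenP; exists (sval (T i)) => //; apply/mapP; exists i; rewrite ?mem_enum.
pose S := fourier_sum s f.
have CS : Cinfty S := Cinfty_fourier_sum s f.
have fS : norm2 (f \- S) <= eta by apply: le_trans (fourier_sum_best cf Lf us tfs) tfP.
(* Differentiating the truncated series of f gives that of its weak derivative, so S approximates in
   H^1. *)
have dS i : partial i S = fourier_sum s (g i).
  by apply: fourier_sum_partial => n; exact: fhat_weak_partial.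
have gS i : norm2 (g i \- partial i S) <= eta.
  rewrite dS; have [c cP] := svalP (T i).
  exact: le_trans (fourier_sum_best c (Lg i) us (tgs i)) cP.
have HP := multiplier_star_algebra (@torus_profiles1 R r R0).
have AS : smooth_closure (multiplier (torus_profiles r R0)) S.
  apply: (smooth_closure_sum HP) => n; apply: (smooth_closureZ HP).
  exact: smooth_closure_character.
have v0 := @volume_gt0 R.
(* A C^1 error d translates into a squared L^2 error of eta for the function and each derivative. *)
pose d := Num.sqrt (eta / volume).
have d0 : 0 < d by rewrite sqrtr_gt0 divr_gt0.
have d2 : d ^+ 2 * (pi *+ 2) ^+ 3 = eta.
  by rewrite sqr_sqrtr ?(ltW (divr_gt0 eta0 v0)) // divfK // gt_eqF.
have [_ /(_ 1%N d d0)[w Pw [Sw0 Sw1]]] := AS.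
have [Cw _] := Pw.
have Ww : satW_infty (torus_profiles r R0) w.
  exact: multiplier_satW (@torus_profiles1 R r R0) _ Pw.
have LS : L2 S := Ck_L2 (CS 0%N I).
have Lw : L2 w := Ck_L2 (Cw 0%N I).
have LdS i : L2 (partial i S) by have CP := Cinfty_partial i CS; exact: Ck_L2 (CP 0%N I).
have Ldw i : L2 (partial i w) by have CP := Cinfty_partial i Cw; exact: Ck_L2 (CP 0%N I).
have tri u v p : L2 u -> L2 v -> L2 p -> norm2 (u \- v) <= eta ->
    norm2 (v \- p) <= eta -> norm2 (u \- p) <= 4 * eta.
  move=> Lu Lv Lp uv vp.
  have -> : u \- p = (u \- v) \+ (v \- p).
    by apply/funext => x /=; rewrite addrA subrK.
  by apply: le_trans (norm2D_le (L2B Lu Lv) (L2B Lv Lp)) _; lra.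
have Sw : norm2 (S \- w) <= eta.
  by rewrite -d2; apply: norm2_le Sw0; [exact: L2_cmeasurable (L2B LS Lw)|exact: ltW].
have dSw i : norm2 (partial i S \- partial i w) <= eta.
  rewrite -d2; apply: norm2_le; [exact: L2_cmeasurable (L2B _ _)|exact: ltW|].
  have [] := Sw1 i.
  by rewrite (partialB (Cinfty_cderivable i CS) (Cinfty_cderivable i Cw)).
have ww i : weak_partials i w (partial i w) := Ck_weak_partial i (Cw 1%N I).
exists w.
  by split=> //; split=> // i; exists (partial i w).
have Lfw := L2B Lf Lw.
have wfw i := weak_partialsB Lf Lw (wg i) (ww i).
rewrite /H1_norm (L2_sqnormE Lfw).
(* The value chosen by [xget] is a genuine weak derivative, since [g i \- partial i w] shows that
   one exists. *)
pose G i := xget (fun=> 0) (weak_partials i (f \- w)).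
have wG i : weak_partials i (f \- w) (G i) by apply: xgetPex; exists (g i \- partial i w).
have GE i : norm2 (G i) <= 8 * eta.
  apply: le_trans (weak_partial_norm2_le Lfw (wG i) (wfw i)) _.
  have := tri _ _ _ (Lg i) (LdS i) (Ldw i) (gS i) (dSw i); lra.
rewrite (eq_bigr (fun i => (norm2 (G i))%:E)); last first.
  by move=> i _; have [LG _] := wG i; exact: L2_sqnormE.
rewrite sumEFin -EFinD.
have total : norm2 (f \- w) + \sum_i norm2 (G i) <= 28 * eta.
  have := tri _ _ _ Lf LS Lw fS Sw.
  have : \sum_i norm2 (G i) <= \sum_(i < 3) 8 * eta by apply: ler_sum.
  rewrite sumr_const card_ord -mulr_natr; lra.
rewrite /= lte_fin -[e](ger0_norm (ltW e0)) -sqrtr_sqr ltr_sqrt ?exprn_gt0 //.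
apply: le_lt_trans total _; rewrite /eta.
have : 0 < e ^+ 2 by rewrite exprn_gt0.
lra.
Qed.

End SobolevDensity.

Unset Implicit Arguments.
Local Close Scope complex_scope.

Theorem proposition4p13 (R : realType) (r R0 : R) (hr : 0 < r) (hrR : r < R0) :
  [/\ forall k : nat, (1 <= k)%N ->
        Ck_closure k (satW_infty (torus_profiles r R0)) = Ck k,
      cubic_saturating (torus_profiles r R0) &
      forall (m : nat) (b : 'I_m -> euclid3 R -> R[i]),
        (forall j, Cinfty (b j)) ->
        Ck_closure 1 (satW_infty b) = Ck 1 ->
        (3 <= m)%N].
Proof.
split=> [k _||m b Cb bdense].
- exact: torus_profiles_Ck_closure hr hrR.
- split; first exact: Cinfty_torus_profiles.
  exact: torus_profiles_H1_dense hr hrR.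
- exact: Ck_dense_family_size Cb bdense.
Qed.
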